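(* Let $k$ be an algebraically closed field of characteristic $0$. For all $m,n\geq 1$ there is an isomorphism of $S_n$-representations $$G^{(n)}(A_m)\simeq\bigoplus_{\substack{\mu\vartriangleright\lambda\\ \mu_1=\lambda_1}}\kappa_\lambda K_{\mu\lambda}V_\mu,$$ where $\lambda=(\lambda_1,\lambda_2,\dots)$ and $\mu=(\mu_1,\mu_2,\dots)$ are weakly decreasing sequences running over partitions of $n$ into at most $\min(n,m+1)$ parts, and $$\kappa_\lambda:=\binom{m}{k_0;\dots;k_{n-1}}=\frac{m!}{k_0!\,k_1!\cdots k_{n-1}!}$$ is the multinomial coefficient with $k_j:=\#\{i\neq 1\mid \lambda_i=j\}$ for $j>0$ and $k_0:=m-\sum_{j>0}k_j$. In particular, $$\dim_k G^{(n)}(A_m)=\sum_{\substack{\mu\vartriangleright\lambda\\ \mu_1=\lambda_1}}\kappa_\lambda K_{\mu\lambda}\dim V_\mu ,$$ and the Hilbert function of $G^{(n)}(A_m)$ is given by $$h_{G^{(n)}(A_m)}(i)=\sum_{\substack{\mu\vartriangleright\lambda\\ \mu_1=\lambda_1=n-i}}\kappa_\lambda K_{\mu\lambda}\dim V_\mu .$$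
   Context: For $m,n\ge 1$, let $A_m=k[x_1,\dots,x_m]/(x_1,\dots,x_m)^2$. Its higher Galois closure is $$G^{(n)}(A_m)=k[x_{i,j}\mid 1\le i\le m,\ 1\le j\le n]/I,\qquad I=\Bigl(\sum_{j=1}^n x_{i,j}\ \Big|\ 1\le i\le m\Bigr)+\sum_{j=1}^n (x_{1,j},\dots,x_{m,j})^2 .$$ It is $\mathbb{Z}$-graded with every $x_{i,j}$ of degree $1$, and $h_{G^{(n)}(A_m)}(i)$ is the $k$-dimension of its degree $i$ part. The symmetric group $S_n$ acts by $\sigma(x_{i,j})=x_{i,\sigma(j)}$. Here $V_\mu$ is the Specht module (irreducible $S_n$-representation over $k$) associated to the partition $\mu$; $K_{\mu\lambda}$ is the Kostka number, i.e. the number of semi-standard Young tableaux of shape $\mu$ and content $\lambda$; and $\mu\vartriangleright\lambda$ means that $\mu$ dominates $\lambda$, i.e. $\mu_1+\dots+\mu_r\geq\lambda_1+\dots+\lambda_r$ for all $r$ (equality $\mu=\lambda$ allowed). *)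

(* Defs.v *)
From HB Require Import structures.
From mathcomp Require Import all_boot all_order all_fingroup all_algebra.
From mathcomp Require Import mxrepresentation character.
From mathcomp Require Import generic_quotient ring_quotient.
From mathcomp Require Import mpoly.
From mathcomp.classical Require Import boolp.

Set Implicit Arguments.
Unset Strict Implicit.
Unset Printing Implicit Defensive.

Import GRing.Theory.

Local Open Scope ring_scope.
Local Open Scope quotient_scope.

(* Partitions of n into at most l parts, padded with zeros to length l. *)
Definition intpart (n l : nat) :=
  {p : l.-tuple 'I_n.+1 |
    sorted geq (map val p) && (sumn (map val p) == n)}.

HB.instance Definition _ (n l : nat) := SubFinite.on (intpart n l).

Section Partitions.

Variables n l : nat.
Implicit Types (lambda mu : intpart n l).

Definition parts mu : seq nat := map val (val mu).

(* [part mu i] is mu_(i+1): rows, columns and letters are numbered from 0. *)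
Definition part mu (i : nat) : nat := nth 0%N (parts mu) i.

(* The partial sums are constant from r = l on. *)
Definition dominates mu lambda : bool :=
  [forall r : 'I_l.+1,
    (\sum_(i < r) part lambda i <= \sum_(i < r) part mu i)%N].

Definition cell mu := {c : 'I_l * 'I_n | (c.2 < part mu c.1)%N}.

HB.instance Definition _ mu := SubFinite.on (cell mu).

Definition row_of mu (c : cell mu) : 'I_l := (val c).1.
Definition col_of mu (c : cell mu) : 'I_n := (val c).2.

Definition semistandard mu (T : {ffun cell mu -> 'I_l}) : bool :=
  [forall c, forall d,
    ((row_of c == row_of d) && (col_of c <= col_of d)%N ==> (T c <= T d)%N)
 && ((col_of c == col_of d) && (row_of c < row_of d)%N ==> (T c < T d)%N)].

Definition has_content mu lambda (T : {ffun cell mu -> 'I_l}) : bool :=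
  [forall a : 'I_l, #|[set c | T c == a]| == part lambda a].

Definition kostka mu lambda : nat :=
  #|[set T : {ffun cell mu -> 'I_l} | semistandard T && has_content lambda T]|.

(* k_j, for j > 0: the number of parts equal to j, the first one excluded. *)
Definition kmult lambda (j : nat) : nat := count_mem j (behead (parts lambda)).

(* For l <= m.+1 the subtraction defining k_0 does not truncate, and the
   division is exact. *)
Definition kappa (m : nat) lambda : nat :=
  (m`! %/ ((m - \sum_(1 <= j < n) kmult lambda j)`!
           * \prod_(1 <= j < n) (kmult lambda j)`!))%N.

End Partitions.

(* The product of permutations is (s * t) x = t (s x), so 'S_n acts on the
   right, as everywhere in the matrix representation library. *)

Section Specht.

Variables (k : fieldType) (n l : nat).

Definition word := {ffun 'I_n -> 'I_l}.

HB.instance Definition _ := Finite.on word.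

Definition word_act (w : word) (s : 'S_n) : word := [ffun x => w ((s^-1)%g x)].

Definition word_mx (s : 'S_n) : 'M[k]_#|{: word}| :=
  \matrix_(a, b) (enum_val b == word_act (enum_val a) s)%:R.

Definition word_vec (w : word) : 'rV[k]_#|{: word}| :=
  delta_mx 0 (enum_rank w).

Lemma word_actM w s t : word_act w (s * t)%g = word_act (word_act w s) t.
Proof. by apply/ffunP=> x; rewrite !ffunE invMg permM. Qed.

Lemma word_act1 w : word_act w 1%g = w.
Proof. by apply/ffunP=> x; rewrite ffunE invg1 perm1. Qed.

Lemma word_vecE w s : word_vec w *m word_mx s = word_vec (word_act w s).
Proof.
apply/rowP=> b; rewrite -rowE !mxE enum_rankK eqxx /=.
by congr (_%:R); rewrite -(inj_eq enum_rank_inj) enum_valK.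
Qed.

Lemma word_mx_repr : mx_repr [set: 'S_n] word_mx.
Proof.
have ext (A B : 'M[k]_#|{: word}|) :
    (forall w, word_vec w *m A = word_vec w *m B) -> A = B.
  move=> AB; apply/row_matrixP=> a; rewrite !rowE.
  by have := AB (enum_val a); rewrite /word_vec enum_valK.
split=> [|s t _ _]; apply: ext => w.
  by rewrite word_vecE word_act1 mulmx1.
by rewrite mulmxA !word_vecE word_actM.
Qed.

Definition word_repr := MxRepresentation word_mx_repr.

Variable mu : intpart n l.

(* A bijective filling of the diagram by 'I_n, given by the cell in which each
   entry sits; as there are n cells, injectivity suffices. *)
Definition tableau := {t : {ffun 'I_n -> cell mu} | injectiveb t}.

HB.instance Definition _ := SubFinite.on tableau.

Definition column_stab (t : tableau) : {set 'S_n} :=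
  [set s : 'S_n | [forall x, col_of (val t (s x)) == col_of (val t x)]].

(* The tabloid {t}, encoded by the map sending an entry to its row. *)
Definition tabloid (t : tableau) : word := [ffun x => row_of (val t x)].

Definition polytabloid (t : tableau) : 'rV[k]_#|{: word}| :=
  \sum_(s in column_stab t) (-1) ^+ s *: word_vec (word_act (tabloid t) s).

(* The span of the polytabloids. The words with mu_i letters i, for all i, are
   exactly the tabloids of shape mu; they span the permutation module M^mu in
   which the polytabloids live. *)
Definition specht_mx : 'M[k]_#|{: word}| :=
  (\sum_(t : tableau) <<polytabloid t>>)%MS.

Lemma tableau_act_proof (t : tableau) (s : 'S_n) :
  injectiveb [ffun x => val t ((s^-1)%g x)].
Proof.
apply/injectiveP=> x y; rewrite !ffunE => /(injectiveP _ (valP t)).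
exact: perm_inj.
Qed.

Definition tableau_act t s : tableau :=
  exist (fun u : {ffun 'I_n -> cell mu} => injectiveb u) _
    (tableau_act_proof t s).

Lemma polytabloid_act t s :
  polytabloid t *m word_mx s = polytabloid (tableau_act t s).
Proof.
rewrite /polytabloid mulmx_suml [RHS](reindex_inj (conjg_inj s)) /=.
apply: eq_big => [u|u _].
  rewrite !inE; apply/forallP/forallP=> fix_u x.
    by rewrite !ffunE /conjg !permM permK; apply: fix_u.
  have := fix_u (s x).
  by rewrite !ffunE /conjg !permM !permK.
rewrite odd_permJ -scalemxAl word_vecE -word_actM; congr (_ *: word_vec _).
apply/ffunP=> x; rewrite !ffunE /=; congr (row_of (val t _)).
by rewrite !invMg invgK !permM permK.
Qed.

Lemma specht_mxmodule : mxmodule word_repr specht_mx.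
Proof.
apply/mxmoduleP=> s _; rewrite /specht_mx sumsmxMr; apply/sumsmx_subP=> t _.
rewrite (eqmxMr _ (genmxE _)) /= polytabloid_act.
by apply: (sumsmx_sup (tableau_act t s)); rewrite ?genmxE.
Qed.

Definition specht : representation k [set: 'S_n] :=
  Representation (submod_repr specht_mxmodule).

End Specht.

Section GaloisClosure.

Variables (k : fieldType) (m n : nat).

Definition xvar (i : 'I_m) (j : 'I_n) : {mpoly k[m * n]} :=
  'X_(mxvec_index i j).

(* The sums \sum_j x_(i,j), and, for each j, the products x_(i,j) x_(i',j),
   which generate (x_(1,j), ..., x_(m,j))^2. *)
Definition galgen (r : 'I_m + 'I_m * 'I_m * 'I_n) : {mpoly k[m * n]} :=
  match r with
  | inl i => \sum_(j < n) xvar i j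
  | inr (i, i', j) => xvar i j * xvar i' j
  end.

Definition galideal : pred {mpoly k[m * n]} :=
  fun p => `[< exists c, p = \sum_r c r * galgen r >].

Lemma galideal_closed : idealr_closed galideal.
Proof.
split=> [||a u v /asboolP[c ->] /asboolP[d ->]].
- by apply/asboolP; exists (fun=> 0); rewrite big1 // => r _; rewrite mul0r.
- apply/asboolP=> -[c /(congr1 (meval (fun=> 0)))].
  rewrite meval1 rmorph_sum /= big1 => [/eqP|r _]; first by rewrite oner_eq0.
  rewrite rmorphM /=; case: r => [i|[[i i'] j]] /=.
    by rewrite rmorph_sum big1 ?mulr0 // => j _; rewrite /= mevalXU.
  by rewrite rmorphM /= mevalXU !mul0r mulr0.
apply/asboolP; exists (fun r => a * c r + d r).
rewrite mulr_sumr -big_split; apply: eq_bigr => r _ /=.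
by rewrite mulrDl mulrA.
Qed.

HB.instance Definition _ :=
  isIdealr.Build {mpoly k[m * n]} galideal galideal_closed.

Definition galclosure := 
  {ideal_quot (galideal : idealr {mpoly k[m * n]})}.

HB.instance Definition _ := GRing.ComNzRing.on galclosure.

Definition galpi (p : {mpoly k[m * n]}) : galclosure :=
  \pi_galclosure p.


HB.instance Definition _ := GRing.RMorphism.copy galpi \pi_galclosure.

Lemma galpi_eq p q : (galpi p == galpi q) = (p - q \in galideal).
Proof. by rewrite Quotient.idealrBE. Qed.
Definition galscale (a : k) (x : galclosure) : galclosure :=
  galpi (a *: repr x).

Lemma galpiZ a p : galscale a (galpi p) = galpi (a *: p).
Proof.
apply/eqP; rewrite /galscale galpi_eq -scalerBr -mul_mpolyC.
apply: idealMr.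
by rewrite -galpi_eq /galpi reprK.
Qed.

Lemma galscaleA a b x : galscale a (galscale b x) = galscale (a * b) x.
Proof. by rewrite -[x]reprK -/(galpi _) !galpiZ scalerA. Qed.

Lemma galscale1 : left_id 1 galscale.
Proof. by move=> x; rewrite -[x]reprK -/(galpi _) galpiZ scale1r. Qed.

Lemma galscaleDr : right_distributive galscale +%R.
Proof.
move=> a x y; rewrite -[x]reprK -[y]reprK -!/(galpi _).
by rewrite -rmorphD !galpiZ scalerDr rmorphD.
Qed.

Lemma galscaleDl x : {morph galscale^~ x : a b / a + b}.
Proof.
move=> a b; rewrite -[x]reprK -!/(galpi _).
by rewrite !galpiZ scalerDl rmorphD.
Qed.

HB.instance Definition _ := GRing.Zmodule_isLmodule.Build k galclosure
  galscaleA galscale1 galscaleDr galscaleDl.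

Lemma galpi_scalable : scalable galpi.
Proof. by move=> a p; rewrite /= -galpiZ. Qed.

HB.instance Definition _ := GRing.isScalable.Build k _ galclosure _ galpi
  galpi_scalable.

(* The substitution x_(i,j) |-> x_(i,s j): [mxvec] sends position
   [mxvec_index i j] to the entry (i, j). *)
Definition perm_subst (s : 'S_n) : (m * n).-tuple {mpoly k[m * n]} :=
  [tuple mxvec (\matrix_(i < m, j < n) xvar i (s j)) 0 v | v < m * n].

Definition poly_act (s : 'S_n) (p : {mpoly k[m * n]}) : {mpoly k[m * n]} :=
  p \mPo perm_subst s.

Lemma poly_act_xvar s i j : poly_act s (xvar i j) = xvar i (s j).
Proof. by rewrite /poly_act comp_mpolyXU -tnth_nth tnth_mktuple mxvecE mxE. Qed.

Lemma poly_act_ideal s p : p \in galideal -> poly_act s p \in galideal.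
Proof.
move=> /asboolP[c ->]; rewrite /poly_act rmorph_sum /=.
apply: (@rpred_sum _ (galideal : idealr {mpoly k[m * n]})) => r _.
rewrite rmorphM /=; apply: idealMr.
suff [r' ->] : exists r', galgen r \mPo perm_subst s = galgen r'.
  apply/asboolP; exists (fun r => (r == r')%:R).
  rewrite (bigD1 r') //= eqxx mul1r big1 ?addr0 // => q /negPf->.
  by rewrite mul0r.
case: r => [i|[[i i'] j]].
  exists (inl i); rewrite /= rmorph_sum [RHS](reindex_inj (@perm_inj _ s)) /=.
  by apply: eq_bigr => j _; apply: poly_act_xvar.
exists (inr (i, i', s j)); rewrite /= rmorphM /=.
by congr (_ * _); apply: poly_act_xvar.
Qed.

Definition gal_act (s : 'S_n) (x : galclosure) : galclosure :=
  galpi (poly_act s (repr x)).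

Lemma gal_act_pi s p : gal_act s (galpi p) = galpi (poly_act s p).
Proof.
apply/eqP; rewrite /gal_act galpi_eq /poly_act -rmorphB.
by apply: poly_act_ideal; rewrite -galpi_eq /galpi reprK.
Qed.

(* The degree d part: the classes of homogeneous polynomials of degree d. *)
Definition gal_degree (d : int) (x : galclosure) : Prop :=
  exists2 p, {in msupp p, forall u : 'X_{1.. m * n}, (mdeg u)%:Z = d}
           & x = galpi p.

End GaloisClosure.

Definition affords (k : fieldType) (n : nat) (V : lmodType k)
    (act : 'S_n -> V -> V) (rG : representation k [set: 'S_n]) : Prop :=
  exists2 f : {linear V -> 'rV[k]_(rdegree rG)},
    bijective f & forall s v, f (act s v) = f v *m rG s.

Definition has_dim (k : fieldType) (V : lmodType k) (U : V -> Prop) (d : nat) :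
    Prop :=
  exists2 f : {linear 'rV[k]_d -> V},
    injective f & forall v, U v <-> exists u, v = f u.

(* Main.v *)
From HB Require Import structures.
Require Import Defs.
From mathcomp Require Import all_boot all_order all_fingroup all_algebra zify.
From mathcomp Require Import pgroup mxrepresentation character.
From mathcomp Require Import generic_quotient ring_quotient mpoly.
From mathcomp.classical Require Import boolp.

Set Implicit Arguments.
Unset Strict Implicit.
Unset Printing Implicit Defensive.

Import GRing.Theory.

(** The n-th tensor power of A_m has as a basis the words of
    length n in the letters 0, ..., m: the letter i > 0 at position j stands for
    x_(i,j), and the letter 0 for no variable. Its part of degree d is spanned by
    the words with n - d zeros, and it is the direct sum of the permutation
    modules spanned by the words of a given content c (c_a letters a) with
    c_0 = n - d. The Galois closure is the quotient by the images of the raising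
    operators, which replace a zero by the letter i in all possible ways
    (coefs_ideal, galpi_relations). These images are spanned by their parts of
    given content (prj_relations), so contents can be treated one at a time.

    Let c be a content and mu a partition, with its Young symmetrizer ysym. The
    quotient of the permutation module of c keeps exactly the Specht modules with
    mu_1 = c_0. If mu_1 < c_0, two zeros lie in the same column of a tableau of
    shape mu, and the symmetrizer kills all words of content c. If mu_1 = c_0,
    the relations come from words with c_0 + 1 zeros and are killed for the same
    reason (rel_mod_ysym0), so the Specht module survives with its full
    multiplicity. If mu_1 > c_0, then a word, symmetrized along the first row of
    a tableau, is a relation: the first row contains a nonzero letter, and
    applying a raising operator to the word where this letter has been removed
    expresses the symmetrized word by words with more zeros in the first row;
    this can be iterated until there are none left outside of it
    (row_sum_sub_relations, compl_mod_ysym0).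

    The multiplicity of the Specht module of mu in the permutation module of c is
    a Kostka number (Young's rule, cont_mult_ssyts). Here is a proof by counting.
    A linear independence argument, in which a filling is compared with its
    rearrangements through the rearrangement inequality, shows that the
    multiplicity is at least the number of semistandard tableaux (ssyts_le_rank)
    and that the dimension of the Specht module is at least the number of
    standard tableaux (ssyts_le_specht). Now in any representation V the Specht
    modules, which are simple and pairwise non-isomorphic, generate a submodule
    of dimension the sum over mu of multiplicity times dimension, so this sum is
    at most dim V, and if there is equality then V is determined by its
    multiplicities (sum_mult_le, mult_complete). For the permutation module of c
    the lower bounds already sum up to its dimension, by the numerical form of the
    Robinson-Schensted-Knuth correspondence (sum_chains_nwords). Hence all bounds
    are equalities. Splitting a permutation module into the relations and a
    complement, the equality passes to both (compl_mod_complete).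

    It remains to sum over c. The Kostka number only depends on the decreasing
    rearrangement lambda of c, and kappa counts the contents c with c_0 = lambda_1
    whose rearrangement is lambda (card_sorts, sum_cont_mult). *)

(** * Counting chains of horizontal strips *)

Lemma sum_bool (I : finType) (P Q : pred I) :
  \sum_(i | P i) (Q i : nat) = #|[set i | P i && Q i]|.
Proof.
by rewrite -sum1dep_card big_mkcondr; apply: eq_bigr => i _; case: (Q i).
Qed.

Section Chains.

Variables p q : nat.

(** Row lengths, in no particular order: the strips below force both of their
    shapes to be partitions, so that sums over strips need no side condition. *)
Definition diagram := {ffun 'I_p -> 'I_q.+1}.

HB.instance Definition _ := Finite.on diagram.

Implicit Types (mu nu rho : diagram) (c : nat -> nat).

Definition rowlen mu (i : nat) : nat :=
  if insub i is Some j then mu j : nat else 0.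

Definition ssize mu : nat := \sum_(i < p) rowlen mu i.

(** Interlacing of the row lengths: mu / rho has at most one box per column. *)
Definition hstrip rho mu : bool :=
  [forall i : 'I_p, rowlen mu i.+1 <= rowlen rho i <= rowlen mu i].

Definition covers rho mu : bool := hstrip rho mu && (ssize mu == (ssize rho).+1).

(** A semistandard tableau is the chain of the shapes filled by its letters
    smaller than a, for a = 0, ..., L; so this is a Kostka number, and for
    c = 1 the number of standard tableaux. *)
Fixpoint chains c (L : nat) mu : nat :=
  if L is L'.+1 then
    \sum_(rho | hstrip rho mu && (ssize mu == ssize rho + c L')) chains c L' rho
  else (ssize mu == 0).

Definition decr c (a : nat) : nat -> nat := fun b => c b - (b == a).

Lemma rowlen_ord mu (i : 'I_p) : rowlen mu i = mu i.
Proof. by rewrite /rowlen valK. Qed.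

Lemma rowlen_out mu i : p <= i -> rowlen mu i = 0.
Proof. by move=> pi; rewrite /rowlen insubN // -leqNgt. Qed.

Lemma rowlen_inj mu nu : (forall i, i < p -> rowlen mu i = rowlen nu i) -> mu = nu.
Proof.
move=> E; apply/ffunP=> i; apply/val_inj.
by have := E i (ltn_ord i); rewrite !rowlen_ord.
Qed.

Lemma hstripP rho mu :
  reflect (forall i, rowlen mu i.+1 <= rowlen rho i <= rowlen mu i)
          (hstrip rho mu).
Proof.
apply: (iffP forallP) => [H i|H i]; last exact: H.
case: (ltnP i p) => [ip|pi]; first exact: (H (Ordinal ip)).
by rewrite !rowlen_out // (leq_trans pi).
Qed.

Lemma hstrip_size rho mu : hstrip rho mu -> ssize rho <= ssize mu.
Proof. by move/hstripP=> H; apply: leq_sum => i _; case/andP: (H i). Qed.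

Lemma rowlen_size mu i : rowlen mu i <= ssize mu.
Proof.
case: (ltnP i p) => [ip|pi]; last by rewrite rowlen_out.
by rewrite /ssize (bigD1 (Ordinal ip)) //= leq_addr.
Qed.

Lemma chains_ext c c' L mu :
  (forall a, a < L -> c a = c' a) -> chains c L mu = chains c' L mu.
Proof.
elim: L mu => //= L IH mu E; rewrite E //.
by apply: eq_bigr => rho _; apply: IH => a aL; apply: E; apply: ltnW.
Qed.

Lemma chains_rows c L mu i : chains c L mu != 0 -> L <= i -> rowlen mu i = 0.
Proof.
elim: L mu i => [|L IH] mu i /=.
  by move=> H _; have := rowlen_size mu i; case: (ssize mu) H; case: rowlen.
rewrite sum_nat_eq0 => /forallPn[rho]; rewrite negb_imply =>
    /andP[/andP[/hstripP H _] nz].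
by case: i => // i Li; have := H i; rewrite (IH rho i) // leqn0 => /andP[/eqP].
Qed.

Definition addbox nu (i : 'I_p) : diagram := [ffun j => inord (nu j + (j == i))].
Definition delbox nu (i : 'I_p) : diagram := [ffun j => inord (nu j - (j == i))].

Lemma rowlen_addbox nu (i : 'I_p) j : ssize nu < q ->
  rowlen (addbox nu i) j = rowlen nu j + (j == i).
Proof.
move=> nq; case: (ltnP j p) => [jp|pj]; last first.
  by rewrite !rowlen_out //; have := ltn_ord i; case: eqP => ?; lia.
rewrite (rowlen_ord _ (Ordinal jp)) (rowlen_ord nu (Ordinal jp)) ffunE inordK //.
have := rowlen_size nu j; rewrite (rowlen_ord nu (Ordinal jp)).
by rewrite -val_eqE /=; lia.
Qed.

Lemma rowlen_delbox nu (i : 'I_p) j : rowlen (delbox nu i) j = rowlen nu j - (j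
    == i).
Proof.
case: (ltnP j p) => [jp|pj]; last by rewrite !rowlen_out.
rewrite (rowlen_ord _ (Ordinal jp)) (rowlen_ord nu (Ordinal jp)) ffunE inordK //.
by rewrite ltnS (leq_trans (leq_subr _ _)) // -ltnS.
Qed.

Lemma sum_indic (i : 'I_p) : \sum_(j < p) (j == i :> nat) = 1.
Proof.
rewrite (bigD1 i) //= eqxx big1 ?addn0 // => j.
by rewrite -val_eqE /= => /negPf->.
Qed.

Lemma ssize_addbox nu (i : 'I_p) : ssize nu < q -> ssize (addbox nu i) = (ssize
    nu).+1.
Proof.
move=> nq; rewrite /ssize (eq_bigr (fun j : 'I_p => rowlen nu j + (j == i :> nat))).
  by rewrite big_split /= sum_indic addn1.
by move=> j _; rewrite rowlen_addbox.
Qed.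

Lemma ssize_delbox nu (i : 'I_p) : 0 < rowlen nu i -> ssize nu = (ssize (delbox
    nu i)).+1.
Proof.
move=> pos; rewrite /ssize.
rewrite (eq_bigr (fun j : 'I_p => rowlen (delbox nu i) j + (j == i :> nat))).
  by rewrite big_split /= sum_indic addn1.
by move=> j _; rewrite rowlen_delbox; case: eqP => [->|_]; lia.
Qed.

Lemma coversP nu mu : covers nu mu ->
  exists i : 'I_p, forall j, rowlen mu j = rowlen nu j + (j == i).
Proof.
case/andP=> /hstripP H /eqP E.
have [i ni] : exists i : 'I_p, rowlen nu i < rowlen mu i.
  apply/existsP; apply: contra_eqT E; rewrite negb_exists => /forallP K.
  suff -> : ssize mu = ssize nu by rewrite neq_ltn ltnSn.
  apply: eq_bigr => i _; apply/eqP; rewrite eqn_leq leqNgt K /=.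
  by case/andP: (H i).
exists i => j; case: (ltnP j p) => [jp|pj]; last first.
  by rewrite !rowlen_out //; have := ltn_ord i; case: eqP => ?; lia.
move: E; rewrite /ssize (bigD1 i) //= [in RHS](bigD1 i) //=.
have Hs (P : pred 'I_p) :
   \sum_(k < p | P k) rowlen nu k <= \sum_(k < p | P k) rowlen mu k.
  by apply: leq_sum => k _; case/andP: (H k).
case: (eqVneq (j : nat) i) => [->|ji].
  have := Hs (fun k => k != i).
  by move: ni; do 2!move: (\sum_(k < p | _) _) => ?; lia.
have ji' : Ordinal jp != i by rewrite -val_eqE.
rewrite (bigD1 (Ordinal jp)) //= [in RHS](bigD1 (Ordinal jp)) //=.
have := Hs (fun k => (k != i) && (k != Ordinal jp)).
move: (H j) ni; do 2!move: (\sum_(k < p | _) _) => ?; lia.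
Qed.

Lemma count_covers (P : pred diagram) nu : ssize nu < q ->
  \sum_(mu | covers nu mu) (P mu : nat) =
  \sum_(i < p) (hstrip nu (addbox nu i) && P (addbox nu i)).
Proof.
move=> nq; rewrite !sum_bool -(card_in_imset (f := addbox nu)); last first.
  move=> i j _ _ E; apply/val_inj/eqP.
  have := rowlen_addbox i i nq; rewrite E rowlen_addbox // eqxx.
  by case: eqP => //; lia.
apply: eq_card => mu; rewrite inE; apply/andP/imsetP => [[cov Pmu]|[i]].
  have [i Hi] := coversP cov.
  have E : mu = addbox nu i by apply: rowlen_inj => j _; rewrite rowlen_addbox.
  exists i => //; rewrite inE -E Pmu andbT /=.
  by case/andP: cov.
by rewrite inE /= => /andP[h Pm] ->; rewrite /covers h ssize_addbox ?eqxx.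
Qed.

Lemma count_covered (P : pred diagram) rho : ssize rho <= q ->
  \sum_(rho' | covers rho' rho) (P rho' : nat) =
  \sum_(j < p) [&& 0 < rowlen rho j, hstrip (delbox rho j) rho
                & P (delbox rho j)].
Proof.
move=> nq; rewrite !sum_bool -(card_in_imset (f := delbox rho)); last first.
  move=> i j; rewrite !inE /= => /andP[i0 _] _ E; apply/val_inj/eqP.
  have := rowlen_delbox rho i i; rewrite E rowlen_delbox // eqxx.
  by case: eqP => //; lia.
apply: eq_card => mu; rewrite inE; apply/andP/imsetP => [[cov Pmu]|[i]].
  have [i Hi] := coversP cov.
  have E : mu = delbox rho i.
    by apply: rowlen_inj => j _; rewrite rowlen_delbox Hi addnK.
  exists i => //; rewrite inE -E Pmu andbT /= Hi eqxx addn1 /=.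
  by case/andP: cov.
by rewrite inE /= => /and3P[pos h Pm] ->; rewrite /covers h -ssize_delbox ?eqxx.
Qed.

(** The local form of the relation D H_r = H_r D + H_(r-1) between removing a
    box (D) and adding a horizontal strip of size r (H_r). If nu / rho is a
    strip, then nu may grow in row 0, and in row i + 1 exactly when rho may
    shrink in row i. Otherwise nu may grow, or rho shrink, only in the one row
    where interlacing fails by one box. *)
Lemma covers_hstrip rho nu : ssize nu < q -> ssize rho <= q ->
    0 < p -> rowlen rho p.-1 = 0 ->
  \sum_(mu | covers nu mu) (hstrip rho mu : nat) =
  \sum_(rho' | covers rho' rho) (hstrip rho' nu : nat) + hstrip rho nu.
Proof.
move=> nq rq p0 last0; rewrite count_covers // count_covered //.
have [H|N] := boolP (hstrip rho nu); last first.
  rewrite addn0; apply: eq_bigr => i _; congr (nat_of_bool _).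
  have fixrow : (forall j, rowlen nu j.+1 <= rowlen rho j <= rowlen nu j + (j ==
      i)) ->
      rowlen rho i = (rowlen nu i).+1.
    move=> K; apply/eqP; have := K i; rewrite eqxx; apply: contraTT => ne.
    apply: contra N => Ki; apply/hstripP=> j; have := K j.
    by case: eqP => [->|_]; lia.
  apply/andP/and3P => [[/hstripP A /hstripP B]|[pos /hstripP A /hstripP B]].
    have {}A j := A j; have {}B j := B j.
    have E : rowlen rho i = (rowlen nu i).+1.
      by apply: fixrow => j; have := B j; rewrite !rowlen_addbox //; lia.
    split; first by rewrite E.
      apply/hstripP=> j; rewrite rowlen_delbox; have := B j; have := B j.+1.
      have := A j; rewrite !rowlen_addbox //.
      by case: (eqVneq j i) => [->|ji]; case: eqP; lia.
    apply/hstripP=> j; rewrite rowlen_delbox; have := B j.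
    have := A j; rewrite !rowlen_addbox //.
    by case: (eqVneq j i) => [->|ji]; case: eqP; lia.
  have E : rowlen rho i = (rowlen nu i).+1.
    apply: fixrow => j; have := B j; rewrite !rowlen_delbox.
    by case: eqP; lia.
  split; apply/hstripP=> j; rewrite !rowlen_addbox //.
    have := A j; have := B j; rewrite !rowlen_delbox.
    by case: (eqVneq j.+1 i) => [ji|_]; rewrite ?ji ?E; case: eqP; lia.
  have := A j; have := B j; rewrite !rowlen_delbox.
  by case: (eqVneq j.+1 i) => [ji|_]; rewrite ?ji ?E; case: (eqVneq j i) =>
      [->|_]; lia.
have {}H := hstripP _ _ H.
pose free j := rowlen nu j.+1 < rowlen rho j.
pose ok i := if i is j.+1 then free j else true.
have -> : \sum_(i < p) (hstrip nu (addbox nu i) && hstrip rho (addbox nu i)) =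
          \sum_(i < p) ok i.
  apply: eq_bigr => i _; congr (nat_of_bool _); apply/andP/idP.
    case=> _ /hstripP B; rewrite /ok; case E: (i : nat) => [|j] //.
    by have := B j; rewrite !rowlen_addbox // E eqxx /free; lia.
  move=> F; have K j : j.+1 = i -> rowlen nu j.+1 < rowlen rho j.
    by move: F => /[swap] <-.
  split; apply/hstripP=> j; rewrite !rowlen_addbox //; move: (H j) (K j);
  by case: (eqVneq j.+1 i) => [ji|_]; lia.
have -> : \sum_(j < p) [&& 0 < rowlen rho j, hstrip (delbox rho j) rho
             & hstrip (delbox rho j) nu] = \sum_(j < p) free j.
  apply: eq_bigr => i _; congr (nat_of_bool _); apply/and3P/idP.
    by case=> pos _ /hstripP/(_ i); rewrite rowlen_delbox eqxx /free; lia.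
  rewrite /free => F; split; first exact: leq_ltn_trans F.
    apply/hstripP=> j; rewrite rowlen_delbox; have := H j; have := H j.+1.
    by case: (eqVneq j i) => [->|_]; lia.
  apply/hstripP=> j; rewrite rowlen_delbox; have := H j.
  by case: (eqVneq j i) => [->|_]; lia.
rewrite -(big_mkord xpredT (fun i => nat_of_bool (ok i))).
rewrite -(big_mkord xpredT (fun i => nat_of_bool (free i))).
rewrite -{1 2}(prednK p0) big_nat_recl // big_nat_recr //= {3}/free last0.
by rewrite addn0 addnC.
Qed.

(** The relation D H_r = H_r D + H_(r-1), applied to the strips of a chain one
    after the other. *)
Lemma sum_covers_chains c L nu : L <= p -> ssize nu < q ->
  \sum_(mu | covers nu mu) chains c L mu =
  \sum_(a < L | 0 < c a) chains (decr c a) L nu.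
Proof.
elim: L c nu => [|L IH] c nu Lp nq /=.
  by rewrite big_ord0 big1 // => mu /andP[_ /eqP->].
have dl (a : 'I_L) : decr c a L = c L by rewrite /decr (gtn_eqF (ltn_ord a)) subn0.
transitivity (\sum_(rho | (ssize nu).+1 == ssize rho + c L)
    chains c L rho * \sum_(mu | covers nu mu) (hstrip rho mu : nat)).
  rewrite (exchange_big_dep (fun rho => (ssize nu).+1 == ssize rho + c L)) /=.
    apply: eq_bigr => rho size_rho; rewrite big_distrr /= big_mkcond
        [RHS]big_mkcond /=.
    apply: eq_bigr => mu _; case: (boolP (covers nu mu)) => //= /andP[_ /eqP->].
    by rewrite size_rho andbT; case: hstrip; rewrite ?muln0 ?muln1.
  by move=> mu rho /andP[_ /eqP->] /andP[_].
transitivity (\sum_(rho | (ssize nu).+1 == ssize rho + c L)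
    chains c L rho * (\sum_(rho' | covers rho' rho) (hstrip rho' nu : nat)
                      + hstrip rho nu)).
  apply: eq_bigr => rho /eqP size_rho.
  have [->|nz] := eqVneq (chains c L rho) 0; first by rewrite !mul0n.
  rewrite covers_hstrip //; first lia.
    exact: leq_ltn_trans Lp.
  by apply: chains_rows nz _; lia.
under eq_bigr do rewrite mulnDr; rewrite big_split /=.
rewrite [RHS]big_mkcond big_ord_recr /= -big_mkcond /=; congr (_ + _).
  transitivity (\sum_(rho' | hstrip rho' nu && (ssize nu == ssize rho' + c L))
      \sum_(rho | covers rho' rho) chains c L rho).
    rewrite [RHS](exchange_big_dep (fun rho => (ssize nu).+1 == ssize rho + c
        L)) /=.
      apply: eq_bigr => rho /eqP size_rho; rewrite big_distrr /=.
      rewrite big_mkcond [RHS]big_mkcond /=.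
      apply: eq_bigr => mu _; case: (boolP (covers mu rho)); rewrite ?andbF //=
          andbT.
      case/andP=> _ /eqP E; move: size_rho; rewrite E addSn => -[->].
      by rewrite eqxx andbT; case: hstrip; rewrite ?muln0 ?muln1.
    by move=> mu rho /andP[_ /eqP E] /andP[_ /eqP->]; rewrite E addSn.
  rewrite [RHS](exchange_big_dep (fun rho' => hstrip rho' nu && (ssize nu ==
      ssize rho' + c L))) /=.
    apply: eq_bigr => rho' /andP[h /eqP E]; rewrite IH //; last 2 first.
    - exact: ltnW.
    - by apply: leq_ltn_trans nq; apply: hstrip_size.
    by apply: eq_bigl => a; rewrite h E dl eqxx !andbT.
  by move=> a rho' _; rewrite dl.
case: (posnP (c L)) => [c0|cpos].
  rewrite big1 // => rho /eqP; rewrite c0 addn0 => E.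
  case: (boolP (hstrip _ _)) => [/hstrip_size|]; rewrite ?muln0 //.
  by rewrite -E ltnn.
rewrite [LHS]big_mkcond [RHS]big_mkcond /=; apply: eq_bigr => rho _.
rewrite /decr eqxx -{1}(subnK cpos) addnA addn1 eqSS.
case: hstrip; case: eqP => //= _; rewrite ?muln0 ?muln1 //.
by apply: chains_ext => a aL; rewrite (ltn_eqF aL) subn0.
Qed.

(** The multinomial coefficient of nwords_fact, in a form that makes sense for
    all c; it counts words, see card_words. *)
Fixpoint nwords n L c : nat :=
  if n is n'.+1 then \sum_(a < L | 0 < c a) nwords n' L (decr c a)
  else [forall a : 'I_L, c a == 0].

Lemma decr_ext c c' L a : (forall b, b < L -> c b = c' b) ->
  forall b, b < L -> decr c a b = decr c' a b.
Proof. by move=> E b bL; rewrite /decr E. Qed.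

(** Robinson-Schensted-Knuth as an identity of numbers: the words are counted
    by pairs made of a chain of horizontal strips and a chain of boxes. *)
Lemma sum_chains_nwords n L c : L <= p -> n <= q ->
  \sum_(mu | ssize mu == n) chains c L mu * chains (fun=> 1) n mu = nwords n L c.
Proof.
move=> Lp; elim: n c => [|n IH] c nq /=.
  have z mu : ssize mu = 0 -> forall i, rowlen mu i = 0.
    by move=> E i; apply/eqP; rewrite -leqn0 -E rowlen_size.
  pose o : diagram := [ffun=> ord0].
  have o0 : ssize o = 0.
    by rewrite /ssize big1 // => i _; rewrite rowlen_ord ffunE.
  rewrite (bigD1 o) /=; last exact/eqP.
  rewrite big1 ?addn0 => [|mu /andP[/eqP E /eqP[]]]; last first.
    by apply: rowlen_inj => i _; rewrite !z.
  rewrite o0 muln1; elim: L Lp => [|L IH] Lp /=.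
    by rewrite o0; apply/esym; congr nat_of_bool; apply/forallP=> -[].
  rewrite (eq_bigl (fun rho => (rho == o) && (c L == 0))).
    case: eqP => [cL|cL]; last first.
      rewrite big_pred0 => [|rho]; last by rewrite andbF.
      apply/esym/eqP; rewrite eqb0; apply/forallPn.
      by exists ord_max; apply/eqP.
    under eq_bigl do rewrite andbT; rewrite big_pred1_eq IH ?(ltnW Lp) //.
    congr nat_of_bool; apply/forallP/forallP => H a; last first.
      exact: (H (widen_ord (leqnSn L) a)).
    have [aL|] := ltnP a L; first exact: (H (Ordinal aL)).
    move=> La; suff -> : a = ord_max by apply/eqP.
    by apply/val_inj/eqP; rewrite eqn_leq La -ltnS ltn_ord.
  move=> rho; rewrite o0; apply/andP/andP => [[/hstripP h]|[/eqP-> /eqP->]].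
    rewrite eq_sym addn_eq0 => /andP[/eqP s0 ->]; split=> //.
    by apply/eqP/rowlen_inj => i _; rewrite !z.
  by rewrite o0; split=> //; apply/hstripP => i; rewrite !z.
under eq_bigr do rewrite big_distrr /=.
rewrite (exchange_big_dep (fun rho => ssize rho == n)) /=; last first.
  by move=> mu rho /eqP-> /andP[_]; rewrite addn1 eqSS eq_sym.
transitivity (\sum_(rho | ssize rho == n)
    chains (fun=> 1) n rho * \sum_(mu | covers rho mu) chains c L mu).
  apply: eq_bigr => rho /eqP E; rewrite big_distrr /= big_mkcond [RHS]big_mkcond.
  apply: eq_bigr => mu _; rewrite /covers E addn1 mulnC.
  by case: eqP; rewrite ?andbF ?andbT.
transitivity (\sum_(rho | ssize rho == n)
    \sum_(a < L | 0 < c a) chains (decr c a) L rho * chains (fun=> 1) n rho).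
  apply: eq_bigr => rho /eqP E; rewrite sum_covers_chains ?E // mulnC.
  by rewrite big_distrl.
rewrite exchange_big /=; apply: eq_bigr => a _; exact/IH/ltnW.
Qed.

Lemma nwords_ext n L c c' :
  (forall a, a < L -> c a = c' a) -> nwords n L c = nwords n L c'.
Proof.
elim: n c c' => [|n IH] c c' E /=.
  by congr nat_of_bool; apply: eq_forallb => a; rewrite E.
apply: eq_big => [a|a _]; first by rewrite E.
by apply: IH; apply: decr_ext.
Qed.

Lemma nwords_fact n L c : \sum_(a < L) c a = n ->
  nwords n L c * \prod_(a < L) (c a)`! = n`!.
Proof.
elim: n c => [|n IH] c E /=.
  have z (a : 'I_L) : c a = 0.
    by apply/eqP; rewrite -leqn0 -E (bigD1 a) //= leq_addr.
  rewrite (_ : [forall a : 'I_L, c a == 0]); last by apply/forallP=> a; rewrite z.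
  by rewrite big1 // => a _; rewrite z.
rewrite big_distrl /=.
transitivity (\sum_(a < L | 0 < c a) c a * n`!).
  apply: eq_bigr => a pos.
  have S : \sum_(b < L) decr c a b = n.
    apply/eqP; rewrite -(eqn_add2r 1) [n + 1]addn1 -E (bigD1 a) // [in X in _ ==
        X](bigD1 a) //=.
    rewrite /decr eqxx addnAC subnK // eqn_add2l; apply/eqP/eq_bigr => b.
    by rewrite -val_eqE /= => /negPf->; rewrite subn0.
  rewrite -(IH _ S) mulnCA; congr (_ * _).
  rewrite (bigD1 a) //= [in RHS](bigD1 a) //= /decr eqxx mulnA; congr (_ * _).
    by rewrite -{1}(subnK pos) addn1 factS -addn1 subnK.
  by apply: eq_bigr => b; rewrite -val_eqE /= => /negPf->; rewrite subn0.
rewrite -big_distrl /= factS -E; congr (_ * _).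
by rewrite big_mkcond; apply: eq_bigr => a _; case: posnP => [->|].
Qed.

End Chains.

(** * From chains to semistandard tableaux *)

Lemma count_between r s q : r <= s -> s <= q ->
  count (fun j => r <= j < s) (index_iota 0 q) = s - r.
Proof.
move=> rs sq; rewrite /index_iota subn0 -(subnKC sq) iotaD count_cat.
rewrite -{2}(subnKC rs) iotaD count_cat !add0n.
rewrite (@eq_in_count _ _ pred0) ?count_pred0; last first.
  by move=> j; rewrite mem_iota /=; lia.
rewrite (@eq_in_count _ _ predT) ?count_predT ?size_iota; last first.
  by move=> j; rewrite mem_iota /=; lia.
rewrite (@eq_in_count _ _ pred0) ?count_pred0 ?addn0 //.
by move=> j; rewrite mem_iota /=; lia.
Qed.

Section Fillings.

Variables p q : nat.
Implicit Types (mu nu rho : diagram p q) (c : nat -> nat).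

(** The value L stands outside of the diagram; this makes the tableaux of all
    shapes functions on the same rectangle. *)
Definition filling L := {ffun 'I_p * 'I_q -> 'I_L.+1}.

Definition fits L mu (T : filling L) : bool :=
  [forall x : 'I_p * 'I_q, (T x < L) == (x.2 < rowlen mu x.1)].

Definition fill_ssyt L (T : filling L) : bool :=
  [forall x : 'I_p * 'I_q, forall y : 'I_p * 'I_q,
    ((x.1 == y.1) && (x.2 <= y.2) ==> (T x <= T y)) &&
    ((x.2 == y.2) && (x.1 < y.1) && (T y < L) ==> (T x < T y))].

Definition fill_content L c (T : filling L) : bool :=
  [forall a : 'I_L, #|[set x | T x == a :> nat]| == c a].

Definition fillings c L mu : {set filling L} :=
  [set T | [&& fits mu T, fill_ssyt T & fill_content c T]].

Definition extend L mu (T : filling L) : filling L.+1 :=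
  [ffun x : 'I_p * 'I_q => if T x < L then inord (T x)
             else if x.2 < rowlen mu x.1 then inord L else inord L.+1].

Lemma extendE L mu (T : filling L) x : extend mu T x =
  (if T x < L then T x : nat else if x.2 < rowlen mu x.1 then L else L.+1) :> nat.
Proof.
by rewrite ffunE; case: ifP => [TL|_]; [|case: ifP => _]; rewrite inordK //; lia.
Qed.

Lemma hstrip_lt rho mu i j : hstrip rho mu -> i < j -> rowlen mu j <= rowlen rho i.
Proof.
move=> /hstripP H; elim: j => // j IH; rewrite ltnS leq_eqVlt => /orP[/eqP->|/IH].
  by case/andP: (H j).
by apply: leq_trans; case/andP: (H j) => a b; apply: leq_trans b.
Qed.

Lemma rowlen_le mu i : rowlen mu i <= q.
Proof.
by rewrite /rowlen; case: insub => // j; rewrite -ltnS.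
Qed.

Lemma card_strip rho mu : hstrip rho mu ->
  #|[set x : 'I_p * 'I_q | rowlen rho x.1 <= x.2 < rowlen mu x.1]|
    = ssize mu - ssize rho.
Proof.
move=> H; rewrite /ssize -sumnB; last by move=> i _; case/andP: (hstripP _ _ H i).
rewrite -sum1dep_card.
rewrite (eq_bigl (fun x : 'I_p * 'I_q => true && (rowlen rho x.1 <= x.2 < rowlen
    mu x.1))) //.
rewrite -(pair_big_dep xpredT (fun (i : 'I_p) (j : 'I_q) => rowlen rho i <= j <
    rowlen mu i)
           (fun _ _ => 1)) /=.
apply: eq_bigr => i _.
rewrite -(big_mkord (fun j => rowlen rho i <= j < rowlen mu i) (fun=> 1)).
rewrite -big_filter sum1_size size_filter.
by apply: count_between; [case/andP: (hstripP _ _ H i) | apply: rowlen_le].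
Qed.

Lemma extend_fillings c L rho mu T : hstrip rho mu ->
    ssize mu = ssize rho + c L -> T \in fillings c L rho ->
  extend mu T \in fillings c L.+1 mu.
Proof.
move=> h size_mu; rewrite !inE => /and3P[/forallP F /forallP S /forallP C].
have {}F x : (T x < L) = (x.2 < rowlen rho x.1) by exact: eqP (F x).
have sub x : T x < L -> x.2 < rowlen mu x.1.
  by rewrite F => /leq_trans-> //; case/andP: (hstripP _ _ h x.1).
apply/and3P; split; apply/forallP.
- move=> x; rewrite extendE; case: ifP => [Tx|_].
    by rewrite sub // (leq_trans Tx).
  by case: ifP; rewrite ?ltnSn ?ltnn.
- move=> x; apply/forallP => y; rewrite !extendE.
  have /forallP/(_ y)/andP[/implyP R /implyP Col] := S x.
  apply/andP; split; apply/implyP.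
    case/andP=> /eqP xy1 xy2; have := R; rewrite xy1 xy2 eqxx => /(_ isT).
    move: xy2; move: (T x : nat) (T y : nat) (x.2 : nat) (y.2 : nat) (rowlen mu
        y.1).
    move=> tx ty x2 y2 r; case: (ltnP tx L); case: (ltnP ty L);
      by case: (ltnP x2 r); case: (ltnP y2 r); lia.
  case/andP=> /andP[/eqP xy2 xy1]; have := Col; rewrite xy2 eqxx xy1 /=.
  case: (ltnP (T y) L) => Ty; first by move=> /(_ isT) lt _; rewrite (ltn_trans
      lt Ty).
  case: (ltnP y.2) => yin; last by rewrite ltnn.
  have Tx : T x < L by rewrite F xy2; apply: leq_trans yin _; apply: hstrip_lt.
  by rewrite Tx.
move=> a; have [aL|La] := ltnP a L.
  rewrite -(eqP (C (Ordinal aL))); apply/eqP; apply: eq_card => x; rewrite !inE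
      extendE /=.
  move: (T x : nat) (x.2 : nat) (rowlen _ _) => t j r.
  by case: (ltnP t L) => //; case: (ltnP j r); lia.
have {La} -> : a = L :> nat by apply/eqP; rewrite eqn_leq La -ltnS ltn_ord.
rewrite -[c L](addKn (ssize rho)) -size_mu -card_strip //; apply/eqP.
apply: eq_card => x; rewrite !inE extendE.
have := F x; move: (T x : nat) (x.2 : nat) (rowlen _ _) (rowlen _ _) => t j r r'.
by case: (ltnP t L); case: (ltnP j r'); case: (ltnP j r); lia.
Qed.

Lemma extend_inj c L mu rho rho' T T' :
    T \in fillings c L rho -> T' \in fillings c L rho' ->
  extend mu T = extend mu T' -> T = T'.
Proof.
rewrite !inE => /and3P[_ _ _] /and3P[_ _ _] E; apply/ffunP=> x; apply/val_inj => /=.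
have := congr1 (fun U : filling L.+1 => U x : nat) E; rewrite !extendE.
have := ltn_ord (T x); have := ltn_ord (T' x).
move: (T x : nat) (T' x : nat) (x.2 < _) => t t' b.
by case: (ltnP t L); case: (ltnP t' L); case: b; lia.
Qed.

Lemma fits_inj L rho rho' (T : filling L) : fits rho T -> fits rho' T -> rho = rho'.
Proof.
move=> /forallP F /forallP F'; apply: rowlen_inj => i ip.
have K (j : 'I_q) : (j < rowlen rho i) = (j < rowlen rho' i).
  by rewrite -(eqP (F (Ordinal ip, j))) (eqP (F' (Ordinal ip, j))).
have L1 (r r' : diagram p q) : (forall j : 'I_q, (j < rowlen r i) = (j < rowlen
    r' i)) ->
    rowlen r i <= rowlen r' i.
  move=> H; rewrite leqNgt; apply/negP => lt.
  have jq := leq_trans lt (rowlen_le r i).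
  by have := H (Ordinal jq); rewrite lt ltnn.
by apply/eqP; rewrite eqn_leq !L1.
Qed.

(** Writing the letter L in the strip mu / rho turns a tableau of shape rho
    into one of shape mu, from which rho can be read off. *)
Lemma chains_le_fillings c L mu : chains c L mu <= #|fillings c L mu|.
Proof.
elim: L mu => [|L IH] mu /=.
  case: eqP => // mu0; rewrite card_gt0; apply/set0Pn.
  exists [ffun=> ord0]; rewrite inE; apply/and3P; split; apply/forallP.
  - move=> x; rewrite ltn0; apply/eqP/esym/negbTE; rewrite -leqNgt.
    by apply: leq_trans (rowlen_size mu x.1) _; rewrite mu0.
  - by move=> x; apply/forallP => y; rewrite !ffunE ltn0 !andbF implybT.
  by case.
apply: (@leq_trans (\sum_(rho | hstrip rho mu && (ssize mu == ssize rho + c L))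
                     #|fillings c L rho|)); first exact: leq_sum.
pose D := [set x : diagram p q * filling L |
  (hstrip x.1 mu && (ssize mu == ssize x.1 + c L)) && (x.2 \in fillings c L x.1)].
have <- : #|D| = \sum_(rho | hstrip rho mu && (ssize mu == ssize rho + c L))
                     #|fillings c L rho|.
  rewrite -sum1dep_card.
  rewrite -(pair_big_dep (fun rho => hstrip rho mu && (ssize mu == ssize rho + c L))
             (fun rho T => T \in fillings c L rho) (fun _ _ => 1)) /=.
  by apply: eq_bigr => rho _; rewrite sum1_card.
rewrite -(card_in_imset (f := fun x => extend mu x.2)).
  apply/subset_leq_card/subsetP => y /imsetP[[rho T] + ->].
  by rewrite inE => /andP[/andP[/= h /eqP s] HT]; apply: extend_fillings HT.
move=> [rho T] [rho' T']; rewrite inE => /andP[_ /= HT]; rewrite inE => /andP[_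
    /= HT'] E.
have ET := extend_inj HT HT' E; congr (_, _) => //; rewrite -{}ET in HT'.
by move: HT HT'; rewrite !inE => /and3P[F _ _] /and3P[F' _ _]; apply: fits_inj F F'.
Qed.


End Fillings.

Section Tableaux.

Variables n l : nat.
Implicit Types mu lambda : intpart n l.

Definition diagram_of mu : diagram l n := [ffun i => tnth (val mu) i].

Lemma part_tnth mu (i : 'I_l) : part mu i = tnth (val mu) i.
Proof.
by rewrite /part /parts (nth_map ord0) ?size_tuple // -tnth_nth.
Qed.

Lemma rowlen_diagram_of mu i : rowlen (diagram_of mu) i = part mu i.
Proof.
have [il|li] := ltnP i l.
  by rewrite (rowlen_ord _ (Ordinal il)) ffunE -part_tnth.
by rewrite rowlen_out // /part nth_default // size_map size_tuple.
Qed.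

Lemma part_le mu i j : i <= j -> part mu j <= part mu i.
Proof.
move=> ij; have /andP[srt _] := valP mu.
have [jl|lj] := ltnP j l; last first.
  by rewrite {1}/part nth_default // size_map size_tuple.
apply: (sorted_leq_nth _ _ _ srt) => //.
- by move=> ? ? ? /= ba cb; apply: leq_trans cb ba.
- by move=> ?; exact: leqnn.
- by rewrite inE size_map size_tuple (leq_ltn_trans ij).
- by rewrite inE size_map size_tuple.
Qed.

Lemma sum_part mu : \sum_(i < l) part mu i = n.
Proof.
have /andP[_ /eqP E] := valP mu; rewrite -[RHS]E sumnE.
by rewrite (big_nth 0) size_map size_tuple big_mkord.
Qed.

Lemma part_le_n mu i : part mu i <= n.
Proof. by rewrite -rowlen_diagram_of rowlen_le. Qed.

Lemma ssize_diagram_of mu : ssize (diagram_of mu) = n.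
Proof.
by rewrite -[RHS](sum_part mu); apply: eq_bigr => i _; rewrite rowlen_diagram_of.
Qed.

Definition ssyt mu L (T : {ffun cell mu -> 'I_L}) : bool :=
  [forall c, forall d,
    ((row_of c == row_of d) && (col_of c <= col_of d)%N ==> (T c <= T d)%N)
 && ((col_of c == col_of d) && (row_of c < row_of d)%N ==> (T c < T d)%N)].

Definition tab_content mu L (c : nat -> nat) (T : {ffun cell mu -> 'I_L}) : bool :=
  [forall a : 'I_L, #|[set x | T x == a]| == c a].

Definition ssyts mu L c : {set {ffun cell mu -> 'I_L}} :=
  [set T | ssyt T && tab_content c T].

Lemma kostka_ssyts mu lambda : kostka mu lambda = #|ssyts mu l (part lambda)|.
Proof. by []. Qed.

Lemma chains_le_ssyts c L mu : 0 < n -> chains c L (diagram_of mu) <= #|ssyts mu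
    L c|.
Proof.
move=> n_gt0; case: L => [|L].
  by rewrite /= ssize_diagram_of (gtn_eqF n_gt0).
apply: leq_trans (chains_le_fillings _ _ _) _.
pose res (T : filling l n L.+1) : {ffun cell mu -> 'I_L.+1} :=
  [ffun x => inord (T (val x))].
have lt (T : filling l n L.+1) (x : cell mu) : fits (diagram_of mu) T -> T (val
    x) < L.+1.
  move=> /forallP/(_ (val x))/eqP->; rewrite rowlen_diagram_of.
  exact: (valP (x : cell mu)).
have resE (T : filling l n L.+1) (x : cell mu) : fits (diagram_of mu) T -> res T
    x = T (val x) :> nat.
  by move=> fT; rewrite ffunE inordK // lt.
rewrite -(card_in_imset (f := res)).
  apply/subset_leq_card/subsetP => z /imsetP[T + ->].
  rewrite !inE => /and3P[fT /forallP S /forallP C].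
  apply/andP; split; apply/forallP.
    move=> x; apply/forallP => y; rewrite !resE //.
    have /forallP/(_ (val y))/andP[R Col] := S (val x).
    by rewrite R /=; move: Col; rewrite lt // andbT.
  move=> a; rewrite -(eqP (C a)) -[X in X == _](card_imset _ val_inj).
  apply/eqP/eq_card => x; rewrite [in RHS]inE; apply/imsetP/eqP => [[y]|E].
    by rewrite inE -val_eqE /= resE // => /eqP <- ->.
  have xin : x.2 < part mu x.1.
    by rewrite -rowlen_diagram_of; have /forallP/(_ x)/eqP<- := fT; rewrite E.
  exists (exist _ x xin) => //; rewrite inE -val_eqE /= resE //=.
  exact/eqP.
move=> T T'; rewrite !inE => /and3P[fT _ _] /and3P[fT' _ _] E.
apply/ffunP=> x; apply/val_inj => /=.
have F := forallP fT x; have F' := forallP fT' x.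
have [xin|out] := ltnP x.2 (part mu x.1).
  have := resE T (exist _ x xin) fT; have := resE T' (exist _ x xin) fT'.
  by rewrite E => -> ->.
move: F F'; rewrite rowlen_diagram_of (ltnNge x.2) out /= => /eqP/negbT F
    /eqP/negbT F'.
apply/eqP; rewrite eqn_leq.
move: F F'; rewrite -!leqNgt => F F'.
by rewrite (leq_trans _ F') ?(leq_trans _ F) // -ltnS.
Qed.

End Tableaux.

(** * Rearrangements *)

Section Rearrangement.

Variables (X : finType) (a b : X -> nat).
Hypothesis inj_b : forall x y, a x = a y -> b x = b y -> x = y.
Implicit Types (f g : X -> nat) (s : {perm X}).

Local Open Scope nat_scope.

Definition block_sorted f := forall x y, a x = a y -> b x < b y -> f x <= f y.

Definition keeps_blocks s := [forall x, a (s x) == a x].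

(** Within a block, the positions where f <= v and those where g <= v are
    initial segments for b, and they are equally many. *)
Lemma block_sorted_uniq f g s : keeps_blocks s -> block_sorted f ->
  block_sorted g -> (forall x, g x = f (s x)) -> g =1 f.
Proof.
move=> /forallP as_ sf sg E x.
have le_v v : (f x <= v) = (g x <= v).
  pose A := [set y | (a y == a x) && (f y <= v)].
  pose B := [set y | (a y == a x) && (g y <= v)].
  have cardAB : #|B| = #|A|.
    rewrite -(card_preimset A (perm_inj (s := s))); apply: eq_card => y.
    by rewrite !inE E (eqP (as_ y)).
  have nested : (A \subset B) || (B \subset A).
    apply/orP; case: (boolP (A \subset B)) => [_|]; first by left.
    case/subsetPn=> y; rewrite !inE => /andP[/eqP ay fy]; rewrite ay eqxx /=
        -ltnNge => gy.
    right; apply/subsetP => z; rewrite !inE => /andP[/eqP az gz]; rewrite az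
        eqxx /=.
    have [yz|zy|E'] := ltngtP (b y) (b z).
    - have := sg y z; rewrite ay az => /(_ erefl yz) gyz.
      by have := leq_trans gy (leq_trans gyz gz); rewrite ltnn.
    - by have := sf z y; rewrite ay az => /(_ erefl zy) /leq_trans; apply.
    by rewrite -(inj_b _ E') // ay az.
  have AB : A = B.
    case/orP: nested => sub; first by apply/eqP; rewrite eqEcard sub cardAB /=.
    by apply/esym/eqP; rewrite eqEcard sub cardAB /=.
  by have := congr1 (fun U : {set X} => x \in U) AB; rewrite !inE eqxx.
by apply/eqP; rewrite eqn_leq le_v leqnn -le_v leqnn.
Qed.

Definition pairing f s := \sum_x b x * f (s x).

(** A maximal rearrangement is sorted on each block, as otherwise exchanging
    two values would increase the sum; and there is only one sorted one. *)
Lemma pairing_max f s : block_sorted f -> keeps_blocks s ->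
  (forall s', keeps_blocks s' -> pairing f s' <= pairing f s) ->
  forall x, f (s x) = f x.
Proof.
move=> sf ks smax; apply: (@block_sorted_uniq f (f \o s) s) => // x y axy bxy /=.
rewrite leqNgt; apply/negP => lt.
have xy : x != y by apply: contraTneq bxy => ->; rewrite ltnn.
have k' : keeps_blocks (tperm x y * s)%g.
  apply/forallP=> z; rewrite permM (eqP (forallP ks _)).
  by case: tpermP => [->|->|_ _]; rewrite ?axy.
have := smax _ k'; rewrite /pairing leqNgt => /negP[].
rewrite (bigD1 x) //= (bigD1 y) 1?eq_sym //= [X in _ < X](bigD1 x) //=.
rewrite [X in _ < _ + X](bigD1 y) 1?eq_sym //= !permM tpermL tpermR.
rewrite (eq_bigr (fun z => b z * f ((tperm x y * s)%g z))); last first.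
  by move=> z /andP[zx zy]; rewrite permM tpermD // eq_sym.
rewrite (eq_bigl (fun i => (i != x) && (i != y))) //.
rewrite !addnA ltn_add2r.
move: bxy lt; move: (b x) (b y) (f (s x)) (f (s y)) => u v w z; nia.
Qed.

Lemma pairing_le f s : block_sorted f -> keeps_blocks s ->
  pairing f s <= pairing f 1%g ?= iff [forall x, f (s x) == f x].
Proof.
move=> sf ks; have k1 : keeps_blocks 1%g by apply/forallP=> x; rewrite perm1.
case: (arg_maxnP (pairing f) k1) => m km mmax.
have fm := pairing_max sf km mmax.
have E1 : pairing f m = pairing f 1%g.
  by apply: eq_bigr => x _; rewrite fm perm1.
split; first by rewrite -E1; apply: mmax.
apply/eqP/forallP => [E x|E].
  apply/eqP/pairing_max => // s' ks'; rewrite E -E1; exact: mmax.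
by apply: eq_bigr => x _; rewrite perm1 (eqP (E x)).
Qed.

End Rearrangement.

Local Open Scope ring_scope.

(** * Young symmetrizers *)

Section Symmetrizers.

Variables (n l : nat).
Implicit Types (mu : intpart n l).

Definition row_stab mu (t : tableau mu) : {set 'S_n} :=
  [set s : 'S_n | [forall x, row_of (val t (s x)) == row_of (val t x)]].

Variables (k : fieldType) (N : nat) (rG : mx_representation k [set: 'S_n] N).

Definition row_sum mu (t : tableau mu) : 'M[k]_N := \sum_(s in row_stab t) rG s.

Definition col_alt mu (t : tableau mu) : 'M[k]_N :=
  \sum_(s in column_stab t) (-1) ^+ s *: rG s.

(** Representations act on row vectors from the right: the rows are symmetrized
    first. *)
Definition ysym mu (t : tableau mu) : 'M[k]_N := row_sum t *m col_alt t.

Lemma rstab_mulr mu (t : tableau mu) s u :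
  s \in row_stab t -> ((s * u)%g \in row_stab t) = (u \in row_stab t).
Proof.
rewrite !inE => /forallP fs; apply/forallP/forallP => H x.
  by have := H ((s^-1)%g x); have := fs ((s^-1)%g x);
     rewrite permM permKV => /eqP-> .
by rewrite permM (eqP (H _)) fs.
Qed.

Lemma cstab_mulr mu (t : tableau mu) s u :
  s \in column_stab t -> ((s * u)%g \in column_stab t) = (u \in column_stab t).
Proof.
rewrite !inE => /forallP fs; apply/forallP/forallP => H x.
  by have := H ((s^-1)%g x); have := fs ((s^-1)%g x);
     rewrite permM permKV => /eqP-> .
by rewrite permM (eqP (H _)) fs.
Qed.

Lemma rstab1 mu (t : tableau mu) : 1%g \in row_stab t.
Proof. by rewrite inE; apply/forallP=> x; rewrite perm1. Qed.

Lemma cstab1 mu (t : tableau mu) : 1%g \in column_stab t.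
Proof. by rewrite inE; apply/forallP=> x; rewrite perm1. Qed.

Lemma rstabV mu (t : tableau mu) s : s \in row_stab t -> (s^-1)%g \in row_stab t.
Proof. by move=> sR; rewrite -(rstab_mulr _ sR) mulgV rstab1. Qed.

Lemma cstabV mu (t : tableau mu) s : s \in column_stab t -> (s^-1)%g \in
    column_stab t.
Proof. by move=> sC; rewrite -(cstab_mulr _ sC) mulgV cstab1. Qed.

Lemma mul_row_sum mu (t : tableau mu) s : s \in row_stab t -> rG s *m row_sum t
    = row_sum t.
Proof.
move=> sR; rewrite /row_sum mulmx_sumr [RHS](reindex_inj (mulgI s)) /=.
by apply: eq_big => [u|u _]; rewrite ?rstab_mulr // repr_mxM ?inE.
Qed.

Lemma mul_col_alt mu (t : tableau mu) s :
  s \in column_stab t -> rG s *m col_alt t = (-1) ^+ s *: col_alt t.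
Proof.
move=> sC; rewrite /col_alt mulmx_sumr [in RHS](reindex_inj (mulgI s))
    scaler_sumr /=.
apply: eq_big => [u|u _]; rewrite ?cstab_mulr // -scalemxAr repr_mxM ?inE //.
by rewrite scalerA odd_permM signr_addb mulrA -signr_addb addbb mul1r.
Qed.

Lemma tperm_cstab mu (t : tableau mu) x y :
  col_of (val t x) = col_of (val t y) -> tperm x y \in column_stab t.
Proof.
by move=> E; rewrite inE; apply/forallP=> z; case: tpermP => [->|->|_ _];
    rewrite ?E.
Qed.

Lemma tperm_rstab mu (t : tableau mu) x y :
  row_of (val t x) = row_of (val t y) -> tperm x y \in row_stab t.
Proof.
by move=> E; rewrite inE; apply/forallP=> z; case: tpermP => [->|->|_ _];
    rewrite ?E.
Qed.

(** The transposition is absorbed by col_alt t up to the sign -1, so that the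
    image of v is its own opposite. *)
Lemma col_alt_kill mu (t : tableau mu) (v : 'rV_N) x y : (2%:R != 0 :> k) ->
    x != y -> col_of (val t x) = col_of (val t y) -> v *m rG (tperm x y) = v ->
  v *m col_alt t = 0.
Proof.
move=> two xy cxy fixv; have := mul_col_alt (tperm_cstab cxy).
rewrite odd_tperm xy expr1 scaleN1r => /(congr1 (mulmx v)).
rewrite mulmxA fixv mulmxN => /eqP; rewrite -addr_eq0 -mulr2n -scaler_nat.
by rewrite scaler_eq0 (negPf two) /= => /eqP.
Qed.

Lemma row_sum_kill mu (t : tableau mu) (v : 'rV_N) x y : (2%:R != 0 :> k) ->
    row_of (val t x) = row_of (val t y) -> v *m rG (tperm x y) = - v ->
  v *m row_sum t = 0.
Proof.
move=> two rxy oppv; have := mul_row_sum (tperm_rstab rxy) => /(congr1 (mulmx v)).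
rewrite mulmxA oppv mulNmx => /eqP; rewrite eq_sym -addr_eq0 -mulr2n -scaler_nat.
by rewrite scaler_eq0 (negPf two) /= => /eqP.
Qed.

End Symmetrizers.

Section TableauExists.

Variables (n l : nat) (mu : intpart n l).

Lemma card_cell : #|{: cell mu}| = n.
Proof.
rewrite card_sig -sum1_card (eq_bigl (fun c : 'I_l * 'I_n => true && (c.2 < part
    mu c.1)%N)) //.
rewrite -(pair_big_dep xpredT (fun (i : 'I_l) (j : 'I_n) => (j < part mu i)%N)
    (fun _ _ => 1%N)).
rewrite -[RHS](sum_part mu); apply: eq_bigr => i _.
rewrite -(big_mkord (fun j => j < part mu i)%N (fun=> 1%N)) -big_filter
    sum1_size size_filter.
by rewrite (eq_count (a2 := fun j => (0 <= j < part mu i)%N)) // count_between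
    ?subn0 // part_le_n.
Qed.

Lemma tableau_exists : exists t : tableau mu, true.
Proof.
pose f : {ffun 'I_n -> cell mu} := [ffun x => enum_val (cast_ord (esym
    card_cell) x)].
have fi : injectiveb f.
  by apply/injectiveP => x y; rewrite !ffunE => /enum_val_inj/cast_ord_inj.
by exists (exist _ f fi).
Qed.

Definition std_tab : tableau mu := xchoose tableau_exists.

Lemma tab_inj (t : tableau mu) : injective (val t).
Proof. exact: (injectiveP _ (valP t)). Qed.

Lemma tab_bij (t : tableau mu) : bijective (val t).
Proof. by apply: inj_card_bij (@tab_inj t) _; rewrite card_cell card_ord. Qed.

End TableauExists.

(** * Words *)

Section Words.

Variables (k : fieldType) (n L : nat).
Local Notation W := (word_repr k n L).
Local Notation word := (word n L).
Implicit Types (w : word) (c : nat -> nat).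

Definition has_cont c w : bool := [forall a : 'I_L, #|[set x | w x == a]| == c a].

Lemma has_cont_act c w s : has_cont c (word_act w s) = has_cont c w.
Proof.
apply: eq_forallb => a; congr (_ == _).
rewrite -[RHS](card_preimset _ (perm_inj (s := s^-1%g))).
by apply: eq_card => x; rewrite !inE ffunE.
Qed.

(** Young's permutation module. *)
Definition cont_mod c : 'M[k]_#|{: word}| := (\sum_(w | has_cont c w) <<word_vec
    k w>>)%MS.

Lemma word_vec_sub c w : has_cont c w -> (word_vec k w <= cont_mod c)%MS.
Proof. by move=> cw; rewrite (sumsmx_sup w) // genmxE. Qed.

Lemma cont_mod_module c : mxmodule W (cont_mod c).
Proof.
apply/mxmoduleP=> s _; rewrite sumsmxMr; apply/sumsmx_subP=> w cw.
by rewrite (eqmxMr _ (genmxE _)) /= word_vecE word_vec_sub // has_cont_act.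
Qed.

Lemma word_vec_row_sum l (mu : intpart n l) (t : tableau mu) w :
  word_vec k w *m row_sum W t = \sum_(s in row_stab t) word_vec k (word_act w s).
Proof. by rewrite mulmx_sumr; apply: eq_bigr => s _; rewrite /= word_vecE. Qed.

Lemma word_vec_col_alt l (mu : intpart n l) (t : tableau mu) w :
  word_vec k w *m col_alt W t =
  \sum_(s in column_stab t) (-1) ^+ s *: word_vec k (word_act w s).
Proof.
by rewrite mulmx_sumr; apply: eq_bigr => s _; rewrite -scalemxAr /= word_vecE.
Qed.

Lemma word_vec_ysym l (mu : intpart n l) (t : tableau mu) w :
  word_vec k w *m ysym W t =
  \sum_(r in row_stab t) \sum_(s in column_stab t)
     (-1) ^+ s *: word_vec k (word_act (word_act w r) s).
Proof.
rewrite mulmxA word_vec_row_sum mulmx_suml; apply: eq_bigr => r _.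
exact: word_vec_col_alt.
Qed.

Lemma word_vec_coord w w' : word_vec k w 0 (enum_rank w') = (w == w')%:R.
Proof. by rewrite mxE eqxx /= (inj_eq enum_rank_inj) eq_sym. Qed.

Lemma rank_cont_mod c : \rank (cont_mod c) = #|[set w | has_cont c w]|.
Proof.
rewrite /cont_mod /word_vec.
have := mxdirect_delta k (P := has_cont c) (f := enum_rank).
move=> /(_ (in2W enum_rank_inj))/mxdirectP -> /=.
rewrite -sum1dep_card; apply: eq_bigr => w _.
by rewrite mxrank_gen mxrank_delta.
Qed.

End Words.

(** * Triangularity *)

(** In a vanishing linear combination of the v i, let j have maximal height
    among the indices with nonzero coefficient: only v j has a nonzero
    coordinate e j. *)
Lemma triangular_rank (k : fieldType) (I : finType) (N r : nat)
    (v : I -> 'rV[k]_N) (e : I -> 'I_N) (h : I -> nat) (U : 'M[k]_(r, N)) :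
    (forall i, v i 0 (e i) != 0) ->
    (forall i j, v i 0 (e j) != 0 -> i = j \/ (h j < h i)%N) ->
    (forall i, (v i <= U)%MS) ->
  (#|I| <= \rank U)%N.
Proof.
move=> lead tri vU.
pose A := \matrix_(i < #|I|) v (enum_val i).
have AU : (A <= U)%MS by apply/row_subP => i; rewrite rowK.
apply: leq_trans (mxrankS AU).
suff : row_free A by rewrite /row_free => /eqP->.
apply/row_freeP; apply/row_freeP; rewrite -kermx_eq0; apply/rowV0P => c
    /sub_kermxP cA.
apply/eqP; apply: contraT => /matrix0Pn[i0 [j0 nz0]].
have {}nz0 : c 0 j0 != 0 by move: nz0; rewrite [i0]ord1.
case: (arg_maxnP (P := fun j => c 0 j != 0) (fun j => h (enum_val j)) nz0) => j
    nzj jmax.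
move/rowP: cA => /(_ (e (enum_val j))); rewrite !mxE (bigD1 j) //= !mxE.
rewrite big1 ?addr0 => [/eqP|i ij]; first by rewrite mulf_eq0 (negPf nzj) (negPf
    (lead _)).
rewrite !mxE; apply/eqP; rewrite mulf_eq0.
case: (eqVneq (c 0 i) 0) => //= nzi; apply: contraT => /tri[/enum_val_inj E|].
  by rewrite E eqxx in ij.
by rewrite ltnNge; move: (jmax i nzi) => /= ->.
Qed.

(** * Independence of semistandard tableaux *)

Section Independence.

Variables (k : fieldType) (n l : nat) (mu : intpart n l) (t : tableau mu).
Hypothesis charf0 : [pchar k] =i pred0.

Lemma natr_neq0 d : (0 < d)%N -> d%:R != 0 :> k.
Proof. by move=> d0; rewrite (proj1 (pcharf0P k) charf0) -lt0n. Qed.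

Lemma cell_inj (x y : cell mu) : row_of x = row_of y -> col_of x = col_of y -> x
    = y.
Proof.
by case: x y => [[i j] p] [[i' j'] p']; rewrite /row_of /col_of /= => E E';
    apply/val_inj; rewrite /= E E'.
Qed.

Let row x : nat := row_of (val t x).
Let col x : nat := col_of (val t x).

Let row_col_inj x y : row x = row y -> col x = col y -> x = y.
Proof. by move=> /val_inj E /val_inj E'; apply/(@tab_inj _ _ _ t)/cell_inj. Qed.

Let col_row_inj x y : col x = col y -> row x = row y -> x = y.
Proof. by move=> E /row_col_inj; apply. Qed.

Lemma keeps_rows s : s \in row_stab t -> keeps_blocks row s.
Proof.
rewrite inE => /forallP H; apply/forallP => x.
by rewrite /row (eqP (H x)).
Qed.

Lemma keeps_cols s : s \in column_stab t -> keeps_blocks col s.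
Proof.
rewrite inE => /forallP H; apply/forallP => x.
by rewrite /col (eqP (H x)).
Qed.

Definition read_tab L (T : {ffun cell mu -> 'I_L}) : word n L := [ffun x => T
    (val t x)].

Lemma read_tab_inj L : injective (@read_tab L).
Proof.
move=> T T' E; apply/ffunP=> x; have [u _ uK] := tab_bij t.
by have := congr1 (fun w : word n L => w (u x)) E; rewrite !ffunE uK.
Qed.

Lemma read_tab_content L c (T : {ffun cell mu -> 'I_L}) :
  tab_content c T -> has_cont c (read_tab T).
Proof.
move=> /forallP H; apply/forallP => a; rewrite -(eqP (H a)).
rewrite -[X in _ == X](on_card_preimset (f := val t)); last exact/onW_bij/tab_bij.
by apply/eqP/eq_card => x; rewrite !inE ffunE.
Qed.

Lemma rows_sorted L (T : {ffun cell mu -> 'I_L}) : ssyt T ->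
  block_sorted row col (fun x => read_tab T x : nat).
Proof.
move=> /forallP S x y rxy cxy; have /forallP/(_ (val t y))/andP[/implyP H _] :=
    S (val t x).
by rewrite !ffunE; apply: H; rewrite (ltnW cxy) andbT; apply/eqP/val_inj.
Qed.

Lemma cols_sorted L (T : {ffun cell mu -> 'I_L}) x y : ssyt T ->
  col x = col y -> (row x < row y)%N -> (read_tab T x < read_tab T y)%N.
Proof.
move=> /forallP S cxy rxy; have /forallP/(_ (val t y))/andP[_ /implyP H] := S
    (val t x).
by rewrite !ffunE; apply: H; rewrite rxy andbT; apply/eqP/val_inj.
Qed.

Lemma cols_distinct L (T : {ffun cell mu -> 'I_L}) x y : ssyt T ->
  col x = col y -> read_tab T x = read_tab T y -> x = y.
Proof.
move=> S cxy E; case: (ltngtP (row x) (row y)) => [lt|lt|]; last exact: col_row_inj.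
  by have := cols_sorted S cxy lt; rewrite E ltnn.
by have := cols_sorted S (esym cxy) lt; rewrite E ltnn.
Qed.

Let weight L (w : word n L) : nat := pairing col (fun x => w x : nat) 1%g.

Let weight_act L (w : word n L) s :
  weight (word_act w s) = pairing col (fun x => w x : nat) (s^-1)%g.
Proof. by apply: eq_bigr => x _; rewrite ffunE perm1. Qed.

Lemma weight_col L (w : word n L) s : s \in column_stab t ->
  weight (word_act w s) = weight w.
Proof.
move=> sC; rewrite weight_act /weight /pairing [RHS](reindex_inj (perm_inj (s :=
    s^-1)%g)) /=.
apply: eq_bigr => x _; rewrite perm1; congr (_ * _)%N.
by apply/esym/eqP; have /forallP := keeps_cols (cstabV sC); apply.
Qed.

Lemma weight_row L (T : {ffun cell mu -> 'I_L}) s : ssyt T -> s \in row_stab t ->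
  (weight (word_act (read_tab T) s) <= weight (read_tab T)
    ?= iff (word_act (read_tab T) s == read_tab T))%N.
Proof.
move=> S sR; rewrite weight_act.
have := pairing_le row_col_inj (rows_sorted S) (keeps_rows (rstabV sR)).
congr (_ <= _ ?= iff _)%N; apply/forallP/eqP => [H|E x].
  by apply/ffunP=> x; rewrite ffunE; apply/val_inj/eqP/H.
by have := congr1 (fun w : word n L => w x) E; rewrite ffunE => ->.
Qed.

(** The weight is the sum over the cells of the column number times the entry.
    Permuting the entries of a column preserves it; permuting those of the rows
    of a semistandard tableau lowers it, unless the tableau is unchanged, by the
    rearrangement inequality. *)
Lemma ysym_lead L (T T' : {ffun cell mu -> 'I_L}) r s : ssyt T -> ssyt T' ->
    r \in row_stab t -> s \in column_stab t ->
    word_act (word_act (read_tab T) r) s = read_tab T' ->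
  [/\ T = T', word_act (read_tab T) r = read_tab T & s = 1%g] \/
  (weight (read_tab T') < weight (read_tab T))%N.
Proof.
move=> S S' rR sC E; have [le eq] := weight_row S rR.
have wT' : weight (read_tab T') = weight (word_act (read_tab T) r).
  by rewrite -E weight_col.
move: le; rewrite -wT' leq_eqVlt => /orP[|lt]; last by right.
rewrite wT' eq => /eqP ET; left; rewrite ET in E.
have fix_ : read_tab T' = read_tab T.
  apply/ffunP => x; apply/val_inj.
  apply: (@block_sorted_uniq _ col row col_row_inj (fun y => read_tab T y : nat)
            (fun y => read_tab T' y : nat) _ (keeps_cols (cstabV sC))) => [y z|y
                z|y] /=.
  - by move=> cyz ryz; apply/ltnW/(cols_sorted S).
  - by move=> cyz ryz; apply/ltnW/(cols_sorted S').
  by rewrite -E [in LHS]ffunE.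
split=> //; first exact/esym/read_tab_inj.
apply/permP => x; rewrite perm1; apply/eqP; rewrite eq_sym -(inj_eq (perm_inj (s
    := (s^-1)%g))) permK.
apply/eqP/(cols_distinct S).
  by apply/eqP; have /forallP := keeps_cols (cstabV sC); apply.
by have := congr1 (fun w : word n L => w x) E; rewrite fix_ [LHS]ffunE.
Qed.

Lemma ssyts_le_rank L c :
  (#|ssyts mu L c| <= \rank (cont_mod k n L c *m ysym (word_repr k n L) t))%N.
Proof.
have in_ssyt (T : {T | T \in ssyts mu L c}) : ssyt (val T).
  by have := valP T; rewrite inE => /andP[].
rewrite -[#|_|](card_sig (mem (ssyts mu L c))).
pose v (T : {T | T \in ssyts mu L c}) :=
  word_vec k (read_tab (val T)) *m ysym (word_repr k n L) t.
have vE (T T' : {T | T \in ssyts mu L c}) : v T 0 (enum_rank (read_tab (val T'))) =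
    \sum_(r in row_stab t) \sum_(s in column_stab t)
     (-1) ^+ s * (word_act (word_act (read_tab (val T)) r) s == read_tab (val
         T'))%:R.
  rewrite /v word_vec_ysym summxE; apply: eq_bigr => r _; rewrite summxE.
  by apply: eq_bigr => s _; rewrite mxE word_vec_coord.
apply: (triangular_rank (v := v) (e := fun T => enum_rank (read_tab (val T)))
         (h := fun T => weight (read_tab (val T)))).
- move=> T; rewrite vE.
  rewrite (eq_bigr (fun r => (word_act (read_tab (val T)) r == read_tab (val
      T))%:R)).
    rewrite -natr_sum natr_neq0 // (bigD1 1%g) ?rstab1 //=.
    by rewrite word_act1 eqxx.
  move=> r rR; rewrite (bigD1 1%g) ?cstab1 //= odd_perm1 expr0 mul1r word_act1.
  rewrite big1 ?addr0 // => s /andP[sC s1]; case: eqP => [E|_]; last by rewrite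
      mulr0.
  case: (ysym_lead (in_ssyt T) (in_ssyt T) rR sC E) => [[_ _ E1]|].
    by rewrite E1 eqxx in s1.
  by rewrite ltnn.
- move=> T T'; rewrite vE; have [->|ne] := eqVneq T T'; first by left.
  move=> nz; right; apply: contraNT nz => nlt; apply/eqP.
  rewrite big1 // => r rR; rewrite big1 // => s sC; case: eqP => [E|_]; last by
      rewrite mulr0.
  case: (ysym_lead (in_ssyt T) (in_ssyt T') rR sC E) => [[E1 _ _]|].
    by rewrite (val_inj E1) eqxx in ne.
  by move=> lt; rewrite lt in nlt.
move=> T; rewrite submxMr // word_vec_sub //; apply: read_tab_content.
by have := valP T; rewrite inE => /andP[].
Qed.

End Independence.

(** * Specht modules *)

Section Specht.

Variables (k : fieldType) (n l : nat) (mu : intpart n l).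
Hypothesis charf0 : [pchar k] =i pred0.
Implicit Type t : tableau mu.
Local Notation W := (word_repr k n l).

Lemma neq2 : 2%:R != 0 :> k. Proof. exact: natr_neq0. Qed.

Lemma same_cell t x y :
  row_of (val t x) = row_of (val t y) -> col_of (val t x) = col_of (val t y) ->
      x = y.
Proof. by move=> E E'; apply/(@tab_inj _ _ _ t)/cell_inj. Qed.

Lemma tabloid_fix t s : s \in column_stab t ->
  word_act (tabloid t) s = tabloid t -> s = 1%g.
Proof.
move=> /cstabV; rewrite inE => /forallP sC E; apply/permP=> x; rewrite perm1.
apply: (@perm_inj _ (s^-1)%g); rewrite permK; apply/esym/(@same_cell t).
  by have := congr1 (fun w : word n l => w x) E; rewrite !ffunE.
exact/eqP/sC.
Qed.

Lemma polytabloidE t : polytabloid k t = word_vec k (tabloid t) *m col_alt W t.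
Proof. by rewrite word_vec_col_alt. Qed.

Lemma tabloidE t x : tabloid t x = row_of (val t x).
Proof. by rewrite ffunE. Qed.

Lemma word_actE (w : word n l) s x : word_act w s x = w ((s^-1)%g x).
Proof. by rewrite ffunE. Qed.

Lemma polytabloid_coord t w : polytabloid k t 0 (enum_rank w) =
  \sum_(s in column_stab t) (-1) ^+ s * (word_act (tabloid t) s == w)%:R.
Proof.
by rewrite /polytabloid summxE; apply: eq_bigr => s _; rewrite mxE word_vec_coord.
Qed.

Lemma polytabloid_lead t : polytabloid k t 0 (enum_rank (tabloid t)) = 1.
Proof.
rewrite polytabloid_coord (bigD1 1%g) ?cstab1 //= odd_perm1 expr0 mul1r
    word_act1 eqxx.
rewrite big1 ?addr0 // => s /andP[sC s1]; case: eqP => [E|_]; last by rewrite mulr0.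
by rewrite (tabloid_fix sC E) eqxx in s1.
Qed.

Lemma polytabloid_neq0 t : polytabloid k t != 0.
Proof.
apply/eqP => /rowP/(_ (enum_rank (tabloid t))).
by rewrite polytabloid_lead mxE => /eqP; rewrite oner_eq0.
Qed.

Definition tab_of (T : {ffun cell mu -> 'I_n}) : {ffun 'I_n -> cell mu} :=
  [ffun y => odflt (val (std_tab mu) y) [pick x | T x == y]].

Section Standard.

Variable T : {ffun cell mu -> 'I_n}.
Hypothesis T_std : T \in ssyts mu n (fun=> 1%N).

Lemma tab_ofK y : T (tab_of T y) = y.
Proof.
rewrite ffunE; case: pickP => [x /eqP //|none].
move: T_std; rewrite inE => /andP[_ /forallP/(_ y)].
by rewrite (eq_card0 (A := [set x | T x == y])) // => x; rewrite inE none.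
Qed.

Lemma tab_of_inj : injectiveb (tab_of T).
Proof. by apply/injectiveP; apply: can_inj tab_ofK. Qed.

Definition tab_std : tableau mu :=
  exist (fun u : {ffun 'I_n -> cell mu} => injectiveb u) _ tab_of_inj.

Let row x : nat := row_of (val tab_std x).
Let col x : nat := col_of (val tab_std x).

Lemma col_id_inj (x y : 'I_n) : col x = col y -> x = y :> nat -> x = y.
Proof. by move=> _ /val_inj. Qed.

Lemma tab_std_sorted : block_sorted col (@nat_of_ord n) row.
Proof.
move=> x y cxy xy; rewrite leqNgt; apply/negP => lt.
move: T_std; rewrite inE => /andP[/forallP/(_ (tab_of T y))/forallP/(_ (tab_of T
    x))].
case/andP=> _ /implyP; rewrite !tab_ofK => H _; move: xy; rewrite ltnNge ltnW //.
by apply: H; rewrite lt andbT; apply/eqP/val_inj/esym.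
Qed.

End Standard.

Let weight (w : word n l) : nat := pairing (@nat_of_ord n) (fun x => w x : nat) 1%g.

(** The analogue of ysym_lead for polytabloids of standard tableaux: now the
    tabloid of t is rearranged by column permutations, and its weight is the
    sum over the entries of the entry times its row number. *)
Lemma tab_std_lead T (T_std : T \in ssyts mu n (fun=> 1%N)) T' (T'_std : T' \in
    ssyts mu n (fun=> 1%N)) s :
    s \in column_stab (tab_std T_std) ->
    word_act (tabloid (tab_std T_std)) s = tabloid (tab_std T'_std) ->
  T = T' \/ (weight (tabloid (tab_std T'_std)) < weight (tabloid (tab_std
      T_std)))%N.
Proof.
have K := tab_ofK T_std; have K' := tab_ofK T'_std.
have inj := @col_id_inj _ T_std; have srt := tab_std_sorted (T_std := T_std).
rewrite -[tab_of T]/(val (tab_std T_std)) in K; rewrite -[tab_of T']/(val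
    (tab_std T'_std)) in K'.
move: (tab_std T_std) (tab_std T'_std) K K' inj srt => t t' K K' inj srt sC E.
have [] := pairing_le inj srt (keeps_cols (cstabV sC)).
have wE : weight (tabloid t) = pairing (@nat_of_ord n) (fun x => row_of (val t
    x) : nat) 1%g.
  by apply: eq_bigr => x _; rewrite ffunE.
have wE' : weight (tabloid t') = pairing (@nat_of_ord n) (fun x => row_of (val t
    x) : nat) (s^-1)%g.
  by rewrite -E; apply: eq_bigr => x _; rewrite !ffunE perm1.
rewrite -wE -wE' leq_eqVlt => /orP[/eqP-> |]; last by right.
rewrite eqxx => /esym/forallP fixr; left.
have rows_eq x : row_of (val t x) = row_of (val t' x).
  have := congr1 (fun w : word n l => w x) E; rewrite !ffunE => <-.
  by apply/val_inj/eqP; rewrite eq_sym; apply: fixr.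
(* both fillings are increasing along the rows, which have the same entries *)
have [u uK Ku] := tab_bij t; have [u' u'K Ku'] := tab_bij t'.
pose f (x : cell mu) : cell mu := val t' (u x).
have f_inj : injective f.
  by move=> x y /(@tab_inj _ _ _ t') /(can_inj Ku).
pose s' := perm f_inj.
have inc (U : {ffun cell mu -> 'I_n}) : U \in ssyts mu n (fun=> 1%N) ->
   block_sorted (fun x : cell mu => row_of x : nat) (fun x : cell mu => col_of x
       : nat) (fun x => U x : nat).
  rewrite inE => /andP[/forallP S _] x y rxy cxy.
  have /forallP/(_ y)/andP[/implyP H _] := S x.
  by apply: H; rewrite (ltnW cxy) andbT; apply/eqP/val_inj.
have T'f x : T' (f x) = T x.
  by rewrite /f K' -[in RHS](Ku x) K.
apply/ffunP => x; apply/val_inj; move: x => /=.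
apply: (@block_sorted_uniq _ (fun x : cell mu => row_of x : nat)
   (fun x : cell mu => col_of x : nat) _ (fun x => T' x : nat) (fun x => T x :
       nat) s').
- by move=> x y /val_inj E1 /val_inj E2; apply: cell_inj.
- by apply/forallP => x; rewrite permE /f -rows_eq Ku.
- exact: inc.
- exact: inc.
by move=> x; rewrite permE T'f.
Qed.

Lemma ssyts_le_specht : (#|ssyts mu n (fun=> 1%N)| <= \rank (specht_mx k mu))%N.
Proof.
rewrite -[#|_|](card_sig (mem (ssyts mu n (fun=> 1%N)))).
pose tt (T : {T | T \in ssyts mu n (fun=> 1%N)}) := tab_std (valP T).
apply: (triangular_rank (v := fun T => polytabloid k (tt T)) (e := fun T =>
    enum_rank (tabloid (tt T)))
         (h := fun T => weight (tabloid (tt T)))).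
- by move=> T; rewrite polytabloid_lead oner_neq0.
- move=> T T'; rewrite polytabloid_coord; have [->|ne] := eqVneq T T'; first by
    left.
  move=> nz; right; apply: contraNT nz => nlt; apply/eqP.
  rewrite big1 // => s sC; case: eqP => [E|_]; last by rewrite mulr0.
  case: (tab_std_lead sC E) => [E1|lt]; first by rewrite (val_inj E1) eqxx in ne.
  by rewrite lt in nlt.
by move=> T; rewrite /specht_mx (sumsmx_sup (tt T)) // genmxE.
Qed.

End Specht.

(** * Words with distinct letters in each column *)

Section ColumnInjective.

Variables (n l : nat) (mu : intpart n l) (t : tableau mu).
Local Open Scope nat_scope.

Definition col_injective L (w : word n L) : bool :=
  [forall x, forall y,
     (col_of (val t x) == col_of (val t y)) && (w x == w y) ==> (x == y)].

Lemma col_injectiveP L (w : word n L) :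
  reflect (forall x y, col_of (val t x) = col_of (val t y) -> w x = w y -> x = y)
          (col_injective w).
Proof.
apply: (iffP forallP) => [H x y cxy wxy|H x].
  by have /forallP/(_ y) := H x; rewrite cxy wxy !eqxx => /eqP.
by apply/forallP => y; apply/implyP => /andP[/eqP cxy /eqP wxy]; apply/eqP/H.
Qed.

Definition below L (w : word n L) r (j : 'I_n) : {set 'I_n} :=
  [set x | (col_of (val t x) == j) && (w x < r)].

(** The letters of a column being distinct, a column of height h holds at most
    min(r, h) letters among 0, ..., r - 1, which is the number of its cells in
    the first r rows. *)
Lemma below_le L (w : word n L) r j : col_injective w ->
  #|below w r j| <= #|below (tabloid t) r j|.
Proof.
move=> /col_injectiveP wi.
case: (boolP [exists x, (col_of (val t x) == j) && (r <= row_of (val t x))]).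
  case/existsP=> x /andP[/eqP cx rx].
  apply: (@leq_trans r).
    case: (posnP r) => [->|r0].
      by rewrite leqn0 cards_eq0; apply/eqP/setP => y; rewrite !inE ltn0 andbF.
    pose f (y : 'I_n) : 'I_r := insubd (Ordinal r0) (w y : nat).
    rewrite -[X in _ <= X]card_ord -(card_in_imset (f := f)); first exact: max_card.
    move=> y z; rewrite !inE => /andP[/eqP cy wy] /andP[/eqP cz wz] /(congr1 val).
    rewrite !val_insubd wy wz => /val_inj E; apply: wi => //; by rewrite cy cz.
  have [u uK Ku] := tab_bij t.
  have lt (i : 'I_r) : i < l.
    by apply: leq_trans (ltn_ord i) _; apply: leq_trans rx _; apply: ltnW.
  have inmu (i : 'I_r) : j < part mu i.
    apply: leq_trans (part_le mu (leq_trans (ltnW (ltn_ord i)) rx)).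
    by rewrite -cx; exact: (valP (val t x)).
  pose c (i : 'I_r) : cell mu := exist (fun c : 'I_l * 'I_n => c.2 < part mu
      c.1) (Ordinal (lt i), j) (inmu i).
  rewrite -[X in X <= _]card_ord -(card_imset (f := fun i : 'I_r => u (c i))).
    apply/subset_leq_card/subsetP => y /imsetP[i _ ->].
    by rewrite !inE tabloidE Ku /row_of /col_of /= eqxx ltn_ord.
  move=> i i' /(can_inj Ku) /(congr1 (fun z : cell mu => row_of z : nat)) /= E.
  exact: val_inj.
rewrite negb_exists => /forallP H; apply/subset_leq_card/subsetP => x.
rewrite !inE => /andP[cx _]; rewrite cx tabloidE ltnNge.
by have := H x; rewrite cx.
Qed.

Lemma card_below L (w : word n L) r : \sum_j #|below w r j| = #|[set x | w x < r]|.
Proof.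
rewrite -sum1dep_card [RHS](partition_big (fun x => col_of (val t x)) xpredT) //=.
apply: eq_bigr => j _; rewrite -sum1dep_card; apply: eq_bigl => x.
by rewrite andbC.
Qed.

Lemma card_rows_below r : r <= l ->
  #|[set x | tabloid t x < r]| = \sum_(i < r) part mu i.
Proof.
move=> rl; rewrite -(card_imset _ (@tab_inj _ _ _ t)).
rewrite (eq_card (B := [set c : cell mu | row_of c < r])); last first.
  move=> c; rewrite inE; apply/imsetP/idP => [[x]|cr]; first by rewrite inE
      tabloidE => ? ->.
  have [u uK Ku] := tab_bij t.
  by exists (u c); rewrite ?Ku // inE tabloidE Ku.
rewrite -(card_imset _ val_inj) /=.
rewrite (eq_card (B := [set c : 'I_l * 'I_n | (c.1 < r) && (c.2 < part mu
    c.1)])); last first.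
  move=> c; rewrite inE; apply/imsetP/andP => [[x]|[c1 c2]].
    by rewrite inE => xr ->; split=> //; apply: (valP x).
  by exists (exist _ c c2); rewrite ?inE.
rewrite -sum1dep_card.
rewrite -(pair_big_dep (fun i : 'I_l => i < r) (fun (i : 'I_l) (j : 'I_n) => (j
    < part mu i)%N) (fun _ _ => 1%N)).
rewrite (big_ord_widen_cond l xpredT (fun i => part mu i) rl) /=.
apply: eq_bigr => i _.
rewrite -(big_mkord (fun j => j < part mu i)%N (fun=> 1%N)) -big_filter
    sum1_size size_filter.
by rewrite (eq_count (a2 := fun j => (0 <= j < part mu i)%N)) // count_between
    ?subn0 // part_le_n.
Qed.

Lemma col_injective_dom L (w : word n L) r : r <= l -> col_injective w ->
  #|[set x | w x < r]| <= \sum_(i < r) part mu i.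
Proof.
move=> rl wi; rewrite -card_rows_below // -!card_below.
by apply: leq_sum => j _; apply: below_le.
Qed.

Lemma has_cont_below L c (w : word n L) r : r <= L -> has_cont c w ->
  #|[set x | w x < r]| = \sum_(i < r) c i.
Proof.
move=> rL /forallP cw; rewrite (big_ord_widen_cond L xpredT c rL) /=.
rewrite -sum1dep_card [LHS](partition_big w (fun a : 'I_L => a < r)) //=.
apply: eq_bigr => a ar; rewrite -(eqP (cw a)) -sum1dep_card; apply: eq_bigl => x.
by case: eqP => [->|]; rewrite ?andbF ?andbT.
Qed.

(** When the content is mu all the inequalities of below_le are equalities, so
    the letters of a column of height h are exactly 0, ..., h - 1. *)
Lemma col_injective_tabloid (w : word n l) : has_cont (part mu) w ->
    col_injective w ->
  exists2 s, s \in column_stab t & w = word_act (tabloid t) s.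
Proof.
move=> cw wi.
have tot r : r <= l -> \sum_j #|below w r j| = \sum_j #|below (tabloid t) r j|.
  by move=> rl; rewrite !card_below card_rows_below // (has_cont_below rl cw).
have eq_below r j : r <= l -> #|below w r j| = #|below (tabloid t) r j|.
  move=> rl; apply/eqP; have [_] := leqif_sum (fun j (_ : true) => leqif_eq
      (below_le r j wi)).
  by rewrite tot // eqxx => /esym/forallP/(_ j).
have split_below (v : word n l) i j :
    #|below v i.+1 j| = #|below v i j| + #|[set x | (col_of (val t x) == j) &&
        (v x == i :> nat)]|.
  rewrite -cardsUI [X in _ = _ + X](_ : _ = 0) ?addn0.
    apply: eq_card => x; rewrite !inE ltnS leq_eqVlt.
    by case: (_ == j) => //=; rewrite orbC.
  by apply: eq_card0 => x; rewrite !inE; case: eqP => //= _; case: ltngtP.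
have ex y : exists x, (col_of (val t x) == col_of (val t y)) && (tabloid t x ==
    w y).
  have := split_below w (w y) (col_of (val t y)).
  rewrite eq_below // split_below eq_below ?(ltnW (ltn_ord _)) //.
  move=> /addnI E; suff : 0 < #|[set x | (col_of (val t x) == col_of (val t y))
      && (tabloid t x == w y :> nat)]|.
    by rewrite card_gt0 => /set0Pn[x]; rewrite inE => H; exists x.
  by rewrite E card_gt0; apply/set0Pn; exists y; rewrite inE !eqxx.
pose f y := xchoose (ex y).
have fP y : col_of (val t (f y)) = col_of (val t y) /\ tabloid t (f y) = w y.
  by have /andP[/eqP ? /eqP ?] := xchooseP (ex y).
have fi : injective f.
  move=> y z E; have [c1 w1] := fP y; have [c2 w2] := fP z.
  by apply: (col_injectiveP _ wi); rewrite -?c1 -?c2 -?w1 -?w2 E.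
exists (perm fi)^-1%g.
  by apply: cstabV; rewrite inE; apply/forallP => y; rewrite permE (proj1 (fP y)).
by apply/ffunP => y; rewrite word_actE invgK permE (proj2 (fP y)).
Qed.

End ColumnInjective.

Section Killing.

Variables (k : fieldType) (n l : nat).
Hypothesis charf0 : [pchar k] =i pred0.
Implicit Type mu : intpart n l.

Lemma word_col_alt_kill L mu (t : tableau mu) (w : word n L) : ~~ col_injective
    t w ->
  word_vec k w *m col_alt (word_repr k n L) t = 0.
Proof.
case/forallPn=> x /forallPn[y]; rewrite negb_imply => /andP[/andP[/eqP cxy /eqP
    wxy] xy].
apply: (col_alt_kill (neq2 charf0) xy cxy); rewrite /= word_vecE; congr word_vec.
by apply/ffunP => z; rewrite ffunE tpermV; case: tpermP => [->|->|].
Qed.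

Lemma dominatesP mu nu :
  reflect (forall r, (r <= l)%N -> (\sum_(i < r) part nu i <= \sum_(i < r) part
      mu i)%N)
          (dominates mu nu).
Proof.
apply: (iffP forallP) => [H r rl|H r]; first exact: (H (Ordinal (rl : (r <
    l.+1)%N))).
by apply: H; rewrite -ltnS.
Qed.

Lemma cont_mod_col_alt_dom L c mu (t : tableau mu) r :
    cont_mod k n L c *m col_alt (word_repr k n L) t != 0 -> (r <= l)%N -> (r <=
        L)%N ->
  (\sum_(i < r) c i <= \sum_(i < r) part mu i)%N.
Proof.
move=> nz rl rL; suff [w cw wi] : exists2 w : word n L, has_cont c w &
    col_injective t w.
  by rewrite -(has_cont_below rL cw) (col_injective_dom rl wi).
apply/exists_inP; apply: contraNT nz; rewrite negb_exists_in => /forall_inP H.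
rewrite -submx0 /cont_mod sumsmxMr; apply/sumsmx_subP => w cw.
by rewrite (eqmxMr _ (genmxE _)) word_col_alt_kill ?sub0mx //; apply: H.
Qed.

Lemma dominates_anti mu nu : dominates mu nu -> dominates nu mu -> mu = nu.
Proof.
move=> /dominatesP H /dominatesP H'.
have E r : (r <= l)%N -> (\sum_(i < r) part nu i = \sum_(i < r) part mu i)%N.
  by move=> rl; apply/eqP; rewrite eqn_leq H ?H'.
apply/val_inj/eq_from_tnth => i; apply/val_inj => /=.
rewrite -!part_tnth; have := E i.+1 (ltn_ord i).
by rewrite !big_ord_recr /= E ?(ltnW (ltn_ord i)) // => /addnI.
Qed.

End Killing.

(** * Specht modules are simple and pairwise non-isomorphic *)

Section Hom.

Variables (k : fieldType) (n l N N' : nat).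
Variables (rG : mx_representation k [set: 'S_n] N) (rG' : mx_representation k
    [set: 'S_n] N').

Lemma ysym_hom (mu : intpart n l) (t : tableau mu) (f : 'M[k]_(N, N')) :
  (forall s, rG s *m f = f *m rG' s) -> ysym rG t *m f = f *m ysym rG' t.
Proof.
move=> fh; rewrite /ysym -mulmxA.
have -> : col_alt rG t *m f = f *m col_alt rG' t.
  rewrite mulmx_suml mulmx_sumr; apply: eq_bigr => s _.
  by rewrite -scalemxAl fh scalemxAr.
rewrite !mulmxA; congr (_ *m _).
by rewrite mulmx_suml mulmx_sumr; apply: eq_bigr => s _.
Qed.

End Hom.

Section SpechtSimple.

Variables (k : fieldType) (n l : nat).
Hypothesis charf0 : [pchar k] =i pred0.
Implicit Types mu nu : intpart n l.
Local Notation W := (word_repr k n l).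

Lemma maschke N (rG : mx_representation k [set: 'S_n] N) :
    mx_completely_reducible rG 1%:M.
Proof. by apply: mx_Maschke_pchar; rewrite /pgroup pcharf'_nat natr_neq0
    ?cardG_gt0. Qed.

Lemma col_alt_sq N (rG : mx_representation k [set: 'S_n] N) mu (t : tableau mu) :
  col_alt rG t *m col_alt rG t = #|column_stab t|%:R *: col_alt rG t.
Proof.
rewrite {1}/col_alt mulmx_suml (eq_bigr (fun=> col_alt rG t)).
  by rewrite sumr_const scaler_nat.
move=> s sC; rewrite -scalemxAl mul_col_alt // scalerA -signr_addb addbb.
by rewrite scale1r.
Qed.

Lemma col_alt_mulr N (rG : mx_representation k [set: 'S_n] N) mu (t : tableau
    mu) s :
  s \in column_stab t -> col_alt rG t *m rG s = (-1) ^+ s *: col_alt rG t.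
Proof.
move=> sC; rewrite /col_alt mulmx_suml [in RHS](reindex_inj (mulIg s))
    scaler_sumr /=.
have inv u : (u \in column_stab t) = (u^-1%g \in column_stab t).
  by apply/idP/idP => /cstabV; rewrite ?invgK.
apply: eq_big => [u|u _].
  by rewrite inv [RHS]inv invMg cstab_mulr // -inv.
rewrite -scalemxAl repr_mxM ?inE // scalerA odd_permM signr_addb mulrC -mulrA.
by rewrite -signr_addb addbb mulr1.
Qed.

Lemma tabloid_content mu (t : tableau mu) : has_cont (part mu) (tabloid t).
Proof.
apply/forallP => a.
have E : (\sum_(i < a.+1) part mu i = \sum_(i < a) part mu i + part mu a)%N.
  by rewrite big_ord_recr.
rewrite -(eqn_add2l (\sum_(i < a) part mu i)) -E.
rewrite -(card_rows_below t (ltn_ord a)) -(card_rows_below t (ltnW (ltn_ord a))).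
rewrite -cardsUI [X in (_ + X)%N == _](_ : _ = 0%N) ?addn0; last first.
  by apply: eq_card0 => x; rewrite !inE; case: (eqVneq (tabloid t x)) => [->|];
      rewrite ?ltnn ?andbF.
apply/eqP. apply: eq_card => x; rewrite !inE ltnS [RHS]leq_eqVlt orbC -val_eqE.
by [].
Qed.

Lemma specht_sub_cont mu : (specht_mx k mu <= cont_mod k n l (part mu))%MS.
Proof.
apply/sumsmx_subP => t _; rewrite genmxE polytabloidE word_vec_col_alt.
apply: summx_sub => s _; apply/scalemx_sub/word_vec_sub.
by rewrite has_cont_act tabloid_content.
Qed.

Lemma polytabloid_sub mu (t : tableau mu) : (polytabloid k t <= specht_mx k mu)%MS.
Proof. by rewrite (sumsmx_sup t) // genmxE. Qed.

Lemma cont_col_alt_sub mu (t : tableau mu) :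
  (cont_mod k n l (part mu) *m col_alt W t <= polytabloid k t)%MS.
Proof.
rewrite /cont_mod sumsmxMr; apply/sumsmx_subP => w cw; rewrite (eqmxMr _ (genmxE
    _)).
have [wi|] := boolP (col_injective t w); last by move/(word_col_alt_kill
    charf0)->; apply: sub0mx.
have [s sC ->] := col_injective_tabloid cw wi.
rewrite -word_vecE -mulmxA (mul_col_alt W sC) -scalemxAr -polytabloidE.
exact: scalemx_sub.
Qed.

Lemma specht_ysym_sub mu (t : tableau mu) :
  (specht_mx k mu *m ysym W t <= polytabloid k t)%MS.
Proof.
rewrite mulmxA; apply: submx_trans (cont_col_alt_sub t); apply: submxMr.
apply: submx_trans (submxMr _ (specht_sub_cont mu)) _.
rewrite mulmx_sumr; apply: summx_sub => s _.
exact: (mxmoduleP (cont_mod_module k n l (part mu))).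
Qed.

Lemma tableau_trans mu (t t' : tableau mu) : exists s, polytabloid k t *m W s =
    polytabloid k t'.
Proof.
have [u uK Ku] := tab_bij t; have [u' u'K Ku'] := tab_bij t'.
have fi : injective (fun x => u' (val t x)).
  by move=> x y /(can_inj Ku')/(@tab_inj _ _ _ t).
exists (perm fi); rewrite /= polytabloid_act; congr polytabloid.
apply/val_inj/ffunP => x; rewrite ffunE.
by rewrite -{2}(permKV (perm fi) x) permE Ku'.
Qed.

Lemma specht_sub_module mu (t : tableau mu) (X : 'M_#|{: word n l}|) : mxmodule
    W X ->
  (polytabloid k t <= X)%MS -> (specht_mx k mu <= X)%MS.
Proof.
move=> modX tX; apply/sumsmx_subP => t' _; rewrite genmxE.
by have [s <-] := tableau_trans t t'; apply: mxmodule_trans.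
Qed.

(** If col_alt t does not kill the submodule U, then U contains the polytabloid
    of t, which generates. If it does, the polytabloid of t, being a multiple of
    its own image under col_alt t, lies in the complement of U given by
    Maschke's theorem. *)
Theorem specht_simple mu : mxsimple W (specht_mx k mu).
Proof.
set t := std_tab mu; have modS := specht_mxmodule k mu; split=> //.
  by apply/eqP => S0; have := polytabloid_sub t; rewrite S0 submx0 (negPf
      (polytabloid_neq0 k t)).
move=> U modU US nzU.
have col_alt_sub (X : 'M_#|{: word n l}|) : mxmodule W X -> (X *m col_alt W t <=
    X)%MS.
  move=> modX; rewrite mulmx_sumr; apply: summx_sub => s _.
  by rewrite -scalemxAr; apply/scalemx_sub/(mxmoduleP modX); rewrite inE.
have [tU|ntU] := eqVneq (U *m col_alt W t) 0; last first.
  have sub : (U *m col_alt W t <= polytabloid k t)%MS.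
    by apply: submx_trans (cont_col_alt_sub t); apply/submxMr/(submx_trans
        US)/specht_sub_cont.
  apply: (@specht_sub_module _ t) => //; apply: submx_trans (col_alt_sub _ modU).
  rewrite -(geq_leqif (mxrank_leqif_sup sub)).
  by apply: leq_trans (rank_leq_row _) _; rewrite lt0n mxrank_eq0.
have [V modV defS dxUV] := mx_reducibleS modS (submx1 _) (@maschke _ W) modU US.
have /sub_addsmxP[[a b] /= ab] : (polytabloid k t <= U + V)%MS.
  by rewrite defS polytabloid_sub.
have tV : (polytabloid k t <= V)%MS.
  have : (polytabloid k t *m col_alt W t <= V)%MS.
    rewrite ab mulmxDl -!mulmxA tU mulmx0 add0r.
    by apply: mulmx_sub; apply: col_alt_sub.
  rewrite polytabloidE -mulmxA col_alt_sq -scalemxAr -polytabloidE eqmx_scale //.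
  by rewrite natr_neq0 // (cardD1 1%g) cstab1.
have SV := specht_sub_module modV tV.
case/negP: nzU; rewrite -submx0 -(mxdirect_addsP dxUV) sub_capmx submx_refl.
exact: submx_trans SV.
Qed.

Lemma specht_row_sum_dom mu nu (s : tableau nu) (t : tableau mu) :
  polytabloid k s *m row_sum W t != 0 -> dominates nu mu.
Proof.
move=> nz; apply/dominatesP => r rl.
have wi : col_injective s (tabloid t).
  apply: contraNT nz => /forallPn[x /forallPn[y]].
  rewrite negb_imply => /andP[/andP[/eqP cxy /eqP wxy] xy]; apply/eqP.
  rewrite !tabloidE in wxy; apply: (row_sum_kill (neq2 charf0) wxy).
  by rewrite polytabloidE -mulmxA col_alt_mulr ?tperm_cstab // odd_tperm xy
      expr1 scaleN1r mulmxN.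
by rewrite -(card_rows_below t) // (col_injective_dom rl wi).
Qed.

(** The row sum of a polytabloid of shape nu is zero unless nu dominates mu,
    and its column sum is zero unless mu dominates nu. *)
Lemma specht_ysym0 mu nu (t : tableau mu) : nu != mu -> specht_mx k nu *m ysym W
    t = 0.
Proof.
move=> ne; apply/eqP; rewrite -submx0 /specht_mx sumsmxMr; apply/sumsmx_subP => s _.
rewrite (eqmxMr _ (genmxE _)) submx0; apply: contraNT ne => nz.
apply/eqP/dominates_anti.
  apply: (@specht_row_sum_dom _ _ s t); apply: contraNneq nz => E.
  by rewrite mulmxA E mul0mx.
apply/dominatesP => r rl; apply: (cont_mod_col_alt_dom charf0 (L := l) (t := t))
    => //.
apply: contraNneq nz => E; rewrite mulmxA -submx0.
suff sub : (polytabloid k s *m row_sum W t <= cont_mod k n l (part nu))%MS.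
  by apply: submx_trans (submxMr _ sub) _; rewrite E sub0mx.
rewrite mulmx_sumr; apply: summx_sub => g _.
apply: (mxmodule_trans (cont_mod_module k n l (part nu))); rewrite ?inE //.
exact: submx_trans (polytabloid_sub s) (specht_sub_cont nu).
Qed.

End SpechtSimple.

(** * Specht modules inside a representation *)

Lemma word_vec_ext (k : fieldType) (n L N : nat) (A B : 'M[k]_(#|{: word n L}|,
    N)) :
  (forall w, word_vec k w *m A = word_vec k w *m B) -> A = B.
Proof.
move=> AB; apply/row_matrixP=> a; rewrite !rowE.
by have := AB (enum_val a); rewrite /word_vec enum_valK.
Qed.

Section SpechtPieces.

Variables (k : fieldType) (n l : nat).
Hypothesis charf0 : [pchar k] =i pred0.
Implicit Types mu nu : intpart n l.
Local Notation W := (word_repr k n l).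

Variables (N : nat) (rG : mx_representation k [set: 'S_n] N).

Section FromTabloids.

Variables (mu : intpart n l) (u : 'rV[k]_N).
Let t := std_tab mu.

(** The equivariant map from the permutation module of shape mu sending the
    tabloid of t to the row symmetrization of u. *)
Definition tabloid_map : 'M[k]_(#|{: word n l}|, N) :=
  \matrix_a \sum_(g : 'S_n | word_act (tabloid t) g == enum_val a) u *m rG g.

Lemma tabloid_mapE w : word_vec k w *m tabloid_map =
  \sum_(g : 'S_n | word_act (tabloid t) g == w) u *m rG g.
Proof. by rewrite /word_vec -rowE rowK enum_rankK. Qed.

Lemma word_act_inj (w w' : word n l) s : word_act w s = word_act w' s -> w = w'.
Proof.
by move=> /(congr1 (fun v => word_act v s^-1%g)); rewrite -!word_actM mulgV
    !word_act1.
Qed.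

Lemma tabloid_map_hom s : W s *m tabloid_map = tabloid_map *m rG s.
Proof.
apply: word_vec_ext => w; rewrite !mulmxA /= word_vecE !tabloid_mapE.
rewrite mulmx_suml (reindex_inj (mulIg s)) /=; apply: eq_big => [g|g _].
  by rewrite word_actM; apply/eqP/eqP => [/word_act_inj|->].
by rewrite repr_mxM ?inE // mulmxA.
Qed.

Lemma tabloid_map_row_sum : word_vec k (tabloid t) *m tabloid_map = u *m row_sum
    rG t.
Proof.
rewrite tabloid_mapE /row_sum mulmx_sumr; apply: eq_bigl => g.
transitivity (g^-1%g \in row_stab t).
  rewrite inE; apply/eqP/forallP => [E x|H].
    by have := congr1 (fun w : word n l => w x) E; rewrite word_actE !tabloidE
        => ->.
  by apply/ffunP => x; rewrite word_actE !tabloidE; apply/eqP/H.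
by apply/idP/idP => /rstabV; rewrite ?invgK.
Qed.

Lemma tabloid_map_poly : polytabloid k t *m tabloid_map = u *m ysym rG t.
Proof.
rewrite polytabloidE -mulmxA.
have -> : col_alt W t *m tabloid_map = tabloid_map *m col_alt rG t.
  rewrite mulmx_suml mulmx_sumr; apply: eq_bigr => s _.
  by rewrite -scalemxAl tabloid_map_hom scalemxAr.
by rewrite mulmxA tabloid_map_row_sum -mulmxA.
Qed.

Definition specht_image : 'M[k]_N := <<specht_mx k mu *m tabloid_map>>%MS.

Lemma specht_image_module : mxmodule rG specht_image.
Proof.
apply/mxmoduleP => s _; rewrite (eqmxMr _ (genmxE _)) genmxE -mulmxA
    -tabloid_map_hom mulmxA.
by apply: submxMr; apply: (mxmoduleP (specht_mxmodule k mu)).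
Qed.

Lemma specht_image_id : (u *m ysym rG t <= specht_image)%MS.
Proof. by rewrite genmxE -tabloid_map_poly submxMr // polytabloid_sub. Qed.

Hypothesis nz : u *m ysym rG t != 0.

Lemma rank_specht_image : \rank specht_image = \rank (specht_mx k mu).
Proof.
rewrite mxrank_gen -[RHS](mxrank_mul_ker _ tabloid_map).
set K := (_ :&: _)%MS; suff -> : K = 0 by rewrite mxrank0 addn0.
have modK : mxmodule W K.
  apply: capmx_module; first exact: specht_mxmodule.
  apply/mxmoduleP => s _; apply/sub_kermxP; rewrite -mulmxA tabloid_map_hom mulmxA.
  by rewrite mulmx_ker mul0mx.
apply/eqP; apply: contraNT nz => nzK.
have [_ _ /(_ K modK (capmxSl _ _) nzK) SK] := specht_simple charf0 mu.
have KM : K *m tabloid_map = 0 by apply/sub_kermxP/capmxSr.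
have := submxMr tabloid_map (submx_trans (polytabloid_sub k t) SK).
by rewrite KM tabloid_map_poly => /submx0null->.
Qed.

Lemma specht_image_rsim : mx_rsim (specht k mu) (submod_repr specht_image_module).
Proof.
have sub : (val_submod (1%:M : 'M_(\rank (specht_mx k mu))) *m tabloid_map <=
    specht_image)%MS.
  by rewrite genmxE; apply/submxMr/val_submodP.
exists (in_submod specht_image (val_submod 1%:M *m tabloid_map)).
- by rewrite rank_specht_image.
- rewrite /row_free mxrank_in_submod // (eqmxMr _ (val_submod1 _)).
  by rewrite -rank_specht_image mxrank_gen.
move=> s _; rewrite -(in_submodJ specht_image_module) //.
rewrite [in LHS]in_submodE mulmxA -in_submodE; congr (in_submod _ _).
rewrite -[in RHS]mulmxA -tabloid_map_hom !mulmxA; congr (_ *m _).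
have := val_submodJ (specht_mxmodule k mu) (1%:M : 'M_(\rank (specht_mx k mu)))
    (in_setT s).
by rewrite mul1mx mulmx1 -mulmxA => <-.
Qed.

Lemma specht_image_simple : mxsimple rG specht_image.
Proof.
apply/(submod_mx_irr specht_image_module)/(mx_rsim_irr specht_image_rsim).
exact/submod_mx_irr/specht_simple.
Qed.

End FromTabloids.

(** * Multiplicities *)

(** This is the dimension of the space of equivariant maps from the Specht
    module to rG: such a map is determined by the image of the polytabloid,
    which can be any vector in the image of the symmetrizer. *)
Definition mult mu : nat := \rank (ysym rG (std_tab mu)).

Lemma rank_ysym_witness mu (j : 'I_(mult mu)) :
  exists u : 'rV_N, u *m ysym rG (std_tab mu) == row j (row_base (ysym rG
      (std_tab mu))).
Proof.
have /submxP[u ->] : (row j (row_base (ysym rG (std_tab mu))) <= ysym rG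
    (std_tab mu))%MS.
  by apply: submx_trans (row_sub _ _) _; rewrite eq_row_base.
by exists u.
Qed.

Lemma row_indep m (R : 'M[k]_(m, N)) i : row_free R ->
  ~~ (row i R <= \sum_(j < m | j != i) <<row j R>>)%MS.
Proof.
move=> fR; apply/negP => /(submxMr (pinvmx R *m delta_mx i 0 : 'cV_N)).
have E j : row j R *m (pinvmx R *m delta_mx i 0 : 'cV_N) = (j == i)%:R%:M.
  rewrite mulmxA rowE -(mulmxA (delta_mx _ _)) mulmxVp // mulmx1.
  by rewrite mul_delta_mx_cond; case: eqP => _; rewrite ?mulr0n ?raddf0 //
      [LHS]mx11_scalar mxE.
rewrite E eqxx sumsmxMr_gen => sub.
have : ((1%:R)%:M <= (0 : 'M[k]_1))%MS.
  apply: submx_trans sub _; apply/sumsmx_subP => j ji.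
  by rewrite genmxE (eqmxMr _ (genmxE _)) E (negPf ji) raddf0 sub0mx.
by rewrite submx0 => /eqP/matrixP/(_ 0 0)/eqP; rewrite !mxE eqxx oner_eq0.
Qed.

Definition mult_index : finType := {mu : intpart n l & 'I_(mult mu)}.

Definition canonical_rep (m : intpart n l -> nat) : representation k [set: 'S_n] :=
  \big[dadd_grepr/grepr0]_(i : {mu : intpart n l & 'I_(m mu)}) specht k (tag i).

Let witness (i : mult_index) : 'rV_N := xchoose (rank_ysym_witness (tagged i)).

Let witnessE (i : mult_index) : witness i *m ysym rG (std_tab (tag i)) =
  row (tagged i) (row_base (ysym rG (std_tab (tag i)))).
Proof. exact: eqP (xchooseP (rank_ysym_witness (tagged i))). Qed.

Let piece (i : mult_index) : 'M_N := specht_image (tag i) (witness i).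

Let witness_nz (i : mult_index) : witness i *m ysym rG (std_tab (tag i)) != 0.
Proof.
rewrite witnessE; apply: contraTneq (row_indep (tagged i) (row_base_free (ysym
    rG (std_tab (tag i))))) => ->.
by rewrite negbK sub0mx.
Qed.

Let piece_ysym (i : mult_index) mu : (piece i *m ysym rG (std_tab mu) <=
  if tag i == mu then witness i *m ysym rG (std_tab (tag i)) else 0)%MS.
Proof.
rewrite (eqmxMr _ (genmxE _)) -mulmxA -(ysym_hom _ (tabloid_map_hom (tag i)
    (witness i))) mulmxA.
case: eqP => [<-|/eqP ne].
  by rewrite -tabloid_map_poly; apply/submxMr/specht_ysym_sub.
by rewrite specht_ysym0 // mul0mx sub0mx.
Qed.

(** A simple piece meeting the sum X of the others is contained in X. The
    projection onto X along an invariant complement commutes with the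
    symmetrizer, so the generator of the piece is the symmetrization of a
    vector of X; it is then a combination of the generators of the other pieces
    of the same shape, although these generators form a basis. *)
Lemma pieces_direct : mxdirect (\sum_i piece i).
Proof.
apply/mxdirect_sumsP => i _; apply/eqP; apply: contraT => nz.
have simN := specht_image_simple (witness_nz i).
set X := (\sum_(j | _) _)%MS in nz.
have modX : mxmodule rG X by apply: sumsmx_module => j _; apply:
    specht_image_module.
have [modN _ /(_ _ _ (capmxSl _ _) nz)] := simN.
rewrite capmx_module // => /(_ isT)/submx_trans/(_ (capmxSr _ _)) NX.
have uX := submx_trans (specht_image_id (tag i) (witness i)) NX.
have [Y modY defV dxXY] := maschke charf0 (rG := rG) modX (submx1 _).
set e := ysym rG (std_tab (tag i)) in uX.
have uXe : (witness i *m e <= X *m e)%MS.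
  have homp s : rG s *m proj_mx X Y = proj_mx X Y *m rG s.
    have H := proj_mx_hom (mxdirect_addsP dxXY) modX modY; rewrite defV in H.
    by have /hom_mxP/(_ s) := H; rewrite inE !mul1mx => ->.
  rewrite -(proj_mx_id (mxdirect_addsP dxXY) uX) -mulmxA (ysym_hom _ homp) mulmxA.
  exact/submxMr/proj_mx_sub.
have := row_indep (tagged i) (row_base_free e).
rewrite -/e -witnessE -/e (submx_trans uXe) //.
rewrite /X sumsmxMr; apply/sumsmx_subP => j ji.
apply: submx_trans (piece_ysym j (tag i)) _.
case: eqP => [E|_]; last exact: sub0mx.
rewrite witnessE /e {e simN nz X modX modN NX uX Y modY defV dxXY uXe}.
case: i j ji E => mu i [nu j] /= ji E.
case: mu / E i ji => i ji.
by apply: (sumsmx_sup j) => //; rewrite ?genmxE //; apply: contraNneq ji => ->.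
Qed.

Lemma sum_mult_le : (\sum_mu mult mu * \rank (specht_mx k mu) <= N)%N.
Proof.
have := rank_leq_row (\sum_i piece i)%MS; rewrite (mxdirectP pieces_direct) /=.
rewrite (eq_bigr (fun i : mult_index => \rank (specht_mx k (tag i)))); last first.
  by move=> i _; apply: rank_specht_image.
have := sig_big_dep xpredT (fun _ _ => true)
          (fun mu (_ : 'I_(mult mu)) => \rank (specht_mx k mu)) => /= <-.
by under eq_bigr do rewrite sum_nat_const card_ord.
Qed.

(** The direct sum of the pieces has dimension the left-hand side. *)
Theorem mult_complete : (\sum_mu mult mu * \rank (specht_mx k mu) = N)%N ->
  mx_rsim rG (canonical_rep mult).
Proof.
move=> E; have defV : (\sum_i piece i :=: 1%:M)%MS.
  apply/eqmxP; rewrite submx1 sub1mx /row_full (mxdirectP pieces_direct) /= -[X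
      in _ == X]E.
  rewrite (eq_bigr (fun i : mult_index => \rank (specht_mx k (tag i)))); last first.
    by move=> i _; apply: rank_specht_image.
  have := sig_big_dep xpredT (fun _ _ => true)
          (fun mu (_ : 'I_(mult mu)) => \rank (specht_mx k mu)) => /= <-.
  by apply/eqP/eq_bigr => mu _; rewrite sum_nat_const card_ord.
apply: mx_rsim_trans (mx_rsim_sym (rsim_submod1 (mxmodule1 rG) (eqmx_refl _))) _.
apply: (mx_rsim_dsum (modU := fun i => specht_image_module (tag i) (witness i))
    _ defV pieces_direct) => i.
exact/mx_rsim_sym/specht_image_rsim.
Qed.

End SpechtPieces.

Section SubmoduleMult.

Variables (k : fieldType) (n l N : nat) (rG : mx_representation k [set: 'S_n] N).
Variables (U : 'M[k]_N) (modU : mxmodule rG U).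

Lemma mult_submod (mu : intpart n l) :
  mult (submod_repr modU) mu = \rank (U *m ysym rG (std_tab mu)).
Proof.
have hom s : submod_repr modU s *m row_base U = row_base U *m rG s.
  have := val_submodJ modU (1%:M : 'M_(\rank U)) (in_setT s).
  by rewrite mul1mx [val_submod 1%:M]mul1mx => <-.
rewrite /mult -(mxrankMfree _ (row_base_free U)) (ysym_hom _ hom).
by rewrite (eqmxMr _ (eq_row_base U)).
Qed.

End SubmoduleMult.

(** * Multiplicities in the permutation modules *)

Section CountWords.

Variable L : nat.
Local Open Scope nat_scope.

Definition cons_word n (a : 'I_L) (w : word n L) : word n.+1 L :=
  [ffun x => if unlift ord0 x is Some y then w y else a].

Lemma cons_word0 n a (w : word n L) : cons_word a w ord0 = a.
Proof. by rewrite ffunE unlift_none. Qed.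

Lemma cons_wordS n a (w : word n L) y : cons_word a w (lift ord0 y) = w y.
Proof. by rewrite ffunE liftK. Qed.

Lemma card_letter_cons n a (w : word n L) b :
  #|[set x | cons_word a w x == b]| = (a == b) + #|[set x | w x == b]|.
Proof.
rewrite -!sum1dep_card big_mkcond big_ord_recl cons_word0 [in RHS]big_mkcond /=.
congr (_ + _).
by apply: eq_bigr => i _; rewrite cons_wordS.
Qed.

Lemma has_cont_cons n c a (w : word n L) :
  has_cont c (cons_word a w) = (0 < c a) && has_cont (decr c a) w.
Proof.
apply/forallP/andP => [H|[ca /forallP H] b].
  have Ha := H a; rewrite card_letter_cons eqxx in Ha.
  split; first by rewrite -(eqP Ha).
  apply/forallP => b; rewrite /decr -(eqP (H b)) card_letter_cons val_eqE
      (eq_sym a b).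
  by rewrite addKn.
rewrite card_letter_cons (eqP (H b)) /decr val_eqE (eq_sym a b).
by case: (eqVneq b a) => [->|_]; [rewrite addnC subnK | rewrite subn0].
Qed.

Lemma card_words n c : #|[set w : word n L | has_cont c w]| = nwords n L c.
Proof.
elim: n c => [|n IH] c.
  rewrite /=; pose o : word 0 L := ffun0 (card_ord 0).
  have all_o (w : word 0 L) : w = o by apply/ffunP => -[].
  have co : has_cont c o = [forall a : 'I_L, c a == 0].
    apply: eq_forallb => a; rewrite (_ : #|_| = 0) 1?eq_sym //.
    by apply: eq_card0 => -[].
  rewrite -co; case E: (has_cont c o).
    by rewrite (eq_card (B := [set o])) ?cards1 // => w; rewrite !inE (all_o w)
        E eqxx.
  by apply: eq_card0 => w; rewrite inE (all_o w) E.
rewrite /= -sum1dep_card (partition_big (fun w : word n.+1 L => w ord0) (fun a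
    => 0 < c a)).
  apply: eq_bigr => a ca; rewrite sum1dep_card -IH.
  rewrite -[RHS](card_imset (f := cons_word a)).
    apply: eq_card => w; rewrite inE; apply/andP/imsetP => [[cw /eqP wa]|[v]].
      have Ew : w = cons_word a [ffun y => w (lift ord0 y)].
        apply/ffunP => x; case: (unliftP ord0 x) => [y ->|->]; last by rewrite
            cons_word0.
        by rewrite cons_wordS ffunE.
      exists [ffun y => w (lift ord0 y)] => //.
      by rewrite inE; move: cw; rewrite {1}Ew has_cont_cons => /andP[].
    by rewrite inE => cv ->; rewrite has_cont_cons ca cv cons_word0.
  move=> v v' E; apply/ffunP => y.
  by have := congr1 (fun w : word n.+1 L => w (lift ord0 y)) E; rewrite !cons_wordS.
move=> w cw; have := forallP cw (w ord0) => /eqP <-.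
by rewrite card_gt0; apply/set0Pn; exists ord0; rewrite inE.
Qed.

End CountWords.

Lemma chains_mono p q c L (sh : diagram p q) : (0 < L)%N -> chains c L sh != 0%N ->
  forall i, (rowlen sh i.+1 <= rowlen sh i)%N.
Proof.
case: L => // L _ /=; rewrite sum_nat_eq0 => /forallPn[rho].
rewrite negb_imply => /andP[/andP[/hstripP h _] _] i.
by case/andP: (h i); apply: leq_trans.
Qed.

Section Completeness.

Variables (k : fieldType) (n l : nat).
Hypothesis charf0 : [pchar k] =i pred0.
Hypothesis n_gt0 : (0 < n)%N.
Implicit Types mu : intpart n l.
Local Notation W := (word_repr k n l).

Lemma sum_intpart (F : diagram l n -> nat) :
    (forall sh, F sh != 0%N -> forall i, (rowlen sh i.+1 <= rowlen sh i)%N) ->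
  (\sum_(sh | ssize sh == n) F sh = \sum_mu F (@diagram_of n l mu))%N.
Proof.
move=> Fpart.
have diagram_of_inj : injective (@diagram_of n l).
  move=> mu nu E; apply/val_inj/eq_from_tnth => i.
  by have := congr1 (fun sh : diagram l n => sh i) E; rewrite !ffunE.
rewrite -(big_imset _ (in2W diagram_of_inj)) /= [LHS]big_mkcond [RHS]big_mkcond /=.
apply: eq_bigr => sh _; case: imsetP => [[mu _ ->]|no]; first by rewrite
    ssize_diagram_of eqxx.
case: eqP => // size_sh; apply/eqP; apply: contra_notT no => /Fpart mono.
pose tp := [tuple sh i | i < l].
have tpE i : nth 0%N (map val tp) i = rowlen sh i.
  have [il|li] := ltnP i l; last by rewrite nth_default ?rowlen_out // size_map
      size_tuple.
  by rewrite (nth_map ord0) ?size_tuple // -(tnth_nth _ tp (Ordinal il))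
      tnth_mktuple (rowlen_ord sh (Ordinal il)).
have tpP : sorted geq (map val tp) && (sumn (map val tp) == n).
  apply/andP; split; last first.
    rewrite sumnE (big_nth 0%N) size_map size_tuple big_mkord -[X in _ == X]size_sh.
    by apply/eqP/eq_bigr => i _; rewrite tpE.
  apply/(sortedP 0%N) => i _; rewrite !tpE; exact: mono.
exists (exist _ tp tpP) => //; apply/ffunP => i; rewrite ffunE /= tnth_mktuple //.
Qed.

Lemma rank_specht_gt0 mu : (0 < \rank (specht_mx k mu))%N.
Proof. by rewrite lt0n mxrank_eq0; case: (specht_simple charf0 mu). Qed.

Definition cont_mult L c mu : nat :=
  \rank (cont_mod k n L c *m ysym (word_repr k n L) (std_tab mu)).

Lemma sum_cont_mult_le L c :
  (\sum_mu cont_mult L c mu * \rank (specht_mx k mu) <= \rank (cont_mod k n L c))%N.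
Proof.
apply: leq_trans (sum_mult_le l charf0 (submod_repr (cont_mod_module k n L c))).
by apply: leq_sum => mu _; rewrite mult_submod.
Qed.

(** The lower bounds for the multiplicities and for the dimensions of the
    Specht modules already account for the whole permutation module. *)
Lemma sum_ssyts_ge c : (\rank (cont_mod k n l c) <=
  \sum_(mu : intpart n l) #|ssyts mu l c| * #|ssyts mu n (fun=> 1)|)%N.
Proof.
rewrite rank_cont_mod card_words -(sum_chains_nwords c (leqnn l) (leqnn n)).
rewrite sum_intpart.
  by apply: leq_sum => mu _; rewrite leq_mul // chains_le_ssyts.
by move=> sh; rewrite muln_eq0 negb_or => /andP[_]; apply: chains_mono.
Qed.

Lemma cont_complete c :
  (\sum_mu cont_mult l c mu * \rank (specht_mx k mu) = \rank (cont_mod k n l c))%N.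
Proof.
apply/eqP; rewrite eqn_leq sum_cont_mult_le; apply: leq_trans (sum_ssyts_ge c) _.
by apply: leq_sum => mu _; rewrite leq_mul // ?ssyts_le_rank ?ssyts_le_specht.
Qed.

(** Young's rule: the lower bounds for all multiplicities and dimensions are
    attained, because they are attained in sum. *)
Theorem cont_mult_ssyts c mu : cont_mult l c mu = #|ssyts mu l c|.
Proof.
have le nu : (#|ssyts nu l c| * #|ssyts nu n (fun=> 1)| <=
              cont_mult l c nu * \rank (specht_mx k nu))%N.
  by rewrite leq_mul // ?ssyts_le_rank ?ssyts_le_specht.
have [_] := leqif_sum (fun nu (_ : true) => leqif_eq (le nu)).
have -> : (\sum_(nu : intpart n l) #|ssyts nu l c| * #|ssyts nu n (fun=> 1)| ==
          \sum_nu cont_mult l c nu * \rank (specht_mx k nu))%N.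
  rewrite eqn_leq leq_sum //= cont_complete; exact: sum_ssyts_ge.
move=> /esym/forallP/(_ mu) /= /eqP E; apply/eqP; rewrite eq_sym eqn_leq.
rewrite (ssyts_le_rank (std_tab mu) charf0) /= leqNgt; apply/negP => lt.
have := ssyts_le_specht k mu; have := rank_specht_gt0 mu; move: lt E.
rewrite -/(cont_mult l c mu); move: (cont_mult _ _ _) (\rank _) #|_| #|_| => a b
    x y.
by nia.
Qed.

End Completeness.

Section Relabel.

Variables (k : fieldType) (n l L : nat) (f : 'I_l -> 'I_L) (c d : nat -> nat).
Hypothesis f_inj : injective f.
Hypothesis cd : forall a : 'I_l, c (f a) = d a.
Hypothesis c_out : forall b : 'I_L, b \notin codom f -> c b = 0%N.

(** Renaming the letters identifies the permutation modules of contents that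
    are rearrangements of each other, up to letters that do not occur. *)
Definition relabel (w : word n l) : word n L := [ffun x => f (w x)].

Definition relabel_mx : 'M[k]_(#|{: word n l}|, #|{: word n L}|) :=
  \matrix_a word_vec k (relabel (enum_val a)).

Lemma word_vec_relabel w : word_vec k w *m relabel_mx = word_vec k (relabel w).
Proof. by rewrite /word_vec -rowE rowK enum_rankK. Qed.

Lemma relabel_inj : injective relabel.
Proof.
move=> w w' E; apply/ffunP => x; apply: f_inj.
by have := congr1 (fun v : word n L => v x) E; rewrite !ffunE.
Qed.

Lemma relabel_hom s : word_repr k n l s *m relabel_mx = relabel_mx *m word_repr
    k n L s.
Proof.
apply: word_vec_ext => w; rewrite !mulmxA /= word_vecE !word_vec_relabel word_vecE.
by congr word_vec; apply/ffunP => x; rewrite !ffunE.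
Qed.

Lemma relabel_free : row_free relabel_mx.
Proof.
apply/row_freeP; exists relabel_mx^T; apply/matrixP => a b.
rewrite !mxE (bigD1 (enum_rank (relabel (enum_val a)))) //= !mxE !eqxx /= mul1r.
rewrite big1 ?addr0 => [|j]; last by rewrite !mxE eqxx /= => /negPf->; rewrite
    mul0r.
by rewrite (inj_eq enum_rank_inj) (inj_eq relabel_inj) (inj_eq enum_val_inj).
Qed.

Lemma relabel_content w : has_cont d w -> has_cont c (relabel w).
Proof.
move=> /forallP dw; apply/forallP => b; have [/codomP[a ->]|nb] := boolP (b \in
    codom f).
  rewrite cd -(eqP (dw a)); apply/eqP/eq_card => x.
  by rewrite !inE ffunE (inj_eq f_inj).
rewrite c_out // eq_card0 // => x; rewrite !inE ffunE.
by apply: contraNF nb => /eqP<-; apply: codom_f.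
Qed.

Lemma cont_mod_relabel : (cont_mod k n l d *m relabel_mx :=: cont_mod k n L c)%MS.
Proof.
apply/eqmxP/andP; split.
  rewrite /(cont_mod k n l d) sumsmxMr_gen; apply/sumsmx_subP => w dw.
  by rewrite genmxE (eqmxMr _ (genmxE _)) word_vec_relabel word_vec_sub //
      relabel_content.
apply/sumsmx_subP => w cw; rewrite genmxE.
have ex x : exists a, f a == w x.
  have : w x \in codom f.
    apply: contraT => /c_out c0; have := forallP cw (w x).
    by rewrite c0 cards_eq0 => /eqP/setP/(_ x); rewrite !inE eqxx.
  by case/codomP => a ->; exists a.
pose v : word n l := [ffun x => xchoose (ex x)].
have vE : relabel v = w by apply/ffunP => x; rewrite !ffunE (eqP (xchooseP (ex x))).
have dv : has_cont d v.
  apply/forallP => a; rewrite -cd -(eqP (forallP cw (f a))) -vE;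
      apply/eqP/eq_card => x.
  by rewrite !inE [relabel v x]ffunE (inj_eq f_inj).
by rewrite -vE -word_vec_relabel; apply/submxMr/word_vec_sub.
Qed.

Lemma rank_relabel : \rank (cont_mod k n L c) = \rank (cont_mod k n l d).
Proof. by rewrite -cont_mod_relabel mxrankMfree // relabel_free. Qed.

Lemma cont_mult_relabel p (mu : intpart n p) : cont_mult k L c mu = cont_mult k
    l d mu.
Proof.
rewrite /cont_mult -(eqmxMr _ cont_mod_relabel) -mulmxA -(ysym_hom _ relabel_hom).
by rewrite mulmxA mxrankMfree // relabel_free.
Qed.

End Relabel.

(** * The relations of the Galois closure on words *)

Section Relations.

Variables (k : fieldType) (n m : nat).
Hypothesis charf0 : [pchar k] =i pred0.
Local Notation word := (word n m.+1).
Local Notation W := (word_repr k n m.+1).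
Implicit Types (w : word) (P : pred word).

Definition upd w (j : 'I_n) (a : 'I_m.+1) : word := [ffun x => if x == j then a
    else w x].

Definition zeros w : nat := #|[set x | w x == ord0]|.

(** Multiplication by x_(i,0) + ... + x_(i,n-1), in the basis of words. *)
Definition raise_mx (i : 'I_m) : 'M[k]_#|{: word}| :=
  \matrix_a \sum_(j | (enum_val a : word) j == ord0) word_vec k (upd (enum_val
      a) j (lift ord0 i)).

Lemma word_vec_raise i w : word_vec k w *m raise_mx i =
  \sum_(j | w j == ord0) word_vec k (upd w j (lift ord0 i)).
Proof. by rewrite /word_vec -rowE rowK enum_rankK. Qed.

Lemma upd_act w j a s : upd (word_act w s) (s j) a = word_act (upd w j a) s.
Proof.
apply/ffunP => x; rewrite !ffunE; congr (if _ then _ else _).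
by rewrite -{1}(permKV s x) (inj_eq perm_inj).
Qed.

Lemma raise_hom i s : W s *m raise_mx i = raise_mx i *m W s.
Proof.
apply: word_vec_ext => w; rewrite !mulmxA /= word_vecE !word_vec_raise mulmx_suml.
rewrite (reindex_inj (perm_inj (s := s))) /=; apply: eq_big => [j|j _].
  by rewrite ffunE permK.
by rewrite word_vecE upd_act.
Qed.

Definition relations : 'M[k]_#|{: word}| := (\sum_(i < m) <<raise_mx i>>)%MS.

Lemma raise_sub i (v : 'rV_#|{: word}|) : (v *m raise_mx i <= relations)%MS.
Proof. by rewrite (sumsmx_sup i) // genmxE submxMl. Qed.

Lemma relations_module : mxmodule W relations.
Proof.
apply/mxmoduleP => s _; rewrite sumsmxMr; apply/sumsmx_subP => i _.
by rewrite (eqmxMr _ (genmxE _)) -raise_hom (sumsmx_sup i) // genmxE submxMl.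
Qed.

Lemma module_row_sum (X : 'M[k]_#|{: word}|) l (mu : intpart n l) (t : tableau mu) :
  mxmodule W X -> (X *m row_sum W t <= X)%MS.
Proof.
move=> modX; rewrite mulmx_sumr; apply: summx_sub => s _.
by apply: (mxmoduleP modX); rewrite inE.
Qed.

Lemma module_col_alt (X : 'M[k]_#|{: word}|) l (mu : intpart n l) (t : tableau mu) :
  mxmodule W X -> (X *m col_alt W t <= X)%MS.
Proof.
move=> modX; rewrite mulmx_sumr; apply: summx_sub => s _.
by rewrite -scalemxAr; apply/scalemx_sub/(mxmoduleP modX); rewrite inE.
Qed.

Lemma module_ysym (X : 'M[k]_#|{: word}|) l (mu : intpart n l) (t : tableau mu) :
  mxmodule W X -> (X *m ysym W t <= X)%MS.
Proof.
move=> modX; rewrite mulmxA; apply: submx_trans (module_col_alt t modX).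
exact/submxMr/module_row_sum.
Qed.

Lemma upd_tperm w j j' a : w j = w j' -> upd w j' a = word_act (upd w j a)
    (tperm j j').
Proof.
move=> E; apply/ffunP => x; rewrite !ffunE tpermV.
by case: tpermP => [->|->|/eqP xj /eqP xj']; rewrite ?eqxx ?(negPf xj) ?(negPf
    xj') //;
   case: eqVneq.
Qed.

Section Absorb.

Variables (l : nat) (mu : intpart n l) (t : tableau mu).
Hypothesis l_gt0 : (0 < l)%N.
Let row0 := [set x | tabloid t x < 1]%N.

(** If the entries of the first row are symmetrized, a relation expresses a
    word with a nonzero letter in that row through words having one more zero
    there, up to an invertible integer. *)
Lemma row_sum_sub_relations w : (zeros w < part mu 0)%N ->
  (word_vec k w *m row_sum W t <= relations)%MS.
Proof.
have card_row0 : #|row0| = part mu 0.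
  by rewrite (card_rows_below t l_gt0) big_ord_recl big_ord0 addn0.
have row0P x y : x \in row0 -> y \in row0 -> tperm x y \in row_stab t.
  move=> xB yB; apply/tperm_rstab/val_inj; move: xB yB.
  by rewrite !inE !ltnS !leqn0 !tabloidE => /eqP x0 /eqP y0; rewrite /= x0 y0.
have [d] := ubnP #|[set x | (w x == ord0) && (x \notin row0)]|.
elim: d w => // d IH w le_d lt.
have [j0 j0B wj0] : exists2 j0, j0 \in row0 & w j0 != ord0.
  apply/exists_inP; apply: contraTT lt; rewrite negb_exists_in => /forall_inP H.
  rewrite -leqNgt -card_row0; apply/subset_leq_card/subsetP => x xB.
  by rewrite inE; have := H x xB; rewrite negbK.
have [i wi] : exists i, w j0 = lift ord0 i.
  by case: (unliftP ord0 (w j0)) => [i ->|E]; [exists i | rewrite E eqxx in wj0].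
pose w' := upd w j0 ord0.
have w'0 j : (w' j == ord0) = (j == j0) || (w j == ord0).
  by rewrite ffunE; case: (j == j0) => //; rewrite eqxx.
have := raise_sub i (word_vec k w') => /(submxMr (row_sum W t)) /submx_trans.
move/(_ _ _ (module_row_sum t relations_module)).
(* A collects the words where the new letter i comes to the first row, which
   are rearrangements of w within that row, and B the words where it comes
   elsewhere, so that the first row has one zero more than in w. *)
rewrite word_vec_raise mulmx_suml (bigID (mem row0)) /=.
set A := (X in ((X + _)%R <= _)%MS); set B := (X in ((_ + X)%R <= _)%MS) => AB.
have BU : (B <= relations)%MS.
  apply: summx_sub => j /andP[]; rewrite w'0 => /orP[/eqP->|wj jB]; first by
      rewrite j0B.
  have ne : j0 != j by apply: contraNneq jB => <-.
  have updE x : (upd w' j (lift ord0 i) x == ord0) = (x != j) && ((x == j0) ||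
      (w x == ord0)).
    rewrite /= ffunE; case: (eqVneq x j) => [_|_]; last by rewrite w'0.
    by rewrite eq_sym; apply/negbTE; rewrite neq_lift.
  apply: IH; last first.
    apply: leq_ltn_trans lt; rewrite /zeros.
    have sw : [set x | w x == ord0] = j |: ([set x | w x == ord0] :\ j).
      by rewrite setD1K // inE.
    rewrite sw cardsU1 !inE eqxx /= (cardsD1 j0) inE updE eqxx ne /= leq_add2l.
    apply/subset_leq_card/subsetP => x; rewrite !inE updE.
    by case/andP=> /negPf-> /andP[-> /=].
  rewrite ltnS in le_d; apply: leq_trans le_d.
  rewrite [X in (_ < X)%N](cardsD1 j) inE wj jB /= ltnS.
  apply/subset_leq_card/subsetP => x; rewrite !inE updE => /andP[/andP[xj] xw xB].
  rewrite xj xB andbT; case/orP: xw => // /eqP E.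
  by move: xB; rewrite E; move: j0B; rewrite inE => ->.
have AE : A = #|[set j | (w' j == ord0) && (j \in row0)]|%:R *: (word_vec k w *m
    row_sum W t).
  rewrite /A -sum1dep_card natr_sum scaler_suml; apply: eq_bigr => j /andP[w'j jB].
  rewrite scale1r -[in RHS](mul_row_sum W (row0P _ _ j0B jB)) mulmxA [word_vec k
      w *m _]word_vecE.
  congr (word_vec k _ *m _); apply/ffunP => x; rewrite !ffunE tpermV.
  case: tpermP => [->|->|/eqP xj0 /eqP xj].
  - rewrite eqxx eq_sym; case: (eqVneq j0 j) => [<-|ne]; first by rewrite wi.
    by move: w'j; rewrite w'0 eq_sym (negPf ne) => /eqP->.
  - by rewrite eqxx wi.
  by rewrite (negPf xj) (negPf xj0).
have AU : (A <= relations)%MS by rewrite -(addrK B A) addmx_sub // eqmx_opp.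
rewrite AE eqmx_scale // in AU; apply: natr_neq0 => //.
by rewrite card_gt0; apply/set0Pn; exists j0; rewrite inE w'0 eqxx.
Qed.

Lemma word_ysym_kill L (v : Defs.word n L.+1) : (part mu 0 < #|[set x | v x ==
    ord0]|)%N ->
  word_vec k v *m ysym (word_repr k n L.+1) t = 0.
Proof.
move=> lt; rewrite mulmxA word_vec_row_sum mulmx_suml big1 // => s _.
apply: word_col_alt_kill => //; apply: contraTN lt => vi; rewrite -leqNgt.
have := col_injective_dom l_gt0 vi; rewrite big_ord_recl big_ord0 addn0.
apply: leq_trans; rewrite -[X in (_ <= X)%N](card_preimset _ (perm_inj (s := s))).
apply/subset_leq_card/subsetP => x; rewrite !inE ffunE permK => /eqP->.
by [].
Qed.

End Absorb.

(** * Projections onto spans of words *)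

Definition prj P : 'M[k]_#|{: word}| :=
  \matrix_a ((P (enum_val a))%:R *: word_vec k (enum_val a)).

Lemma word_vec_prj P w : word_vec k w *m prj P = (P w)%:R *: word_vec k w.
Proof. by rewrite {1}/word_vec -rowE rowK enum_rankK. Qed.

Lemma prj_hom P s : (forall w s, P (word_act w s) = P w) -> W s *m prj P = prj P
    *m W s.
Proof.
move=> Pact; apply: word_vec_ext => w; rewrite !mulmxA /= word_vecE !word_vec_prj.
by rewrite -scalemxAl word_vecE Pact.
Qed.

(** The words in the image of a word by a raising operator are rearrangements
    of each other, hence have the same content. *)
Lemma prj_relations c : (relations *m prj (has_cont c) <= relations)%MS.
Proof.
rewrite sumsmxMr; apply/sumsmx_subP => i _; rewrite (eqmxMr _ (genmxE _)).
apply/row_subP => a; rewrite rowE mulmxA.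
rewrite -[delta_mx _ _]/(delta_mx 0 _) -[a]enum_valK -/(word_vec k (enum_val a)).
rewrite word_vec_raise mulmx_suml.
have [j0 wj0|none] := pickP (fun j => (enum_val a : word) j == ord0); last first.
  by rewrite big_pred0 // sub0mx.
pose b := has_cont c (upd (enum_val a) j0 (lift ord0 i)).
rewrite (eq_bigr (fun j => b%:R *: word_vec k (upd (enum_val a) j (lift ord0 i)))).
  by rewrite -scaler_sumr -word_vec_raise; apply/scalemx_sub/raise_sub.
move=> j /eqP wj; rewrite word_vec_prj; congr (_%:R *: _).
by rewrite (@upd_tperm _ j0 j) ?has_cont_act // wj (eqP wj0).
Qed.

End Relations.

(** * Decomposition by content *)

Lemma capmx0S (k : fieldType) (N : nat) (A B A' B' : 'M[k]_N) :
  (A :&: B = 0)%MS -> (A' <= A)%MS -> (B' <= B)%MS -> (A' :&: B' = 0)%MS.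
Proof. by move=> E AA BB; apply/eqP; rewrite -submx0 -[X in (_ <= X)%MS]E
    capmxS. Qed.

Lemma mxdirect_sub (k : fieldType) (N : nat) (I : finType) (P : pred I) (A B : I
    -> 'M[k]_N) :
  mxdirect (\sum_(i | P i) A i) -> (forall i, (B i <= A i)%MS) -> mxdirect
      (\sum_(i | P i) B i).
Proof.
move=> /mxdirect_sumsP dA BA; apply/mxdirect_sumsP => i Pi.
apply: capmx0S (dA i Pi) _ _ => //.
by apply/sumsmx_subP => j Pj; rewrite (sumsmx_sup j).
Qed.

Section Contents.

Variables (k : fieldType) (n m : nat).
Local Notation word := (word n m.+1).
Local Notation W := (word_repr k n m.+1).

Definition content := {ffun 'I_m.+1 -> 'I_n.+1}.

HB.instance Definition _ := Finite.on content.

Implicit Types (c : content) (w : word).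

Definition cnt c : nat -> nat := fun a => c (inord a).

Definition content_of w : content := [ffun a => inord #|[set x | w x == a]|].

Lemma has_cntE c w : has_cont (cnt c) w = (content_of w == c).
Proof.
have lt a : (#|[set x | w x == a]| < n.+1)%N.
  by rewrite ltnS -[X in (_ <= X)%N]card_ord max_card.
apply/forallP/eqP => [H|<- a]; last by rewrite /cnt inord_val ffunE inordK.
apply/ffunP => a; apply/val_inj; rewrite ffunE /= inordK // (eqP (H a)).
by rewrite /cnt inord_val.
Qed.

Definition perm_mod c := cont_mod k n m.+1 (cnt c).

Lemma sum_perm_mod : (\sum_c perm_mod c :=: 1%:M)%MS.
Proof.
apply/eqmxP; rewrite submx1; apply/row_subP => a; rewrite row1.
rewrite -[a]enum_valK; apply: submx_trans (sumsmx_sup (content_of (enum_val a))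
    _ (submx_refl _)) => //.
by rewrite word_vec_sub // has_cntE.
Qed.

Lemma perm_mod_prj c : perm_mod c *m prj k (has_cont (cnt c)) = perm_mod c.
Proof.
apply/eqP; rewrite -subr_eq0 -[X in _ - X]mulmx1 -mulmxBr; apply/eqP/sub_kermxP.
apply/sumsmx_subP => w cw; rewrite genmxE; apply/sub_kermxP.
by rewrite mulmxBr mulmx1 word_vec_prj cw scale1r subrr.
Qed.

Lemma perm_mod_prj0 c c' : c != c' -> perm_mod c *m prj k (has_cont (cnt c')) = 0.
Proof.
move=> ne; apply/sub_kermxP/sumsmx_subP => w; rewrite has_cntE => /eqP cw.
rewrite genmxE; apply/sub_kermxP.
by rewrite word_vec_prj has_cntE cw (negPf ne) scale0r.
Qed.

Lemma sub_prj c r (v : 'M_(r, _)) : (v <= perm_mod c)%MS -> v *m prj k (has_cont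
    (cnt c)) = v.
Proof. by case/submxP=> u ->; rewrite -mulmxA perm_mod_prj. Qed.

Lemma perm_mod_disjoint c : (perm_mod c :&: (\sum_(c' | c' != c) perm_mod c') =
    0)%MS.
Proof.
apply/eqP; rewrite -submx0.
set X := (_ :&: _)%MS.
rewrite -(sub_prj (capmxSl _ _ : (X <= perm_mod c)%MS)).
have /(submxMr (prj k (has_cont (cnt c)))) := capmxSr _ _ : (X <= \sum_(j | j !=
    c) perm_mod j)%MS.
move/submx_trans; apply; rewrite sumsmxMr; apply/sumsmx_subP => c' ne.
by rewrite perm_mod_prj0 // sub0mx.
Qed.

Hypothesis charf0 : [pchar k] =i pred0.
Local Notation U := (relations k n m).

Definition rel_mod c := (perm_mod c :&: U)%MS.

Lemma rel_mod_module c : mxmodule W (rel_mod c).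
Proof. by apply: capmx_module; [apply: cont_mod_module | apply:
    relations_module]. Qed.

Lemma compl_exists c : exists V : 'M_#|{: word}|,
  [&& mxmodule W V, (rel_mod c + V == perm_mod c)%MS & (rel_mod c :&: V)%MS == 0].
Proof.
have redT : mx_completely_reducible W (perm_mod c).
  by apply: mx_reducibleS (cont_mod_module _ _ _ _) (submx1 _) _; apply: maschke.
have [V modV defT dx] := redT _ (rel_mod_module c) (capmxSl _ _).
by exists V; rewrite modV (mxdirect_addsP dx) eqxx andbT; apply/eqmxP.
Qed.

(** A submodule of words isomorphic to the part of content c of the quotient by
    the relations; multiplicities in it are ranks. *)
Definition compl_mod c : 'M_#|{: word}| := xchoose (compl_exists c).

Lemma compl_modP c : [/\ mxmodule W (compl_mod c), (rel_mod c + compl_mod c :=: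
    perm_mod c)%MS
                  & (rel_mod c :&: compl_mod c = 0)%MS].
Proof. by have /and3P[? /eqmxP ? /eqP ?] := xchooseP (compl_exists c). Qed.

Lemma compl_mod_sub c : (compl_mod c <= perm_mod c)%MS.
Proof. by have [_ <- _] := compl_modP c; apply: addsmxSr. Qed.

Lemma compl_mod_direct P : mxdirect (\sum_(c | P c) compl_mod c).
Proof.
apply/mxdirect_sumsP => c Pc; apply: capmx0S (perm_mod_disjoint c)
    (compl_mod_sub c) _.
apply/sumsmx_subP => j /andP[_ jc].
by apply: submx_trans (compl_mod_sub j) _; rewrite (sumsmx_sup j).
Qed.

Definition compl_sum (P : pred content) : 'M_#|{: word}| := (\sum_(c | P c)
    compl_mod c)%MS.

Lemma compl_sum_module P : mxmodule W (compl_sum P).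
Proof. by apply: sumsmx_module => c _; case: (compl_modP c). Qed.

Lemma cap_relations_compl_mod c : (U :&: compl_mod c = 0)%MS.
Proof.
have [_ _ z] := compl_modP c; apply/eqP; rewrite -submx0 -[X in (_ <= X)%MS]z
    !sub_capmx.
by rewrite capmxSl capmxSr (submx_trans (capmxSr _ _) (compl_mod_sub c)).
Qed.

Lemma cap_compl_sum P : (U :&: compl_sum P = 0)%MS.
Proof.
set X := (_ :&: _)%MS; have /sub_sumsmxP[u Xu] := capmxSr _ _ : (X <= compl_sum
    P)%MS.
rewrite Xu big1 // => c Pc.
apply/eqP; rewrite -submx0 -[X in (_ <= X)%MS](cap_relations_compl_mod c)
    sub_capmx submxMl andbT.
have uT c' : (u c' *m compl_mod c' <= perm_mod c')%MS by apply: submx_trans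
    (submxMl _ _) (compl_mod_sub c').
have -> : u c *m compl_mod c = X *m prj k (has_cont (cnt c)).
  rewrite Xu mulmx_suml (bigD1 c) //= sub_prj ?uT // big1 ?addr0 // => c'
      /andP[_ ne].
  by have /submxP[D ->] := uT c'; rewrite -mulmxA perm_mod_prj0 ?mulmx0.
by apply: submx_trans (submxMr _ (capmxSl _ _)) (@prj_relations k n m (cnt c)).
Qed.

Lemma add_compl_sum : (U + compl_sum xpredT :=: 1%:M)%MS.
Proof.
apply/eqmxP; rewrite submx1 /= -sum_perm_mod; apply/sumsmx_subP => c _.
have [_ <- _] := compl_modP c; rewrite addsmxS ?capmxSr //.
by rewrite (sumsmx_sup c).
Qed.

Variables (l : nat).
Hypothesis l_gt0 : (0 < l)%N.
Implicit Types mu : intpart n l.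

Lemma zerosE c w : has_cont (cnt c) w -> zeros w = c ord0.
Proof. by move=> /forallP/(_ ord0)/eqP; rewrite /cnt inord_val. Qed.

Lemma perm_mod_ysym0 c mu : (part mu 0 < c ord0)%N -> perm_mod c *m ysym W
    (std_tab mu) = 0.
Proof.
move=> lt; apply/eqP; rewrite -submx0 sumsmxMr; apply/sumsmx_subP => w cw.
by rewrite (eqmxMr _ (genmxE _)) word_ysym_kill ?sub0mx // -[#|_|]/(zeros w)
    (zerosE cw).
Qed.

Lemma zeros_upd (i : 'I_m) w j : w j = ord0 ->
  zeros w = (zeros (upd w j (lift ord0 i))).+1.
Proof.
move=> wj; rewrite /zeros (cardsD1 j) inE wj eqxx add1n; congr _.+1.
by apply: eq_card => x; rewrite !inE ffunE; case: (eqVneq x j).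
Qed.

(** The relations are images of words with one zero more, thus with more than
    mu_1 zeros: two of these lie in the same column of the tableau. *)
Lemma rel_mod_ysym0 c mu : part mu 0 = c ord0 -> rel_mod c *m ysym W (std_tab
    mu) = 0.
Proof.
move=> E; set e := ysym _ _; pose p := prj k (has_cont (cnt c) (n:=n) (L:=m.+1)).
have pe : p *m e = e *m p.
  by apply/esym/ysym_hom => s; apply: prj_hom => w u; rewrite has_cont_act.
have KT : (rel_mod c <= perm_mod c)%MS by apply: capmxSl.
rewrite -(sub_prj KT) -mulmxA pe mulmxA.
have /submxP[D ->] : (rel_mod c <= U)%MS by apply: capmxSr.
apply/eqP; rewrite -submx0 -!(mulmxA D); apply: mulmx_sub.
rewrite -mulmxA sumsmxMr; apply/sumsmx_subP => i _.
rewrite (eqmxMr _ (genmxE _)) mulmxA -(ysym_hom _ (raise_hom k i)) -mulmxA.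
suff -> : ysym W (std_tab mu) *m (raise_mx k n i *m p) = 0 by apply: sub0mx.
apply: word_vec_ext => w; rewrite mulmx0 mulmxA.
have [le|lt] := leqP (zeros w) (part mu 0); last by rewrite word_ysym_kill //
    mul0mx.
have hom s : W s *m (raise_mx k n i *m p) = (raise_mx k n i *m p) *m W s.
  rewrite /p mulmxA raise_hom -[RHS]mulmxA -prj_hom ?mulmxA // => w' u.
  by rewrite has_cont_act.
rewrite -mulmxA (ysym_hom _ hom) !mulmxA word_vec_raise mulmx_suml big1 ?mul0mx
    // => j /eqP wj.
rewrite word_vec_prj; case: (boolP (has_cont _ _)) => [/zerosE zc|_]; last by
    rewrite scale0r.
by move: le; rewrite E -zc (zeros_upd i wj) ltnn.
Qed.

(** Once the first row is symmetrized, all words with less than mu_1 zeros are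
    relations. *)
Lemma compl_mod_ysym0 c mu : (c ord0 < part mu 0)%N -> compl_mod c *m ysym W
    (std_tab mu) = 0.
Proof.
move=> lt; have [modC _ z] := compl_modP c; apply/eqP; rewrite -submx0 -[X in (_
    <= X)%MS]z.
rewrite sub_capmx module_ysym // andbT mulmxA; apply: submx_trans
    (module_col_alt _ (rel_mod_module c)).
apply: submxMr; rewrite sub_capmx; apply/andP; split.
  exact/(submx_trans (submxMr _ (compl_mod_sub c)))/module_row_sum/cont_mod_module.
apply: submx_trans (submxMr _ (compl_mod_sub c)) _; rewrite sumsmxMr.
apply/sumsmx_subP => w cw; rewrite (eqmxMr _ (genmxE _)).
by apply: row_sum_sub_relations => //; rewrite (zerosE cw).
Qed.

Lemma rank_split c mu : (\rank (rel_mod c *m ysym W (std_tab mu)) +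
  \rank (compl_mod c *m ysym W (std_tab mu)) = cont_mult k m.+1 (cnt c) mu)%N.
Proof.
have [modC defT z] := compl_modP c; rewrite /cont_mult -/(perm_mod c) -(eqmxMr _
    defT) addsmxMr.
rewrite mxrank_disjoint_sum //; apply: capmx0S z _ _; apply: module_ysym => //.
exact: rel_mod_module.
Qed.

Lemma rank_compl_mod_ysym c mu : \rank (compl_mod c *m ysym W (std_tab mu)) =
  if part mu 0 == c ord0 then cont_mult k m.+1 (cnt c) mu else 0%N.
Proof.
case: ltngtP => [lt|lt|E].
- have := rank_split c mu; rewrite /cont_mult -/(perm_mod c) perm_mod_ysym0 //
    mxrank0.
  by move/eqP; rewrite addn_eq0 => /andP[_ /eqP].
- by rewrite compl_mod_ysym0 // mxrank0.
by rewrite -rank_split rel_mod_ysym0 // mxrank0.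
Qed.

Lemma mult_sub_le (X : 'M_#|{: word}|) : mxmodule W X ->
  (\sum_(mu : intpart n l) \rank (X *m ysym W (std_tab mu)) * \rank (specht_mx k
      mu) <= \rank X)%N.
Proof.
move=> modX; have := sum_mult_le l charf0 (submod_repr modX).
by congr (_ <= _)%N; apply: eq_bigr => mu _; rewrite mult_submod.
Qed.

(** Both the relations and their complement satisfy the inequality of
    mult_sub_le, and the sum of the two is an equality. *)
Lemma compl_mod_complete c :
    (\sum_(mu : intpart n l) cont_mult k m.+1 (cnt c) mu * \rank (specht_mx k
        mu) = \rank (perm_mod c))%N ->
  (\sum_(mu : intpart n l) \rank (compl_mod c *m ysym W (std_tab mu)) * \rank
      (specht_mx k mu) = \rank (compl_mod c))%N.
Proof.
have [modC defT z] := compl_modP c; move=> E; apply/eqP; rewrite eqn_leq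
    mult_sub_le //=.
have := mult_sub_le (rel_mod_module c); rewrite -(leq_add2r (\rank (compl_mod c))).
rewrite -mxrank_disjoint_sum // defT -E.
under [X in (_ <= X -> _)%N]eq_bigr do rewrite -rank_split mulnDl.
by rewrite big_split /= leq_add2l.
Qed.

Lemma rank_compl_sum_ysym P mu : \rank (compl_sum P *m ysym W (std_tab mu)) =
  (\sum_(c | P c) \rank (compl_mod c *m ysym W (std_tab mu)))%N.
Proof.
rewrite /compl_sum sumsmxMr.
have d : mxdirect (\sum_(c | P c) (compl_mod c *m ysym W (std_tab mu))).
  apply: mxdirect_sub (compl_mod_direct P) _ => c.
  by apply: module_ysym; case: (compl_modP c).
exact: (mxdirectP d).
Qed.

Lemma rank_compl_sum P : \rank (compl_sum P) = (\sum_(c | P c) \rank (compl_mod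
    c))%N.
Proof. exact: (mxdirectP (compl_mod_direct P)). Qed.

End Contents.

(** * Sorting a content *)

Section Sorting.

Local Open Scope nat_scope.

Variables (n m l : nat).
Hypothesis n_gt0 : 0 < n.
Hypothesis lE : l = minn n m.+1.
Implicit Types (c : content n m) (lambda mu : intpart n l).

Let l_gt0 : 0 < l. Proof. by rewrite lE leq_min n_gt0. Qed.
Let l_le : l <= m.+1. Proof. by rewrite lE geq_minr. Qed.

Definition padded lambda : seq nat := parts lambda ++ nseq (m.+1 - l) 0.

Definition letters c : seq nat := [seq val (c a) | a <- enum 'I_m.+1].

Definition sorts c lambda : bool := perm_eq (letters c) (padded lambda).

Lemma size_parts lambda : size (parts lambda) = l.
Proof. by rewrite size_map size_tuple. Qed.

Lemma size_padded lambda : size (padded lambda) = m.+1.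
Proof. by rewrite size_cat size_parts size_nseq subnKC. Qed.

Lemma size_letters c : size (letters c) = m.+1.
Proof. by rewrite size_map size_enum_ord. Qed.

Lemma nth_letters c (a : 'I_m.+1) : nth 0 (letters c) a = c a.
Proof. by rewrite (nth_map a) ?size_enum_ord // nth_ord_enum. Qed.

Lemma nth_padded lambda i : nth 0 (padded lambda) i = part lambda i.
Proof.
rewrite nth_cat size_parts; case: ltnP => // li.
by rewrite nth_nseq if_same /part nth_default // size_parts.
Qed.

Lemma letters_le c x : x \in letters c -> x <= n.
Proof. by case/mapP => a _ ->; rewrite -ltnS; exact: ltn_ord (c a). Qed.

Lemma sort_exists c : \sum_a c a = n -> exists lambda, sorts c lambda.
Proof.
move=> sumc; pose s := sort geq (letters c).
have geq_tot : total geq by move=> x y; apply: leq_total.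
have geq_tr : transitive geq by move=> x y z /= xy zx; apply: leq_trans xy.
have s_sorted : sorted geq s by apply: sort_sorted.
have s_perm : perm_eq s (letters c) by rewrite perm_sort.
have s_size : size s = m.+1 by rewrite (perm_size s_perm) size_letters.
have s_sum : sumn s = n.
  by rewrite (perm_sumn s_perm) sumnE big_map big_enum.
have s_le i : nth 0 s i <= n.
  have [il|li] := ltnP i (size s); last by rewrite nth_default.
  by apply: (@letters_le c); rewrite -(perm_mem s_perm) mem_nth.
have s_zero i : l <= i -> nth 0 s i = 0.
  have [im|mi _] := ltnP i m.+1; last by rewrite nth_default // s_size.
  rewrite lE geq_min leqNgt [m.+1 <= i]leqNgt im orbF -leqNgt => ni.
  (* otherwise more than n entries are positive *)
  apply/eqP; rewrite -leqn0 leqNgt; apply/negP => pos.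
  have : i.+1 <= sumn s.
    rewrite sumnE (big_nth 0) s_size (big_cat_nat (n := i.+1)) //=.
    apply: leq_trans (leq_addr _ _); rewrite -[X in X <= _]subn0 -[X in X <=
        _]muln1 -sum_nat_const_nat.
    rewrite !big_nat; apply: leq_sum => j /andP[_ ji]; apply: leq_trans pos _.
    apply: (sorted_leq_nth geq_tr _ 0 s_sorted) => //; rewrite ?inE ?s_size //.
    - by move=> ?; exact: leqnn.
    - exact: leq_trans ji _.
  by rewrite s_sum ltnNge ni.
pose tp : l.-tuple 'I_n.+1 := [tuple inord (nth 0 s i) | i < l].
have tpE : map val tp = take l s.
  apply: (@eq_from_nth _ 0) => [|i]; first by rewrite size_map size_tuple
      size_takel // s_size.
  rewrite size_map size_tuple => il.
  rewrite (nth_map ord0) ?size_tuple // -(tnth_nth _ tp (Ordinal il)) tnth_mktuple.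
  by rewrite /= inordK ?nth_take // ltnS.
have sE : s = take l s ++ nseq (m.+1 - l) 0.
  rewrite -{1}(cat_take_drop l s); congr (_ ++ _).
  apply: (@eq_from_nth _ 0) => [|i _]; first by rewrite size_drop s_size size_nseq.
  by rewrite nth_drop nth_nseq if_same s_zero // leq_addr.
have tpP : sorted geq (map val tp) && (sumn (map val tp) == n).
  rewrite tpE take_sorted //= -[X in _ == X]s_sum [in X in _ == X]sE sumn_cat
      sumn_nseq mul0n.
  by rewrite addn0.
exists (exist _ tp tpP); rewrite /sorts /padded /parts /= tpE -sE.
by rewrite perm_sym.
Qed.

Lemma sort_unique c lambda mu : sorts c lambda -> sorts c mu -> lambda = mu.
Proof.
rewrite /sorts => sl sm; have : perm_eq (padded lambda) (padded mu).
  by rewrite -(permPl sl).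
rewrite perm_cat2r => pe.
have /andP[ls _] := valP lambda; have /andP[ms _] := valP mu.
have E : parts lambda = parts mu.
  apply: (sorted_eq (leT := geq)) => //.
  - by move=> x y z /= xy zx; apply: leq_trans xy.
  - by move=> x y /= H; apply/eqP; rewrite eqn_leq andbC.
by apply/val_inj/val_inj/(inj_map val_inj).
Qed.

Lemma sorts_head c lambda : sorts c lambda -> c ord0 <= part lambda 0.
Proof.
move=> s; have : (c ord0 : nat) \in padded lambda.
  by rewrite -(perm_mem s); apply: map_f; rewrite mem_enum.
by case/(nthP 0) => i _ <-; rewrite nth_padded part_le.
Qed.

Lemma sorts_sum c lambda : sorts c lambda -> \sum_a c a = n.
Proof.
move=> s; have := perm_sumn s; rewrite sumn_cat sumn_nseq mul0n addn0.
have /andP[_ /eqP->] := valP lambda; by rewrite sumnE big_map big_enum.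
Qed.

Lemma sorts_relabel c lambda : sorts c lambda ->
  exists f : 'I_l -> 'I_m.+1, [/\ injective f,
     forall a : 'I_l, cnt c (f a) = part lambda a
   & forall b : 'I_m.+1, b \notin codom f -> cnt c b = 0].
Proof.
rewrite /sorts perm_sym => /(perm_iotaP 0)[Is pI Ep].
have sI : size Is = m.+1 by rewrite (perm_size pI) size_iota size_letters.
have uI : uniq Is by rewrite (perm_uniq pI) iota_uniq.
have ltI i : i < m.+1 -> nth 0 Is i < m.+1.
  move=> im; have : nth 0 Is i \in iota 0 (size (letters c)).
    by rewrite -(perm_mem pI) mem_nth // sI.
  by rewrite mem_iota size_letters.
have cI i : i < m.+1 -> cnt c (nth 0 Is i) = part lambda i.
  move=> im; rewrite -nth_padded Ep (nth_map 0) ?sI //.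
  by rewrite /cnt -nth_letters inordK // ltI.
exists (fun a : 'I_l => inord (nth 0 Is a)); split=> [a b|a|b nb].
- move/(congr1 val); rewrite /= !inordK ?ltI ?(leq_trans (ltn_ord _)) //.
  by move/eqP; rewrite nth_uniq ?sI ?(leq_trans (ltn_ord _)) // => /eqP/val_inj.
- by rewrite inordK ?ltI ?cI ?(leq_trans (ltn_ord _)).
have bI : val b \in Is by rewrite (perm_mem pI) mem_iota size_letters /=.
rewrite -(nth_index 0 bI) cI; last by move: bI; rewrite -index_mem sI.
have [il|li] := ltnP (index (val b) Is) l; last by rewrite /part nth_default //
    size_parts.
case/negP: nb; apply/codomP; exists (Ordinal il); apply/val_inj.
by rewrite /= nth_index // inord_val.
Qed.

Lemma sorts_cont c lambda :
  sorts c lambda = has_cont (fun j => count_mem j (padded lambda)) (c : word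
      m.+1 n.+1).
Proof.
have cntE (a : 'I_n.+1) : #|[set x | c x == a]| = count_mem (a : nat) (letters c).
  rewrite cardsE cardE /enum_mem size_filter count_map enumT.
  by apply: eq_count.
apply/idP/forallP => [s a|H]; first by rewrite cntE (seq.permP s).
apply/allP => x; rewrite mem_cat => xin /=.
have xn : x < n.+1.
  case/orP: xin => [/letters_le //|/(nthP 0)[i _ <-]].
  by rewrite nth_padded ltnS part_le_n.
by rewrite -(eqP (H (Ordinal xn))) cntE.
Qed.

Lemma parts_cons lambda : parts lambda = part lambda 0 :: behead (parts lambda).
Proof. by rewrite /part; case: (parts lambda) (size_parts lambda) l_gt0 => //=
    <-. Qed.

(** A content with first entry lambda_1 is a rearrangement of lambda if its tail
    is a word containing each of the other parts, and the padding zeros, as often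
    as lambda does; these words are counted by a multinomial coefficient. No
    other part can be equal to n, which is why kappa only involves k_j for
    j < n. *)
Lemma card_sorts lambda :
  #|[set c : content n m | (c ord0 == part lambda 0 :> nat) && sorts c lambda]|
      = kappa m lambda.
Proof.
pose a : 'I_n.+1 := inord (part lambda 0).
have aE : a = part lambda 0 :> nat by rewrite inordK // ltnS part_le_n.
pose s := behead (parts lambda) ++ nseq (m.+1 - l) 0.
have sE : padded lambda = part lambda 0 :: s by rewrite /padded parts_cons.
have size_s : size s = m by have := size_padded lambda; rewrite sE => -[].
pose d j := count_mem j (padded lambda).
have dE j : decr d a j = count_mem j s.
  by rewrite /decr /d sE /= aE eq_sym addKn.
have da : 0 < d a by rewrite /d sE /= aE eqxx.
have -> : #|[set c : content n m | (c ord0 == part lambda 0 :> nat) && sorts c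
    lambda]|
          = nwords m n.+1 (fun j => count_mem j s).
  rewrite -(nwords_ext m (c := decr d a)) => [|j _]; last exact: dE.
  rewrite -card_words -(card_imset (f := cons_word a)).
    apply: eq_card => c; rewrite inE sorts_cont; apply/andP/imsetP => [[/eqP c0
        cd]|[g]].
      have Ec : c = cons_word a [ffun y => c (lift ord0 y)].
        apply/ffunP => x; case: (unliftP ord0 x) => [y ->|->]; last first.
          by rewrite cons_word0; apply/val_inj; rewrite /= c0 aE.
        by rewrite cons_wordS ffunE.
      exists [ffun y => c (lift ord0 y)] => //.
      by rewrite inE; move: cd; rewrite {1}Ec has_cont_cons => /andP[].
    by rewrite inE => cg ->; rewrite has_cont_cons da cg cons_word0 aE.
  move=> v v' E; apply/ffunP => y.
  by have := congr1 (fun w : word m.+1 n.+1 => w (lift ord0 y)) E; rewrite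
      !cons_wordS.
have sum_count : \sum_(j < n.+1) count_mem (j : nat) s = m.
  rewrite -[RHS]size_s -sum1_size.
  have mem_s x : x \in s -> x < n.+1.
    move=> xs; have : x \in padded lambda by rewrite sE inE xs orbT.
    by case/(nthP 0) => i _ <-; rewrite nth_padded ltnS part_le_n.
  rewrite (eq_bigr (fun j : 'I_n.+1 => \sum_(x <- s | x == j :> nat) 1)); last
      first.
    by move=> j _; rewrite sum1_count.
  rewrite (exchange_big_dep xpredT) //= !big_seq; apply: eq_bigr => x xs.
  by rewrite (big_pred1 (Ordinal (mem_s x xs))).
have count_top : count_mem n s = 0.
  apply/count_memPn; rewrite mem_cat negb_or mem_nseq (gtn_eqF n_gt0) andbF andbT.
  apply/negP => nin; have /andP[srt /eqP sm] := valP lambda.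
  have : n \in parts lambda by rewrite parts_cons inE nin orbT.
  case/(nthP 0) => i _ /esym ni.
  have n0 : n <= part lambda 0 := leq_trans (eq_leq ni) (part_le lambda (leq0n i)).
  move: sm; rewrite -/(parts lambda) parts_cons /= => sm.
  have : n <= sumn (behead (parts lambda)).
    by move: nin; elim: (behead _) => //= x r IH; rewrite inE =>
        /orP[/eqP<-|/IH]; lia.
  by lia.
have count_pos j : 0 < j -> count_mem j s = kmult lambda j.
  move=> j0; rewrite /s count_cat count_nseq /= eq_sym (gtn_eqF j0) mul0n addn0.
  by [].
have fact_ := @nwords_fact m n.+1 (fun j => count_mem j s) sum_count.
have sum1 : m - \sum_(1 <= j < n) kmult lambda j = count_mem 0 s.
  rewrite -[X in X - _]sum_count -(big_mkord xpredT (fun j => count_mem j s)).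
  rewrite big_nat_recr //= count_top addn0 big_ltn //.
  rewrite (eq_big_nat _ _ (F2 := kmult lambda)) ?addnK // => j /andP[j0 _].
  exact: count_pos.
have prod1 : \prod_(j < n.+1) (count_mem (j : nat) s)`! =
    (count_mem 0 s)`! * \prod_(1 <= j < n) (kmult lambda j)`!.
  rewrite -(big_mkord xpredT (fun j => (count_mem j s)`!)).
  rewrite big_nat_recr //= count_top fact0 muln1 big_ltn //; congr (_ * _).
  by apply: eq_big_nat => j /andP[j0 _]; rewrite count_pos.
rewrite /kappa sum1 -fact_ prod1 mulnK // muln_gt0 fact_gt0 /=.
by apply/prodn_gt0 => j; apply: fact_gt0.
Qed.

End Sorting.

(** * Representations are determined by their multiplicities *)

Section MultMorphism.

Variables (k : fieldType) (n l : nat).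
Hypothesis charf0 : [pchar k] =i pred0.
Hypothesis n_gt0 : (0 < n)%N.
Implicit Types mu nu : intpart n l.
Local Notation repr := (representation k [set: 'S_n]).

Lemma mult_rsim n1 n2 (rG1 : mx_representation k [set: 'S_n] n1)
    (rG2 : mx_representation k [set: 'S_n] n2) mu :
  mx_rsim rG1 rG2 -> mult rG1 mu = mult rG2 mu.
Proof.
case=> B E fB hom; rewrite /mult -(mxrankMfree _ fB).
rewrite (ysym_hom _ (fun s => hom s (in_setT s))) eqmxMfull //.
by rewrite /row_full (eqP fB) E.
Qed.

Lemma mult_dadd (r1 r2 : repr) mu : mult (dadd_grepr r1 r2) mu = (mult r1 mu +
    mult r2 mu)%N.
Proof.
have sum_block (I : finType) (P : pred I) (F : I -> 'M[k]_(rdegree r1)) (G : I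
    -> 'M[k]_(rdegree r2)) :
    \sum_(i | P i) block_mx (F i) 0 0 (G i) =
    block_mx (\sum_(i | P i) F i) 0 0 (\sum_(i | P i) G i).
  elim/big_rec3: _ => [|i x y z _ ->]; last by rewrite add_block_mx !addr0.
  by rewrite block_mx_const.
rewrite /mult /ysym /row_sum /col_alt /= sum_block.
rewrite (eq_bigr (fun s : 'S_n => block_mx ((-1) ^+ s *: r1 s) 0 0 ((-1) ^+ s *:
    r2 s))).
  by rewrite sum_block mulmx_block !(mulmx0, mul0mx, addr0, add0r)
      rank_diag_block_mx.
by move=> s _; rewrite scale_block_mx !scaler0.
Qed.

Lemma mult_grepr0 mu : mult (grepr0 : repr) mu = 0%N.
Proof. by apply/eqP; rewrite -leqn0; apply: rank_leq_row. Qed.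

Lemma mult_big (I : Type) (r : seq I) (P : pred I) (F : I -> repr) mu :
  mult (\big[dadd_grepr/grepr0]_(i <- r | P i) F i) mu = (\sum_(i <- r | P i)
      mult (F i) mu)%N.
Proof.
exact: (big_morph (fun rG : repr => mult rG mu) (fun r1 r2 => mult_dadd r1 r2
    mu) (mult_grepr0 mu)).
Qed.

Lemma rdegree_big (I : Type) (r : seq I) (P : pred I) (F : I -> repr) :
  rdegree (\big[dadd_grepr/grepr0]_(i <- r | P i) F i) = (\sum_(i <- r | P i)
      rdegree (F i))%N.
Proof.
by apply: (big_morph (fun rG : repr => rdegree rG)).
Qed.

Lemma mult_specht_ne mu nu : nu != mu -> mult (specht k nu) mu = 0%N.
Proof. by move=> ne; rewrite mult_submod specht_ysym0 ?mxrank0. Qed.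

Lemma mult_canonical (f : intpart n l -> nat) mu :
  mult (canonical_rep k f) mu = (f mu * mult (specht k mu) mu)%N.
Proof.
rewrite mult_big.
have := sig_big_dep xpredT (fun _ _ => true)
          (fun nu (_ : 'I_(f nu)) => mult (specht k nu) mu) => /= <-.
under eq_bigr do rewrite sum_nat_const card_ord.
rewrite (bigD1 mu) //= [X in (_ + X)%N]big1 ?addn0 // => nu ne.
by rewrite -[mult _ _]/(mult (specht k nu) mu) mult_specht_ne ?muln0.
Qed.

Lemma kostka_self mu : (0 < kostka mu mu)%N.
Proof.
rewrite card_gt0; apply/set0Pn; exists [ffun c => row_of c]; rewrite inE.
apply/andP; split.
  apply/forallP => c; apply/forallP => d; rewrite !ffunE; apply/andP; split.
    by apply/implyP => /andP[/eqP-> _].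
  by apply/implyP => /andP[].
apply/forallP => a.
have /forallP/(_ a)/eqP <- := tabloid_content (std_tab mu).
rewrite -(on_card_preimset (f := val (std_tab mu))); last exact/onW_bij/tab_bij.
by apply/eqP/eq_card => x; rewrite !inE ffunE tabloidE.
Qed.

(** The multiplicity of a Specht module in itself: the permutation module of
    the same shape contains it f > 0 times, whence f = f * mult. *)
Lemma mult_specht mu nu : mult (specht k nu) mu = (nu == mu).
Proof.
have [->|ne] := eqVneq nu mu; last exact: mult_specht_ne.
pose rG := submod_repr (cont_mod_module k n l (part mu)).
have mE : mult rG mu = kostka mu mu.
  by rewrite mult_submod -/(cont_mult k l (part mu) mu) cont_mult_ssyts.
have comp : (\sum_(nu : intpart n l) mult rG nu * \rank (specht_mx k nu) =
             \rank (cont_mod k n l (part mu)))%N.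
  apply: etrans (cont_complete l charf0 n_gt0 _).
  by apply: eq_bigr => ka _; rewrite mult_submod.
have := mult_rsim mu (mult_complete charf0 comp).
rewrite mult_canonical mE => /eqP.
by rewrite -{1}[kostka mu mu]muln1 eqn_pmul2l ?kostka_self // => /eqP <-.
Qed.

(** Both are similar to canonical_rep of the common multiplicities. *)
Lemma rsim_of_mult n1 n2 (rG1 : mx_representation k [set: 'S_n] n1)
    (rG2 : mx_representation k [set: 'S_n] n2) :
    (forall mu : intpart n l, mult rG1 mu = mult rG2 mu) ->
    (\sum_(mu : intpart n l) mult rG1 mu * \rank (specht_mx k mu) = n1)%N ->
    (\sum_(mu : intpart n l) mult rG2 mu * \rank (specht_mx k mu) = n2)%N ->
  mx_rsim rG1 rG2.
Proof.
move=> E c1 c2; apply: mx_rsim_trans (mult_complete charf0 c1) _.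
rewrite (_ : @mult k n l n1 rG1 = @mult k n l n2 rG2); last exact/funext/E.
exact/mx_rsim_sym/mult_complete.
Qed.

End MultMorphism.

(** * Multiplicities in the Galois closure *)

Section Closure.

Variables (k : fieldType) (n m l : nat).
Hypothesis charf0 : [pchar k] =i pred0.
Hypothesis n_gt0 : (0 < n)%N.
Hypothesis lE : l = minn n m.+1.
Implicit Types (mu lambda : intpart n l) (c : content n m).

Let l_gt0 : (0 < l)%N. Proof. by rewrite lE leq_min n_gt0. Qed.

Lemma cont_mult_sorts c lambda mu : sorts c lambda ->
  cont_mult k m.+1 (cnt c) mu = kostka mu lambda.
Proof.
move=> s; have [f [fi fc fo]] := sorts_relabel lE s.
by rewrite (cont_mult_relabel k fi fc fo) cont_mult_ssyts.
Qed.

Lemma perm_mod_eq0 c : (\sum_a c a != n)%N -> perm_mod k c = 0.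
Proof.
move=> ne; apply/eqP; rewrite -submx0; apply/sumsmx_subP => w cw.
case/negP: ne; rewrite -[X in _ == X]card_ord -sum1_card.
rewrite [X in _ == X](partition_big w xpredT) //=; apply/eqP/eq_bigr => a _.
have /eqP := forallP cw a; rewrite /cnt inord_val => <-.
by rewrite -sum1dep_card.
Qed.

Lemma perm_mod_complete c :
  (\sum_(mu : intpart n l) cont_mult k m.+1 (cnt c) mu * \rank (specht_mx k mu)
      = \rank (perm_mod k c))%N.
Proof.
have [sc|ne] := eqVneq (\sum_a c a)%N n; last first.
  rewrite perm_mod_eq0 // mxrank0 big1 // => mu _.
  by rewrite /cont_mult -/(perm_mod k c) perm_mod_eq0 // mul0mx mxrank0.
have [lambda s] := sort_exists lE sc.
have [f [fi fc fo]] := sorts_relabel lE s.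
rewrite /perm_mod (rank_relabel k n fi fc fo) -(cont_complete l charf0 n_gt0).
by apply: eq_bigr => mu _; rewrite (cont_mult_relabel k fi fc fo).
Qed.

Lemma kostka_dom mu lambda : kostka mu lambda != 0%N -> dominates mu lambda.
Proof.
rewrite kostka_ssyts -(cont_mult_ssyts charf0 n_gt0) mxrank_eq0 => nz.
apply/dominatesP => r rl; apply: (cont_mod_col_alt_dom charf0 (L := l) (t :=
    std_tab mu)) => //.
apply: contraNneq nz => E; rewrite -submx0 mulmxA.
suff sub : (cont_mod k n l (part lambda) *m row_sum (word_repr k n l) (std_tab
    mu) <=
   cont_mod k n l (part lambda))%MS.
  by apply: submx_trans (submxMr _ sub) _; rewrite E sub0mx.
rewrite mulmx_sumr; apply: summx_sub => g _.
by apply: (mxmoduleP (cont_mod_module k n l (part lambda))); rewrite inE.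
Qed.

Definition closure_mult mu : nat :=
  (\sum_(lambda | dominates mu lambda && (part mu 0 == part lambda 0)) kappa m
      lambda * kostka mu lambda)%N.

(** Group the contents by their decreasing rearrangement lambda. A nonzero
    Kostka number forces lambda_1 <= mu_1, while mu_1 = c_0 is a part of lambda;
    so only the lambda with lambda_1 = mu_1 contribute. *)
Lemma sum_cont_mult mu :
  (\sum_(c : content n m | part mu 0 == c ord0) cont_mult k m.+1 (cnt c) mu =
      closure_mult mu)%N.
Proof.
transitivity (\sum_(c : content n m | part mu 0 == c ord0)
   \sum_(lambda | sorts c lambda) kostka mu lambda)%N.
  apply: eq_bigr => c _; have [sc|ne] := eqVneq (\sum_a c a)%N n.
    have [lambda s] := sort_exists lE sc.
    rewrite (big_pred1 lambda) ?(cont_mult_sorts _ s) // => nu.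
    by apply/idP/eqP => [s'|->//]; apply: (sort_unique s' s).
  rewrite /cont_mult -/(perm_mod k c) perm_mod_eq0 // mul0mx mxrank0 big1 // =>
      lambda s.
  by rewrite (sorts_sum s) eqxx in ne.
rewrite (exchange_big_dep xpredT) //= /closure_mult [RHS]big_mkcond /=.
apply: eq_bigr => lambda _; rewrite sum_nat_const.
have [->|nz] := eqVneq (kostka mu lambda) 0%N; first by rewrite !muln0 if_same.
have dom := kostka_dom nz; rewrite dom /=.
have le : (part lambda 0 <= part mu 0)%N.
  by have /dominatesP/(_ 1%N l_gt0) := dom; rewrite !big_ord_recl !big_ord0 !addn0.
case: eqP => [E|ne].
  rewrite -(card_sorts n_gt0 lE lambda); congr (_ * _)%N; apply: eq_card => c.
  by rewrite !inE E eq_sym.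
rewrite eq_card0 // => c; rewrite !inE; apply/negP => /andP[/eqP c0 s].
by case: ne; apply/eqP; rewrite eqn_leq le andbT c0 (sorts_head s).
Qed.

Section Degrees.

Variable Q : pred nat.
Let P c := Q (c ord0).

Lemma rank_closure_ysym mu :
  \rank (compl_sum charf0 P *m ysym (word_repr k n m.+1) (std_tab mu)) =
  if Q (part mu 0) then closure_mult mu else 0%N.
Proof.
rewrite rank_compl_sum_ysym; under eq_bigr do rewrite rank_compl_mod_ysym //.
rewrite -big_mkcondr /=; case: ifP => Qmu.
  rewrite -sum_cont_mult; apply: eq_bigl => c; rewrite andbC /P.
  by case: eqP => //= <-.
by apply: big_pred0 => c; rewrite /P; case: eqP; rewrite ?andbF // => <-;
    rewrite Qmu.
Qed.

Lemma closure_complete :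
  (\sum_(mu : intpart n l) \rank (compl_sum charf0 P *m ysym (word_repr k n
      m.+1) (std_tab mu)) *
     \rank (specht_mx k mu) = \rank (compl_sum charf0 P))%N.
Proof.
rewrite rank_compl_sum [LHS](eq_bigr (fun mu : intpart n l => \sum_(c | P c)
  \rank (compl_mod charf0 c *m ysym (word_repr k n m.+1) (std_tab mu)) * \rank
      (specht_mx k mu))%N);
  last by move=> mu _; rewrite rank_compl_sum_ysym big_distrl.
rewrite exchange_big; apply: eq_bigr => c _.
by apply: compl_mod_complete; apply: perm_mod_complete.
Qed.

Lemma rank_closure : \rank (compl_sum charf0 P) =
  (\sum_(lambda : intpart n l | Q (part lambda 0))
    \sum_(mu : intpart n l | dominates mu lambda && (part mu 0 == part lambda 0))
      kappa m lambda * kostka mu lambda * rdegree (specht k mu))%N.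
Proof.
rewrite -closure_complete (exchange_big_dep xpredT) //=; apply: eq_bigr => mu _.
rewrite rank_closure_ysym /closure_mult; case: ifP => Qmu; last first.
  rewrite mul0n big_pred0 // => lambda; case: eqP => [E|]; last by rewrite !andbF.
  by rewrite -E Qmu.
rewrite big_distrl /=; apply: eq_bigl => lambda.
by case: eqP => [<-|]; rewrite ?andbF // Qmu.
Qed.

End Degrees.

Definition target : representation k [set: 'S_n] :=
  \big[dadd_grepr/grepr0]_(lambda : intpart n l)
    \big[dadd_grepr/grepr0]_(mu : intpart n l | dominates mu lambda && (part mu
        0 == part lambda 0))
      muln_grepr (specht k mu) (kappa m lambda * kostka mu lambda).

Lemma mult_target mu : mult target mu = closure_mult mu.
Proof.
rewrite mult_big /closure_mult [RHS]big_mkcond /=; apply: eq_bigr => lambda _.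
rewrite mult_big.
rewrite (eq_bigr (fun nu => if nu == mu then kappa m lambda * kostka nu lambda
    else 0)%N).
  rewrite -big_mkcondr /=; case: ifP => [H|H].
    rewrite (big_pred1 mu) // => nu /=.
    by case: (eqVneq nu mu) => [->|]; rewrite ?andbF ?andbT ?H.
  by apply: big_pred0 => nu; case: (eqVneq nu mu) => [->|]; rewrite ?andbF // H.
move=> nu _; rewrite mult_big sum_nat_const card_ord mult_specht //.
by case: eqP => _; rewrite ?muln1 ?muln0.
Qed.

Lemma rdegree_target : rdegree target = \rank (compl_sum charf0 (fun c : content
    n m => true)).
Proof.
rewrite (rank_closure xpredT) rdegree_big; apply: eq_bigr => lambda _.
rewrite rdegree_big; apply: eq_bigr => mu _.
by rewrite rdegree_big sum_nat_const card_ord.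
Qed.

Lemma compl_sum_target :
  mx_rsim (submod_repr (compl_sum_module charf0 (fun c : content n m => true)))
      target.
Proof.
have multE mu : mult (submod_repr (compl_sum_module charf0 (fun c : content n m
    => true))) mu
  = closure_mult mu.
  by rewrite mult_submod (rank_closure_ysym xpredT).
have comp : (\sum_mu closure_mult mu * \rank (specht_mx k mu) =
             \rank (compl_sum charf0 (fun c : content n m => true)))%N.
  rewrite -(closure_complete xpredT); apply: eq_bigr => mu _.
  by rewrite (rank_closure_ysym xpredT).
apply: (@rsim_of_mult k n l charf0) => [mu||].
- by rewrite multE mult_target.
- by apply: etrans comp; apply: eq_bigr => mu _; rewrite multE.
rewrite [RHS]rdegree_target; apply: etrans comp.
by apply: eq_bigr => mu _; rewrite mult_target.
Qed.

End Closure.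

(** * The Galois closure as a quotient of the space of words *)

Lemma eq_mxvec_index m n (i i' : 'I_m) (j j' : 'I_n) :
  (mxvec_index i j == mxvec_index i' j') = (i == i') && (j == j').
Proof. by rewrite /mxvec_index (inj_eq (@cast_ord_inj _ _ _)) (inj_eq
    enum_rank_inj). Qed.

Section Monomials.

Variables (k : fieldType) (m n : nat).
Local Notation word := (word n m.+1).
Local Notation poly := {mpoly k[m * n]}.
Local Notation galpi := (@galpi k m n).
Implicit Types (w : word) (u : 'X_{1.. m * n}) (p : poly).

Definition letter_mon w (j : 'I_n) : 'X_{1.. m * n} :=
  if unlift ord0 (w j) is Some i then U_(mxvec_index i j)%MM else 0%MM.

(** The word w stands for the product of the x_(w j, j) over the j such that
    w j is not 0. *)
Definition mon w : 'X_{1.. m * n} := (\sum_j letter_mon w j)%MM.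

Lemma monE w i j : mon w (mxvec_index i j) = (w j == lift ord0 i).
Proof.
rewrite /mon mnm_sumE (bigD1 j) //= big1 ?addn0 => [|j' jj'].
  rewrite /letter_mon; case: (unliftP ord0 (w j)) => [i' ->|->]; last by rewrite
      mnm0E.
  by rewrite mnm1E (inj_eq (@lift_inj _ ord0)) eq_mxvec_index eqxx andbT.
rewrite /letter_mon; case: (unlift _ _) => [i'|]; last by rewrite mnm0E.
by rewrite mnm1E eq_mxvec_index (negPf jj') andbF.
Qed.

Lemma mnm_eqP u u' : (forall i j, u (mxvec_index i j) = u' (mxvec_index i j)) ->
    u = u'.
Proof. by move=> E; apply/mnmP => v; case/mxvec_indexP: v. Qed.

Lemma mon_inj : injective mon.
Proof.
move=> w w' E; apply/ffunP => j.
have Ei i : (w j == lift ord0 i) = (w' j == lift ord0 i).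
  by have := congr1 (fun u : 'X_{1.. m * n} => u (mxvec_index i j)) E; rewrite
      !monE; do 2!case: eqP.
case: (unliftP ord0 (w j)) => [i wi|w0].
  by apply/esym/eqP; rewrite wi -Ei wi.
case: (unliftP ord0 (w' j)) => [i wi|->//].
by apply/eqP; rewrite wi Ei wi.
Qed.

Lemma mdeg_mon w : (mdeg (mon w) + zeros w = n)%N.
Proof.
rewrite /mon mdeg_sum /zeros -sum1dep_card [X in (_ + X)%N]big_mkcond -big_split /=.
rewrite -[RHS]card_ord -sum1_card; apply: eq_bigr => j _.
rewrite /letter_mon; case: (unliftP ord0 (w j)) => [i ->|->]; last by rewrite
    mdeg0 eqxx.
by rewrite mdeg1.
Qed.

(** This characterizes the exponents mon w; all other monomials are multiples of
    some x_(i,j) x_(i',j). *)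
Definition columnwise u := forall j i i',
  (u (mxvec_index i j) <= 1)%N /\
  (0 < u (mxvec_index i j) -> 0 < u (mxvec_index i' j) -> i = i')%N.

Lemma mon_columnwise w : columnwise (mon w).
Proof.
move=> j i i'; rewrite !monE; split; first exact: leq_b1.
by rewrite !lt0b => /eqP-> /eqP/lift_inj.
Qed.

Lemma columnwise_mon u : columnwise u -> exists w, mon w = u.
Proof.
move=> cu; pose w : word := [ffun j =>
  if [pick i | 0 < u (mxvec_index i j)]%N is Some i then lift ord0 i else ord0].
exists w; apply: mnm_eqP => i j; rewrite monE ffunE.
case: pickP => [i0 pos|none]; last first.
  by have := none i; case: (u _).
rewrite (inj_eq (@lift_inj _ ord0)); case: eqP => [<-|ne].
  by have [le _] := cu j i0 i0; apply/eqP; rewrite eq_sym eqn_leq le.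
by have [_ H] := cu j i0 i; case: (u (mxvec_index i j)) H => // d /(_ pos isT).
Qed.

Lemma columnwise_sub u d : columnwise (u + d)%MM -> columnwise u.
Proof.
move=> c j i i'; have [le H] := c j i i'; rewrite !mnmDE in le H; split.
  exact: leq_trans (leq_addr _ _) le.
by move=> pi pi'; apply: H; rewrite addn_gt0 ?pi ?pi'.
Qed.

Lemma not_columnwise u : ~ columnwise u -> exists j i i' u',
  u = (u' + (U_(mxvec_index i j) + U_(mxvec_index i' j)))%MM.
Proof.
move=> nc; suff [j [i [i' le]]] : exists j i i',
    (U_(mxvec_index i j) + U_(mxvec_index i' j) <= u)%MM.
  by exists j, i, i', (u - (U_(mxvec_index i j) + U_(mxvec_index i' j)))%MM;
      rewrite submK.
apply: contra_notP nc => H j i i'; split.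
  rewrite leqNgt; apply/negP => lt; apply: H; exists j, i, i.
  apply/mnm_lepP => v; rewrite mnmDE !mnm1E; case: eqP => [<-|//].
  by rewrite addn1.
move=> pi pi'; apply/eqP; apply: contraT => ne; case: H; exists j, i, i'.
apply/mnm_lepP => v; rewrite mnmDE !mnm1E; case: eqP => [<-|_].
  by rewrite eq_mxvec_index eqxx andbT eq_sym (negPf ne).
by case: eqP => [<-|].
Qed.

(** * Vanishing monomials *)

Lemma galpi_eq0 p : (galpi p == 0) = (p \in @galideal k m n).
Proof. by rewrite -[0](raddf0 galpi) galpi_eq subr0. Qed.

Lemma galpi_galgen r : galpi (galgen k r) = 0.
Proof.
apply/eqP; rewrite galpi_eq0; apply/asboolP; exists (fun q => (q == r)%:R).
rewrite (bigD1 r) //= eqxx mul1r big1 ?addr0 // => q /negPf->.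
by rewrite mul0r.
Qed.

Lemma galpi_not_columnwise u : ~ columnwise u -> galpi 'X_[u] = 0.
Proof.
case/not_columnwise=> j [i [i' [u' ->]]].
have := galpi_galgen (inr (i, i', j)); rewrite /= /xvar -mpolyXD => E.
by rewrite mpolyXD rmorphM /= E mulr0.
Qed.

(** * Words as coordinates on polynomials *)

Definition coefs p : 'rV[k]_#|{: word}| := \row_a p@_(mon (enum_val a)).

Definition poly_of (v : 'rV[k]_#|{: word}|) : poly := \sum_a v 0 a *: 'X_[mon
    (enum_val a)].

Lemma coefs_linear : linear coefs.
Proof. by move=> a p q; apply/rowP => b; rewrite !mxE mcoeffD mcoeffZ. Qed.

HB.instance Definition _ := GRing.isLinear.Build k poly 'rV[k]_#|{: word}| _
    coefs coefs_linear.

Lemma poly_of_linear : linear poly_of.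
Proof.
move=> a v w; rewrite /poly_of scaler_sumr -big_split; apply: eq_bigr => b _ /=.
by rewrite !mxE scalerDl scalerA.
Qed.

HB.instance Definition _ := GRing.isLinear.Build k 'rV[k]_#|{: word}| poly _
    poly_of poly_of_linear.

Lemma coefsX u w : coefs 'X_[u] 0 (enum_rank w) = (u == mon w)%:R.
Proof. by rewrite mxE mcoeffX enum_rankK. Qed.

Lemma row_wordP (v v' : 'rV[k]_#|{: word}|) :
  (forall w, v 0 (enum_rank w) = v' 0 (enum_rank w)) -> v = v'.
Proof. by move=> E; apply/rowP => a; rewrite -[a]enum_valK. Qed.

Lemma coefs_mon w : coefs 'X_[mon w] = word_vec k w.
Proof.
by apply: row_wordP => w'; rewrite coefsX word_vec_coord (inj_eq mon_inj).
Qed.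

Lemma coefs_not_columnwise u : ~ columnwise u -> coefs 'X_[u] = 0.
Proof.
move=> nc; apply: row_wordP => w; rewrite coefsX mxE.
by case: eqP => // E; case: nc; rewrite E; apply: mon_columnwise.
Qed.

Lemma poly_of_word w : poly_of (word_vec k w) = 'X_[mon w].
Proof.
rewrite /poly_of (bigD1 (enum_rank w)) //= enum_rankK word_vec_coord eqxx scale1r.
rewrite big1 ?addr0 // => a /negPf ne.
by rewrite /word_vec mxE eqxx ne scale0r.
Qed.

Lemma row_word_sum (v : 'rV[k]_#|{: word}|) : v = \sum_a v 0 a *: word_vec k
    (enum_val a).
Proof.
rewrite {1}[v]row_sum_delta; apply: eq_bigr => a _.
by rewrite /word_vec enum_valK.
Qed.

Lemma poly_ofK : cancel poly_of coefs.
Proof.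
move=> v; rewrite [RHS]row_word_sum /poly_of raddf_sum; apply: eq_bigr => a _ /=.
by rewrite linearZ /= coefs_mon.
Qed.

Lemma galpi_coefs p : galpi (poly_of (coefs p)) = galpi p.
Proof.
rewrite {1}[p]mpolyE [in RHS](mpolyE p) (raddf_sum coefs) (raddf_sum poly_of)
    !(raddf_sum galpi).
apply: eq_bigr => u _ /=.
rewrite !linearZ /=; congr (_ *: _).
have [[w <-]|nc] := pselect (exists w, mon w = u); first by rewrite coefs_mon
    poly_of_word.
have {}nc : ~ columnwise u by move/columnwise_mon.
by rewrite coefs_not_columnwise // raddf0 raddf0 galpi_not_columnwise.
Qed.

(** * The ideal and the raising operators *)

Lemma mon_upd w j i : w j = ord0 -> mon (upd w j (lift ord0 i)) = (mon w +
    U_(mxvec_index i j))%MM.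
Proof.
move=> wj; apply: mnm_eqP => i' j'; rewrite mnmDE !monE mnm1E eq_mxvec_index ffunE.
rewrite [j' == j]eq_sym; case: (eqVneq j j') => [<-|]; last by rewrite andbF addn0.
by rewrite wj andbT (inj_eq (@lift_inj _ ord0)).
Qed.

Lemma mon_not_columnwise w j i : w j != ord0 -> ~ columnwise (mon w +
    U_(mxvec_index i j))%MM.
Proof.
case: (unliftP ord0 (w j)) => [i' wj _|->]; last by rewrite eqxx.
move=> /(_ j i' i); rewrite !mnmDE !monE !mnm1E !eq_mxvec_index !eqxx wj eqxx /=
    => -[le H].
by move: le; rewrite (H _ _) ?eqxx // addn1.
Qed.

(** Reading off the coefficients of the monomials mon w turns multiplication by
    a linear generator of the ideal into a raising operator. *)
Lemma coefs_raise p i : coefs (p * \sum_j xvar k i j) = coefs p *m raise_mx k n i.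
Proof.
rewrite {1}[p]mpolyE [in RHS](mpolyE p) mulr_suml !(raddf_sum coefs) mulmx_suml;
    apply: eq_bigr => u _ /=.
rewrite -scalerAl !linearZ /= -scalemxAl; congr (_ *: _).
rewrite mulr_sumr raddf_sum /=.
under eq_bigr do rewrite /xvar -mpolyXD.
have [[w <-]|nc] := pselect (exists w, mon w = u).
  rewrite coefs_mon word_vec_raise [RHS]big_mkcond; apply: eq_bigr => j _.
  case: (eqVneq (w j) ord0) => [wj|wj]; first by rewrite -mon_upd // coefs_mon.
  by apply: coefs_not_columnwise; apply: mon_not_columnwise.
have {}nc : ~ columnwise u by move/columnwise_mon.
rewrite (coefs_not_columnwise nc) mul0mx big1 // => j _.
by apply: coefs_not_columnwise => /columnwise_sub.
Qed.

Lemma coefs_square p i i' j : coefs (p * (xvar k i j * xvar k i' j)) = 0.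
Proof.
rewrite [p]mpolyE mulr_suml raddf_sum big1 // => u _ /=.
rewrite -scalerAl linearZ /= /xvar -!mpolyXD coefs_not_columnwise ?scaler0 //.
move=> /(_ j i i'); rewrite !mnmDE !mnm1E !eq_mxvec_index !eqxx !andbT => -[le H].
have E : i = i' by apply: H; rewrite !addn_gt0 /= ?orbT.
by move: le; rewrite E eqxx; lia.
Qed.

Lemma coefs_ideal p : p \in @galideal k m n -> (coefs p <= relations k n m)%MS.
Proof.
move=> /asboolP[c ->]; rewrite raddf_sum; apply: summx_sub => r _ /=.
case: r => [i|[[i i'] j]] /=; last by rewrite coefs_square sub0mx.
by rewrite coefs_raise raise_sub.
Qed.

Lemma coefs_galpi p : galpi p = 0 -> (coefs p <= relations k n m)%MS.
Proof. by move/eqP; rewrite galpi_eq0; apply: coefs_ideal. Qed.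

Lemma galpi_relations (v : 'rV[k]_#|{: word}|) : (v <= relations k n m)%MS ->
    galpi (poly_of v) = 0.
Proof.
case/sub_sumsmxP=> u ->; rewrite (raddf_sum poly_of) (raddf_sum galpi) big1 //
    => i _ /=.
have /submxP[D ->] : (u i *m <<raise_mx k n i>> <= raise_mx k n i)%MS.
  by rewrite -(genmxE (raise_mx k n i)) submxMl.
rewrite -[D]poly_ofK -coefs_raise galpi_coefs rmorphM /=.
by rewrite -[\sum_j _]/(galgen k (inl i)) galpi_galgen mulr0.
Qed.

Lemma galpi_surj (x : galclosure k m n) : exists p, x = galpi p.
Proof. by exists (repr x); rewrite /Defs.galpi reprK. Qed.

(** * The action of permutations on polynomials and words *)

Lemma mpolyX_mon w : 'X_[mon w] = \prod_j 'X_[letter_mon w j] :> poly.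
Proof. exact: (big_morph (fun u => 'X_[u] : poly) (@mpolyXD _ k) (@mpolyX0 _
    k)). Qed.

Lemma poly_act_mon s w : poly_act s 'X_[mon w] = 'X_[mon (word_act w s)] :> poly.
Proof.
rewrite !mpolyX_mon /poly_act rmorph_prod /= [RHS](reindex_inj (@perm_inj _ s)) /=.
apply: eq_bigr => j _; rewrite /letter_mon ffunE permK.
case: (unlift _ _) => [i|]; first exact: poly_act_xvar.
by rewrite mpolyX0 rmorph1.
Qed.

Lemma poly_act_of s (v : 'rV[k]_#|{: word}|) :
  poly_act s (poly_of v) = poly_of (v *m word_repr k n m.+1 s).
Proof.
rewrite {1 2}[v]row_word_sum mulmx_suml !(raddf_sum poly_of) /poly_act
    raddf_sum; apply: eq_bigr => a _ /=.
by rewrite -scalemxAl !linearZ /= word_vecE !poly_of_word -poly_act_mon.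
Qed.

End Monomials.

(** * The decomposition of the Galois closure *)

Lemma linear_pack (k : pzRingType) (U V : lmodType k) (f : U -> V) :
  linear f -> exists F : {linear U -> V}, F =1 f.
Proof.
move=> lf; pose F : {linear U -> V} := HB.pack f (GRing.isLinear.Build k U V _ f
    lf).
by exists F.
Qed.

Section Assembly.

Variables (k : fieldType) (n m l : nat).
Hypothesis charf0 : [pchar k] =i pred0.
Hypothesis n_gt0 : (0 < n)%N.
Hypothesis lE : l = minn n m.+1.
Local Notation word := (word n m.+1).
Local Notation W := (word_repr k n m.+1).
Local Notation U := (relations k n m).
Local Notation galpi := (@galpi k m n).
Local Notation poly_of := (@poly_of k m n).

Lemma cap_C_U P : (compl_sum charf0 P :&: U = 0)%MS.
Proof. by apply/eqP; rewrite -submx0 capmxC cap_compl_sum. Qed.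

Lemma add_C_U : (compl_sum charf0 (fun c : content n m => true) + U :=: 1%:M)%MS.
Proof. by rewrite addsmxC; apply: add_compl_sum. Qed.

(** Project onto the invariant complement of the relations, then use that the
    target has the same multiplicities as this complement. *)
Lemma quotient_map : exists Q : 'M[k]_(#|{: word}|, rdegree (target k n m l)),
  [/\ U *m Q = 0, forall s, W s *m Q = Q *m target k n m l s,
      forall v : 'rV_#|{: word}|, v *m Q = 0 -> (v <= U)%MS & row_full Q].
Proof.
set C := compl_sum charf0 (fun c : content n m => true); have modC :=
    compl_sum_module charf0 (fun c : content n m => true).
have dCU : (C :&: U = 0)%MS by apply: cap_C_U.
have [B E fB hom] := compl_sum_target charf0 n_gt0 lE.
have projC r (v : 'M_(r, _)) : (v *m proj_mx C U <= C)%MS by apply: proj_mx_sub.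
have projC1 : (proj_mx C U <= C)%MS by rewrite -[proj_mx _ _]mul1mx.
exists (in_submod C (proj_mx C U) *m B); split.
- by rewrite mulmxA in_submodE mulmxA proj_mx_0 // !mul0mx.
- move=> s; rewrite -[RHS]mulmxA -hom ?inE // [LHS]mulmxA [RHS]mulmxA; congr (_
    *m _).
  rewrite -(in_submodJ modC) // in_submodE mulmxA -in_submodE; congr (in_submod
      _ _).
  have H := proj_mx_hom dCU modC (relations_module k n m); rewrite add_C_U in H.
  by have /hom_mxP/(_ s) := H; rewrite inE !mul1mx => ->.
- move=> v; rewrite mulmxA => /eqP; rewrite mulmx_free_eq0 // in_submodE mulmxA
    -in_submodE.
  move=> /eqP v0; have := in_submodK (projC _ v); rewrite v0 linear0 => vp.
  have := @proj_mx_compl_sub _ _ _ C U v; rewrite -vp subr0; apply.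
  by rewrite add_C_U submx1.
rewrite /row_full mxrankMfree // mxrank_in_submod // -[X in _ == X]E eqn_leq
    mxrankS //=.
apply: mxrankS; rewrite -[X in (X <= _)%MS](proj_mx_id dCU (submx_refl C)).
exact: submxMl.
Qed.

Lemma affords_target : affords (@gal_act k m n) (target k n m l).
Proof.
have [Q [UQ homQ kerQ fullQ]] := quotient_map.
pose f (x : galclosure k m n) := coefs (repr x) *m Q.
have fE p : f (galpi p) = coefs p *m Q.
  apply/eqP; rewrite -subr_eq0 -mulmxBl -linearB /=.
  have /coefs_galpi/submxP[D ->] : galpi (repr (galpi p) - p) = 0.
    by rewrite raddfB /= {1}/Defs.galpi reprK subrr.
  by rewrite -mulmxA UQ mulmx0.
have flin : linear f.
  move=> a x y; have [p ->] := galpi_surj x; have [q ->] := galpi_surj y.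
  by rewrite -linearP !fE linearP mulmxDl -scalemxAl.
have [F FE] := linear_pack flin.
exists F.
  exists (fun y => galpi (poly_of (y *m pinvmx Q))) => [x|y]; last first.
    by rewrite FE fE poly_ofK mulmxKpV // submx_full.
  have [p ->] := galpi_surj x; rewrite FE fE -[RHS]galpi_coefs.
  apply/eqP; rewrite -subr_eq0 -raddfB -(raddfB poly_of) /= galpi_relations //.
  by apply: kerQ; rewrite mulmxBl mulmxKpV ?subrr // submx_full.
move=> s x; have [p ->] := galpi_surj x; rewrite gal_act_pi !FE !fE.
rewrite -[in RHS]mulmxA -homQ mulmxA -[coefs p *m _ s]poly_ofK -poly_act_of.
apply/eqP; rewrite -subr_eq0 -mulmxBl -linearB /=.
have /coefs_galpi/submxP[D ->] : galpi (poly_act s p - poly_act s (poly_of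
    (coefs p))) = 0.
  by rewrite raddfB /= -!gal_act_pi galpi_coefs subrr.
by rewrite -mulmxA UQ mulmx0.
Qed.

Section Graded.

Variable Q : pred nat.
Let P (c : content n m) := Q (c ord0).
Let C := compl_sum charf0 P.
Let T : 'M[k]_#|{: word}| := (\sum_(c | P c) perm_mod k c)%MS.

Lemma graded_split : (C + U + T :=: C + U)%MS.
Proof.
apply/addsmx_idPl/sumsmx_subP => c Pc; have [_ <- _] := compl_modP charf0 c.
by rewrite addsmx_sub (submx_trans (capmxSr _ _)) ?addsmxSr // (submx_trans _
    (addsmxSl _ _)) // (sumsmx_sup c).
Qed.

Lemma C_sub_T : (C <= T)%MS.
Proof.
by apply/sumsmx_subP => c Pc; apply: submx_trans (compl_mod_sub charf0 c) _;
    rewrite (sumsmx_sup c).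
Qed.

Lemma T_support (v : 'rV[k]_#|{: word}|) :
  (v <= T)%MS <-> forall w, v 0 (enum_rank w) != 0 -> Q (zeros w).
Proof.
split=> [vT w|H].
  apply: contraNT => nQ.
  have : (T <= kermx (delta_mx (enum_rank w) 0 : 'cV[k]_#|{: word}|))%MS.
    apply/sumsmx_subP => c Pc; apply/sumsmx_subP => w' cw'; rewrite genmxE;
        apply/sub_kermxP.
    rewrite /word_vec mul_delta_mx_cond; case: eqP => // /enum_rank_inj E.
    by move: nQ; rewrite -E (zerosE cw') -/(P c) Pc.
  move/(submx_trans vT)/sub_kermxP/matrixP/(_ 0 0); rewrite !mxE => E; apply/eqP.
  rewrite -[RHS]E (bigD1 (enum_rank w)) //= mxE !eqxx mulr1 big1 ?addr0 // => a ne.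
  by rewrite mxE (negPf ne) mulr0.
rewrite [v]row_word_sum; apply: summx_sub => a _.
have [->|nz] := eqVneq (v 0 a) 0; first by rewrite scale0r sub0mx.
apply: scalemx_sub; rewrite (sumsmx_sup (content_of (enum_val a))) //.
  rewrite /P -(zerosE (w := enum_val a)) ?has_cntE //.
  by apply: H; rewrite enum_valK.
by rewrite word_vec_sub // has_cntE.
Qed.

(** The part V of the Galois closure spanned by the words whose number of zeros
    satisfies Q is isomorphic to the complement C of the relations among them. *)
Lemma graded_dim (V : galclosure k m n -> Prop) d :
    (forall x, V x <-> exists2 v : 'rV_#|{: word}|, (v <= T)%MS & x = galpi
        (poly_of v)) ->
    d = \rank C ->
  has_dim V d.
Proof.
move=> VE ->.
have base_sub (D : 'rV[k]_(\rank C)) : (D *m row_base C <= C)%MS.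
  by apply: submx_trans (submxMl _ _) _; rewrite eq_row_base.
pose f (u : 'rV[k]_(\rank C)) := galpi (poly_of (u *m row_base C)).
have flin : linear f by move=> a u u'; rewrite /f mulmxDl -scalemxAl !linearP.
have [F FE] := linear_pack flin.
exists F.
  move=> u u'; rewrite !FE /f => /eqP; rewrite -subr_eq0 -raddfB -(raddfB
      poly_of) /= => /eqP.
  move/coefs_galpi; rewrite poly_ofK -mulmxBl => sub.
  have : ((u - u') *m row_base C <= (0 : 'M[k]_#|{: word}|))%MS.
    rewrite -[X in (_ <= X)%MS](cap_C_U P) sub_capmx sub andbT.
    exact: base_sub.
  rewrite submx0 mulmx_free_eq0 ?row_base_free // subr_eq0.
  by move/eqP.
move=> x; rewrite VE; split=> [[v vT ->]|[u ->]].
  have : (v <= C + U)%MS.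
    apply: submx_trans vT _; rewrite -graded_split; exact: addsmxSr.
  case/sub_addsmxP=> -[a b] /= ->.
  have /submxP[D ->] : (a *m C <= row_base C)%MS by rewrite eq_row_base submxMl.
  exists D; rewrite FE /f (raddfD poly_of) raddfD /=.
  by rewrite [X in _ + X]galpi_relations ?addr0 // submxMl.
exists (u *m row_base C) => //; apply: submx_trans C_sub_T.
exact: base_sub.
Qed.

End Graded.

Lemma galclosure_dim : has_dim (fun _ : galclosure k m n => True)
  (\rank (compl_sum charf0 (fun c : content n m => true))).
Proof.
apply: (@graded_dim xpredT) => // x; split=> // _.
have [p ->] := galpi_surj x; exists (coefs p); last by rewrite galpi_coefs.
by apply/(T_support xpredT).
Qed.

Lemma msupp_poly_of (v : 'rV[k]_#|{: word}|) u : u \in msupp (poly_of v) ->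
  exists2 w, v 0 (enum_rank w) != 0 & u = mon w.
Proof.
rewrite mcoeff_msupp /poly_of raddf_sum /= => nz.
suff /existsP[w /andP[vw /eqP ->]] : [exists w, (v 0 (enum_rank w) != 0) && (u
    == mon w)].
  by exists w.
apply: contraNT nz; rewrite negb_exists => /forallP H; apply/eqP.
rewrite big1 // => a _; rewrite mcoeffZ mcoeffX.
have := H (enum_val a); rewrite enum_valK negb_and negbK.
by case/orP=> [/eqP->|]; [rewrite mul0r | rewrite eq_sym => /negPf->; rewrite
    mulr0].
Qed.

Lemma gal_degree_dim (i : int) : has_dim (@gal_degree k m n i)
  (\rank (compl_sum charf0 (fun c : content n m => (c ord0 : nat)%:Z == n%:Z - i))).
Proof.
pose Q (z : nat) := z%:Z == n%:Z - i; apply: (@graded_dim Q) => // x.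
have degE (w : word) : (mdeg (mon w))%:Z = i <-> (zeros w)%:Z == n%:Z - i.
  have := mdeg_mon w; move: (mdeg (mon w)) (zeros w) => d z E.
  by split=> [<-|/eqP z_]; [apply/eqP|]; lia.
split=> [[p hom ->]|[v /(T_support Q) vT ->]].
  exists (coefs p); last by rewrite galpi_coefs.
  apply/(T_support Q) => w; rewrite mxE enum_rankK -mcoeff_msupp => win.
  exact/degE/hom.
exists (poly_of v) => // u /msupp_poly_of[w nz ->].
exact/degE/vT.
Qed.

End Assembly.

Theorem theorem1p6 (k : closedFieldType) (m n : nat) :
  [pchar k] =i pred0 -> (0 < m)%N -> (0 < n)%N ->
  let l := minn n m.+1 in
  [/\ affords (@gal_act k m n)
        (\big[dadd_grepr/grepr0]_(lambda : intpart n l)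
          \big[dadd_grepr/grepr0]_(mu : intpart n l
               | dominates mu lambda && (part mu 0 == part lambda 0))
            muln_grepr (specht k mu) (kappa m lambda * kostka mu lambda)),
      has_dim (fun _ : galclosure k m n => True)
        (\sum_(lambda : intpart n l)
          \sum_(mu : intpart n l
               | dominates mu lambda && (part mu 0 == part lambda 0))
            kappa m lambda * kostka mu lambda * rdegree (specht k mu))%N
    & forall i : int,
      has_dim (@gal_degree k m n i)
        (\sum_(lambda : intpart n l | ((part lambda 0)%:Z == n%:Z - i)%R)
          \sum_(mu : intpart n l
               | dominates mu lambda && (part mu 0 == part lambda 0))
            kappa m lambda * kostka mu lambda * rdegree (specht k mu))%N].
Proof.
move=> charf0 _ n_gt0 l; have lE : l = minn n m.+1 by [].
split; first exact: (affords_target charf0 n_gt0 lE).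
  rewrite -(rank_closure charf0 n_gt0 lE xpredT); exact: galclosure_dim.
move=> i; rewrite -(rank_closure charf0 n_gt0 lE (fun z => z%:Z == n%:Z - i)).
exact: gal_degree_dim.
Qed.
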